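(* Let $G$ be a smooth function, let $m_G$ be defined implicitly by $x=\pi\int_{\sqrt{m_G(x)}}^{+\infty}\eta(it/2)^4G(R(e^{-\pi t}))dt$, with inverse $m_G^{(-1)}$, put $y(x)=R\!\left(e^{-\pi\sqrt{m_G(x)}}\right)$ and $Q_{n^2}(A)=m_G\!\left(n^2 m_G^{(-1)}(A)\right)$. For $n>0$ set $H_n(x)=\Omega_{1/n}\circ F_1\circ b(x)=\Omega_{1/n}\!\left(F_1(b_x)\right)$. Then $$y(n^2x)=H_n\circ\left(n^2\cdot Q_{n^2}\right)\circ\left(n^{-2}H_n^{(-1)}\right)\circ y(x),$$ i.e. $y(n^2x)=H_n\!\left(n^2\,Q_{n^2}\!\left(n^{-2}H_n^{(-1)}(y(x))\right)\right)$.
   Context: $\eta(\tau)=e^{\pi i\tau/12}\prod_{n\ge1}(1-e^{2\pi i n\tau})$ is the Dedekind eta function; $R(q)=\cfrac{q^{1/5}}{1+\cfrac{q}{1+\cfrac{q^2}{1+\cdots}}}$ ($0<q<1$) is the Rogers–Ramanujan continued fraction. For $s>0$, $\Omega_s$ is defined by $\Omega_s(R(e^{-\pi\sqrt r}))=R(e^{-\pi s\sqrt r})$ for $r>0$. For $r>0$, $k_r\in(0,1)$ is the elliptic singular modulus ($K(\sqrt{1-k_r^2})/K(k_r)=\sqrt r$, $K(k)=\int_0^{\pi/2}(1-k^2\sin^2\theta)^{-1/2}d\theta$), and $b_r=3\sqrt[3]{2k_r}\cdot{}_2F_1\!\left[\frac16,\frac13;\frac76;k_r^2\right]$. $F_1$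 is defined by $x=5\int_0^{F_1(x)}\frac{dt}{t\sqrt[6]{t^{-5}-11-t^5}}$. $H_n^{(-1)}$ is the inverse of $H_n$. *)

(* Defs.v *)
From Stdlib Require Import Reals Lra ClassicalEpsilon.
From Coquelicot Require Import Coquelicot.
Open Scope R_scope.

(** Dedekind eta on the positive imaginary axis: for y > 0,
    etaI y = eta(i y) = e^{-pi y/12} * prod_{n>=1} (1 - e^{-2 pi n y})
    (literal unfolding of eta(tau) at tau = i y; the product is the limit
    of its partial products). *)
Fixpoint eta_partprod (y : R) (N : nat) : R :=
  match N with
  | O => 1
  | S N' => eta_partprod y N' * (1 - exp (- 2 * PI * INR N * y))
  end.

Definition etaI (y : R) : R :=
  exp (- PI * y / 12) * real (Lim_seq (eta_partprod y)).

(** Rogers-Ramanujan continued fraction.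
    rr_tail q N k = 1 + q^k/(1 + q^(k+1)/( ... /(1))) (N levels);
    the denominator 1 + q/(1 + q^2/(1 + ...)) is lim_N rr_tail q N 1. *)
Fixpoint rr_tail (q : R) (N k : nat) : R :=
  match N with
  | O => 1
  | S N' => 1 + q ^ k / rr_tail q N' (S k)
  end.

Definition RR (q : R) : R :=
  Rpower q (1/5) / real (Lim_seq (fun N => rr_tail q N 1)).

(** Omega_s (R(e^{-pi sqrt r})) = R(e^{-pi s sqrt r}) for r > 0. *)
Definition Omega (s w : R) : R :=
  RR (exp (- PI * s * sqrt
        (epsilon (inhabits 0) (fun r => 0 < r /\ RR (exp (- PI * sqrt r)) = w)))).

Definition ellK (k : R) : R :=
  RInt (fun th => / sqrt (1 - k ^ 2 * (sin th) ^ 2)) 0 (PI / 2).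

Definition k_sing (r : R) : R :=
  epsilon (inhabits 0)
    (fun k => 0 < k < 1 /\ ellK (sqrt (1 - k ^ 2)) / ellK k = sqrt r).

Fixpoint poch (a : R) (n : nat) : R :=
  match n with
  | O => 1
  | S n' => poch a n' * (a + INR n')
  end.

Definition hyp2F1 (a b c z : R) : R :=
  Series (fun n => poch a n * poch b n / (poch c n * INR (Factorial.fact n)) * z ^ n).

Definition b_sing (r : R) : R :=
  3 * Rpower (2 * k_sing r) (1/3) * hyp2F1 (1/6) (1/3) (7/6) (k_sing r ^ 2).

Definition F1_integrand (t : R) : R :=
  / (t * Rpower (/ t ^ 5 - 11 - t ^ 5) (1/6)).

Definition F1 (x : R) : R :=
  epsilon (inhabits 0)
    (fun u => 0 < u /\ (forall t, 0 < t <= u -> 0 < / t ^ 5 - 11 - t ^ 5) /\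
       is_RInt_gen F1_integrand (at_right 0) (at_point u) (x / 5)).

Definition H (n x : R) : R := Omega (1 / n) (F1 (b_sing x)).

Definition Hinv (n w : R) : R :=
  epsilon (inhabits 0) (fun x => 0 < x /\ H n x = w).

Definition mG_integrand (G : R -> R) (t : R) : R :=
  (etaI (t / 2)) ^ 4 * G (RR (exp (- PI * t))).

Definition mG_def (G : R -> R) (mG : R -> R) (x : R) : Prop :=
  0 < mG x /\
  is_RInt_gen (mG_integrand G) (at_point (sqrt (mG x))) (Rbar_locally p_infty) (x / PI).

(** The inverse m_G^{(-1)}: it is given explicitly by the defining formula. *)
Definition mG_inv (G : R -> R) (A : R) : R :=
  PI * RInt_gen (mG_integrand G) (at_point (sqrt A)) (Rbar_locally p_infty).

Definition Q (G mG : R -> R) (n A : R) : R := mG (n ^ 2 * mG_inv G A).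

Definition yfun (mG : R -> R) (x : R) : R := RR (exp (- PI * sqrt (mG x))).

Definition smooth (G : R -> R) : Prop := forall (k : nat) (x : R), ex_derive_n G k x.

(* Main.v *)
(** Everything rests on F_1(b_r) = R(e^{-pi sqrt r}) and on the injectivity of R; then
    H_n(y) = R(e^{-pi sqrt(y)/n}), its inverse sends R(e^{-pi sqrt m}) to n^2 m, and the formula is
    immediate.  With T(q) = prod (1 - q^n) and q = e^{-pi sqrt r}, the first identity follows by
    differentiating in q from
    - R(q) = q^{1/5} B/A with theta series A, B: the convergents of the continued fraction are
      Schur's alternating sums of Gaussian binomials, and A, B are products by the triple product;
    - R^{-5} - 11 - R^5 = T(q)^6 / (q T(q^5)^6): dissect theta(zeta^k; zeta^i q^{1/5}) modulo 5 and
      multiply over the fifth roots of unity;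
    - 5 q R'/R = T(q)^5 / T(q^5): the Weierstrass three-term relation at pi/5 and 2 pi/5;
    - the modulus k(q) = theta_2^2/theta_3^2 has K'/K = -ln q / pi and q k'(q)/k = theta_4^4 / 2.
      Both K'/(K ln q) and q k'(q)/(k theta_4^4) are invariant under q -> q^2 (Landen), so each equals
      its limit at q = 0;
    - k theta_4^12 / (1 - k^2) = 4 sqrt(q) T(q)^12, and the derivative in k of
      3 (2k)^{1/3} 2F1(1/6, 1/3; 7/6; k^2), which is elementary by the binomial series. *)

Require Import Defs.
From Stdlib Require Import Reals Lra Lia List Permutation ClassicalEpsilon ZArith.
From Stdlib Require FunctionalExtensionality PropExtensionality.
From Coquelicot Require Import Coquelicot.
Open Scope R_scope.

(** * Unordered summation *)

(** The modulus k_r, Omega_s, F_1 and the inverse of H_n are all picked by [epsilon], so each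
    demands both existence and uniqueness of a solution. Hence the strict monotonicity of R and of
    K'/K and the positivity of the integrand of F_1. The singular endpoint 0 of the integral of F_1
    is reached through R itself: R increases, takes all small positive values, and b tends to 0 with
    q.

    Infinite sums are unordered sums over arbitrary index types, because the theta identities
    reindex over Z and over pairs by injections and by parity or residue splittings. Interchanges of
    limit and sum, termwise differentiation included, rest on one dominated convergence statement
    for arbitrary filters.

    No complex analysis enters. In place of Liouville's theorem, a product of two theta series is
    rewritten by the substitution (a + b, a - b); this exhibits a skew form of rank two, whose
    Plucker relation is the three-term relation. The 11 of the quintic is l^5 + m^5 for the golden
    ratio l and its conjugate m. *)

Fixpoint lsum {I : Type} (f : I -> R) (L : list I) : R :=
  match L with
  | nil => 0
  | i :: L' => f i + lsum f L'
  end.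

Definition summable {I : Type} (f : I -> R) : Prop :=
  exists M, forall L, NoDup L -> lsum (fun i => Rabs (f i)) L <= M.

(** Convergence along the net of finite subsets, coded as duplicate-free lists ordered by [incl].
    Independence of the order of summation is built in, so reindexing needs no rearrangement
    theorem. *)
Definition is_sum {I : Type} (f : I -> R) (s : R) : Prop :=
  forall eps, 0 < eps -> exists L0, NoDup L0 /\
    forall L, NoDup L -> incl L0 L -> Rabs (lsum f L - s) < eps.

Definition Sum {I : Type} (f : I -> R) : R := epsilon (inhabits 0) (is_sum f).

Lemma eq_dec_classic {I : Type} (x y : I) : {x = y} + {x <> y}.
Proof. apply excluded_middle_informative. Qed.

Lemma lsum_ext {I : Type} (f g : I -> R) (L : list I) :
  (forall i, In i L -> f i = g i) -> lsum f L = lsum g L.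
Proof.
  induction L as [|a L IH]; intros h; simpl; [reflexivity|].
  rewrite h by (left; reflexivity). rewrite IH; [reflexivity|].
  intros i hi; apply h; right; exact hi.
Qed.

Lemma lsum_le {I : Type} (f g : I -> R) (L : list I) :
  (forall i, In i L -> f i <= g i) -> lsum f L <= lsum g L.
Proof.
  induction L as [|a L IH]; intros h; simpl; [lra|].
  apply Rplus_le_compat; [apply h; left; reflexivity|].
  apply IH; intros i hi; apply h; right; exact hi.
Qed.

Lemma lsum_ge0 {I : Type} (f : I -> R) (L : list I) :
  (forall i, In i L -> 0 <= f i) -> 0 <= lsum f L.
Proof.
  induction L as [|a L IH]; intros h; simpl; [lra|].
  apply Rplus_le_le_0_compat; [apply h; left; reflexivity|].
  apply IH; intros i hi; apply h; right; exact hi.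
Qed.

Lemma lsum_lin {I : Type} (a b : R) (f g : I -> R) (L : list I) :
  lsum (fun i => a * f i + b * g i) L = a * lsum f L + b * lsum g L.
Proof. induction L as [|c L IH]; simpl; [ring|rewrite IH; ring]. Qed.

Lemma lsum_app {I : Type} (f : I -> R) (L1 L2 : list I) :
  lsum f (L1 ++ L2) = lsum f L1 + lsum f L2.
Proof. induction L1 as [|a L IH]; simpl; [ring|rewrite IH; ring]. Qed.

Lemma lsum_perm {I : Type} (f : I -> R) (L1 L2 : list I) :
  Permutation L1 L2 -> lsum f L1 = lsum f L2.
Proof. induction 1; simpl; lra. Qed.

Lemma lsum_map {I J : Type} (h : I -> J) (f : J -> R) (L : list I) :
  lsum f (map h L) = lsum (fun i => f (h i)) L.
Proof. induction L as [|a L IH]; simpl; [reflexivity|rewrite IH; reflexivity]. Qed.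

Lemma Rabs_lsum {I : Type} (f : I -> R) (L : list I) :
  Rabs (lsum f L) <= lsum (fun i => Rabs (f i)) L.
Proof.
  induction L as [|a L IH]; simpl; [rewrite Rabs_R0; lra|].
  eapply Rle_trans; [apply Rabs_triang|lra].
Qed.

(** The device for comparing two finite partial sums: up to permutation the larger list is the
    smaller one followed by a disjoint remainder. *)
Lemma incl_split {I : Type} (L0 L : list I) :
  NoDup L0 -> NoDup L -> incl L0 L ->
  exists L', NoDup L' /\ Permutation L (L0 ++ L') /\ (forall i, In i L' -> ~ In i L0).
Proof.
  intros n0 n1 hi.
  pose (p := fun i => if in_dec eq_dec_classic i L0 then false else true).
  assert (hp : forall i, In i (filter p L) <-> In i L /\ ~ In i L0).
  { intro i. rewrite filter_In. unfold p. destruct in_dec; split; intros [a b]; split; auto; easy. }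
  exists (filter p L). split; [apply NoDup_filter; exact n1|]. split; [|intros i h; apply hp in h; tauto].
  apply NoDup_Permutation; [exact n1| |].
  - apply NoDup_app; [exact n0|apply NoDup_filter; exact n1|]. intros i h1 h2. apply hp in h2. tauto.
  - intro i. rewrite in_app_iff, hp. split.
    + intro h. destruct (in_dec eq_dec_classic i L0); tauto.
    + intros [h|h]; [apply hi; exact h|tauto].
Qed.

Lemma list_join {I : Type} (L1 L2 : list I) :
  exists L, NoDup L /\ incl L1 L /\ incl L2 L.
Proof.
  exists (nodup eq_dec_classic (L1 ++ L2)). split; [apply NoDup_nodup|].
  split; intros i h; apply nodup_In, in_app_iff; tauto.
Qed.

Lemma is_sum_unique {I : Type} (f : I -> R) (s1 s2 : R) :
  is_sum f s1 -> is_sum f s2 -> s1 = s2.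
Proof.
  intros h1 h2. destruct (Req_dec s1 s2) as [e|ne]; [exact e|exfalso].
  assert (he : 0 < Rabs (s1 - s2) / 2). { assert (0 < Rabs (s1 - s2)) by (apply Rabs_pos_lt; lra). lra. }
  destruct (h1 _ he) as [L1 [_ k1]]. destruct (h2 _ he) as [L2 [_ k2]].
  destruct (list_join L1 L2) as [L [n [i1 i2]]].
  specialize (k1 L n i1). specialize (k2 L n i2).
  assert (Rabs (s1 - s2) <= Rabs (lsum f L - s1) + Rabs (lsum f L - s2)).
  { replace (s1 - s2) with (- (lsum f L - s1) + (lsum f L - s2)) by ring.
    eapply Rle_trans; [apply Rabs_triang|]. rewrite Rabs_Ropp. lra. }
  lra.
Qed.

Lemma Sum_unique {I : Type} (f : I -> R) (s : R) : is_sum f s -> Sum f = s.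
Proof.
  intro h. apply is_sum_unique with f; [|exact h].
  unfold Sum. apply epsilon_spec. exists s; exact h.
Qed.

Lemma is_sum_lin {I : Type} (a b : R) (f g : I -> R) (s t : R) :
  is_sum f s -> is_sum g t -> is_sum (fun i => a * f i + b * g i) (a * s + b * t).
Proof.
  intros hf hg eps he.
  set (m := Rabs a + Rabs b + 1).
  assert (hm : 0 < m) by (unfold m; pose proof (Rabs_pos a); pose proof (Rabs_pos b); lra).
  assert (he' : 0 < eps / m) by (apply Rdiv_lt_0_compat; lra).
  destruct (hf _ he') as [L1 [_ k1]]. destruct (hg _ he') as [L2 [_ k2]].
  destruct (list_join L1 L2) as [L0 [n [i1 i2]]].
  exists L0. split; [exact n|]. intros L nL iL.
  specialize (k1 L nL (incl_tran i1 iL)). specialize (k2 L nL (incl_tran i2 iL)).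
  rewrite lsum_lin.
  replace (a * lsum f L + b * lsum g L - (a * s + b * t))
    with (a * (lsum f L - s) + b * (lsum g L - t)) by ring.
  eapply Rle_lt_trans; [apply Rabs_triang|]. rewrite !Rabs_mult.
  apply Rle_lt_trans with ((Rabs a + Rabs b) * (eps / m)).
  - pose proof (Rabs_pos a); pose proof (Rabs_pos b). nra.
  - replace eps with (m * (eps / m)) at 2 by (field; lra). unfold m at 2. nra.
Qed.

Lemma is_sum_ext {I : Type} (f g : I -> R) (s : R) :
  (forall i, f i = g i) -> is_sum f s -> is_sum g s.
Proof.
  intros h hf eps he. destruct (hf eps he) as [L0 [n k]]. exists L0; split; [exact n|].
  intros L nL iL. rewrite <- (lsum_ext f g); [apply k; assumption|]. intros; apply h.
Qed.

Lemma is_sum_nonneg {I : Type} (f : I -> R) :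
  (forall i, 0 <= f i) -> summable f -> exists s, is_sum f s.
Proof.
  intros hp [M hM].
  assert (e : forall L, lsum (fun i => Rabs (f i)) L = lsum f L).
  { intro L; apply lsum_ext; intros; apply Rabs_pos_eq, hp. }
  destruct (completeness (fun y => exists L, NoDup L /\ y = lsum f L)) as [s [ub lub]].
  - exists M. intros y [L [n ->]]. rewrite <- e. apply hM; exact n.
  - exists 0, nil. split; [constructor|reflexivity].
  - exists s. intros eps he.
    destruct (excluded_middle_informative (exists L0, NoDup L0 /\ s - eps < lsum f L0)) as [[L0 [n0 h0]]|hn].
    + exists L0. split; [exact n0|]. intros L n iL.
      destruct (incl_split L0 L n0 n iL) as [L' [n' [pm _]]].
      assert (lsum f L = lsum f L0 + lsum f L') by (rewrite (lsum_perm f _ _ pm); apply lsum_app).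
      assert (0 <= lsum f L') by (apply lsum_ge0; auto).
      assert (lsum f L <= s) by (apply ub; exists L; auto).
      apply Rabs_def1; lra.
    + exfalso. assert (s <= s - eps); [|lra]. apply lub. intros y [L [n ->]].
      apply Rnot_lt_le. intro h. apply hn. exists L; auto.
Qed.

Lemma summable_dom {I : Type} (f g : I -> R) :
  (forall i, Rabs (f i) <= g i) -> summable g -> summable f.
Proof.
  intros h [M hM]. exists M. intros L n. eapply Rle_trans; [|apply (hM L n)].
  apply lsum_le. intros i _. eapply Rle_trans; [apply h|apply Rle_abs].
Qed.

Lemma summable_lin {I : Type} (a b : R) (f g : I -> R) :
  summable f -> summable g -> summable (fun i => a * f i + b * g i).
Proof.
  intros [M hM] [N hN]. exists (Rabs a * M + Rabs b * N). intros L n.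
  eapply Rle_trans; [apply lsum_le with (g := fun i => Rabs a * Rabs (f i) + Rabs b * Rabs (g i))|].
  - intros i _. eapply Rle_trans; [apply Rabs_triang|]. rewrite !Rabs_mult; lra.
  - rewrite lsum_lin. specialize (hM L n). specialize (hN L n).
    pose proof (Rabs_pos a); pose proof (Rabs_pos b). nra.
Qed.

Lemma summable_abs {I : Type} (f : I -> R) : summable f -> summable (fun i => Rabs (f i)).
Proof.
  intros [M hM]. exists M. intros L n. erewrite lsum_ext; [apply (hM L n)|].
  intros; apply Rabs_Rabsolu.
Qed.

(** The family is written as (|f| + f) - |f|, a difference of two nonnegative summable families; the
    sum of such a family is the supremum of its finite partial sums. *)
Lemma Sum_correct {I : Type} (f : I -> R) : summable f -> is_sum f (Sum f).
Proof.
  intro hf. unfold Sum. apply epsilon_spec.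
  destruct (is_sum_nonneg (fun i => Rabs (f i))) as [s hs];
    [intro; apply Rabs_pos|apply summable_abs; exact hf|].
  destruct (is_sum_nonneg (fun i => 1 * Rabs (f i) + 1 * f i)) as [t ht].
  - intro i. assert (h := Rle_abs (- f i)). rewrite Rabs_Ropp in h. lra.
  - apply summable_lin; [apply summable_abs|]; exact hf.
  - exists (1 * t + (-1) * s). eapply is_sum_ext; [|apply is_sum_lin; [exact ht|exact hs]].
    intro i; simpl; ring.
Qed.

(** Valid without summability: if no sum exists, both values are still chosen from the same
    predicate, by extensionality. *)
Lemma Sum_ext {I : Type} (f g : I -> R) : (forall i, f i = g i) -> Sum f = Sum g.
Proof.
  intro h. destruct (excluded_middle_informative (exists s, is_sum f s)) as [[s hs]|hn].
  - rewrite (Sum_unique f s hs). symmetry; apply Sum_unique.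
    apply is_sum_ext with f; assumption.
  - unfold Sum. f_equal. apply FunctionalExtensionality.functional_extensionality.
    intro s. apply PropExtensionality.propositional_extensionality. split; apply is_sum_ext; auto.
Qed.

Lemma Sum_lin {I : Type} (a b : R) (f g : I -> R) :
  summable f -> summable g ->
  Sum (fun i => a * f i + b * g i) = a * Sum f + b * Sum g.
Proof. intros hf hg. apply Sum_unique, is_sum_lin; apply Sum_correct; assumption. Qed.

Lemma summable_ext {I : Type} (f g : I -> R) :
  (forall i, f i = g i) -> summable f -> summable g.
Proof.
  intros h [M hM]. exists M. intros L n. erewrite lsum_ext; [apply (hM L n)|].
  intros; simpl; rewrite h; reflexivity.
Qed.

Lemma summable_plus {I : Type} (f g : I -> R) :
  summable f -> summable g -> summable (fun i => f i + g i).
Proof.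
  intros hf hg. apply summable_ext with (fun i => 1 * f i + 1 * g i); [intro; ring|].
  apply summable_lin; assumption.
Qed.

Lemma summable_scal {I : Type} (a : R) (f : I -> R) :
  summable f -> summable (fun i => a * f i).
Proof.
  intros hf. apply summable_ext with (fun i => a * f i + 0 * f i); [intro; ring|].
  apply summable_lin; assumption.
Qed.

Lemma Sum_plus {I : Type} (f g : I -> R) :
  summable f -> summable g -> Sum (fun i => f i + g i) = Sum f + Sum g.
Proof.
  intros hf hg. rewrite (Sum_ext _ (fun i => 1 * f i + 1 * g i)) by (intro; ring).
  rewrite Sum_lin by assumption. ring.
Qed.

Lemma Sum_scal {I : Type} (a : R) (f : I -> R) :
  summable f -> Sum (fun i => a * f i) = a * Sum f.
Proof.
  intros hf. rewrite (Sum_ext _ (fun i => a * f i + 0 * f i)) by (intro; ring).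
  rewrite Sum_lin by assumption. ring.
Qed.

Lemma summable_minus {I : Type} (f g : I -> R) :
  summable f -> summable g -> summable (fun i => f i - g i).
Proof.
  intros hf hg. apply summable_ext with (fun i => 1 * f i + (-1) * g i); [intro; ring|].
  apply summable_lin; assumption.
Qed.

Lemma Sum_minus {I : Type} (f g : I -> R) :
  summable f -> summable g -> Sum (fun i => f i - g i) = Sum f - Sum g.
Proof.
  intros hf hg. rewrite (Sum_ext _ (fun i => 1 * f i + (-1) * g i)) by (intro; ring).
  rewrite Sum_lin by assumption. ring.
Qed.

Lemma is_sum_finite {I : Type} (f : I -> R) (L0 : list I) :
  NoDup L0 -> (forall i, ~ In i L0 -> f i = 0) -> is_sum f (lsum f L0).
Proof.
  intros n0 h eps he. exists L0. split; [exact n0|]. intros L n iL.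
  destruct (incl_split L0 L n0 n iL) as [L' [_ [pm hd]]].
  rewrite (lsum_perm f _ _ pm), lsum_app.
  assert (lsum f L' = 0) as ->.
  { clear pm. induction L' as [|a L' IH]; simpl; [reflexivity|].
    rewrite h, IH; [ring| |apply hd; left; reflexivity]. intros; apply hd; right; assumption. }
  replace (lsum f L0 + 0 - lsum f L0) with 0 by ring. rewrite Rabs_R0; exact he.
Qed.

Lemma summable_finite {I : Type} (f : I -> R) (L0 : list I) :
  (forall i, ~ In i L0 -> f i = 0) -> summable f.
Proof.
  intros h0. pose (K := nodup eq_dec_classic L0).
  assert (h : forall i, ~ In i K -> f i = 0).
  { intros i hi; apply h0; intro; apply hi, nodup_In; assumption. }
  assert (nK : NoDup K) by apply NoDup_nodup.
  exists (lsum (fun i => Rabs (f i)) K). intros L n.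
  destruct (list_join L K) as [U [nU [i1 i2]]].
  destruct (incl_split L U n nU i1) as [L' [_ [pm _]]].
  destruct (incl_split K U nK nU i2) as [L2 [_ [pm2 d2]]].
  assert (lsum (fun i => Rabs (f i)) L2 = 0).
  { clear pm2. induction L2 as [|a L2 IH]; simpl; [reflexivity|].
    rewrite h, Rabs_R0, IH; [ring| |apply d2; left; reflexivity]. intros; apply d2; right; assumption. }
  assert (e1 := lsum_perm (fun i => Rabs (f i)) _ _ pm). assert (e2 := lsum_perm (fun i => Rabs (f i)) _ _ pm2).
  rewrite lsum_app in e1, e2.
  assert (0 <= lsum (fun i => Rabs (f i)) L') by (apply lsum_ge0; intros; apply Rabs_pos). lra.
Qed.

Lemma Sum_le {I : Type} (f g : I -> R) :
  (forall i, f i <= g i) -> summable f -> summable g -> Sum f <= Sum g.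
Proof.
  intros h hf hg. apply Rnot_lt_le. intro hl.
  set (eps := (Sum f - Sum g) / 2). assert (he : 0 < eps) by (unfold eps; lra).
  destruct (Sum_correct f hf eps he) as [L1 [_ k1]]. destruct (Sum_correct g hg eps he) as [L2 [_ k2]].
  destruct (list_join L1 L2) as [L [n [i1 i2]]].
  specialize (k1 L n i1). specialize (k2 L n i2). apply Rabs_def2 in k1, k2.
  assert (lsum f L <= lsum g L) by (apply lsum_le; auto). unfold eps in *. lra.
Qed.

Lemma Sum_ge_lsum {I : Type} (f : I -> R) (L0 : list I) :
  (forall i, 0 <= f i) -> summable f -> NoDup L0 -> lsum f L0 <= Sum f.
Proof.
  intros hp hf n0. apply Rnot_lt_le. intro hl.
  set (eps := lsum f L0 - Sum f). assert (he : 0 < eps) by (unfold eps; lra).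
  destruct (Sum_correct f hf eps he) as [L1 [_ k1]].
  destruct (list_join L0 L1) as [L [n [i1 i2]]].
  specialize (k1 L n i2). apply Rabs_def2 in k1.
  destruct (incl_split L0 L n0 n i1) as [L' [_ [pm _]]].
  rewrite (lsum_perm f _ _ pm), lsum_app in k1.
  assert (0 <= lsum f L') by (apply lsum_ge0; auto). unfold eps in *. lra.
Qed.

Lemma Rabs_Sum_le {I : Type} (f g : I -> R) :
  (forall i, Rabs (f i) <= g i) -> summable g -> Rabs (Sum f) <= Sum g.
Proof.
  intros h hg. assert (hf := summable_dom f g h hg).
  apply Rabs_le. split.
  - replace (- Sum g) with ((-1) * Sum g) by ring. rewrite <- Sum_scal by exact hg.
    apply Sum_le; [|apply summable_scal; exact hg|exact hf].
    intro i. specialize (h i). apply Rabs_le_between in h. lra.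
  - apply Sum_le; [|exact hf|exact hg]. intro i. specialize (h i). apply Rabs_le_between in h. lra.
Qed.

(** The map [e] is an injection whose image contains the support of [f]. This is more flexible than
    a bijection: the splittings by parity and by residues modulo 5 only have to be shown injective
    and exhaustive. *)
Lemma is_sum_reindex {I J : Type} (e : I -> J) (f : J -> R) (s : R) :
  (forall i1 i2, e i1 = e i2 -> i1 = i2) ->
  (forall j, (forall i, e i <> j) -> f j = 0) ->
  is_sum (fun i => f (e i)) s -> is_sum f s.
Proof.
  intros inj hz hs eps he. destruct (hs eps he) as [L0 [n0 k]].
  exists (map e L0). split; [apply FinFun.Injective_map_NoDup; [intros x y; apply inj|exact n0]|].
  intros L n iL.
  (* [K] lists the preimages of the members of [L]; members outside the image of [e] contribute
     zero. *)
  assert (hL : exists K, NoDup K /\ incl L0 K /\ lsum (fun i => f (e i)) K = lsum f L).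
  { assert (hK : forall L, NoDup L -> exists K, NoDup K /\ lsum (fun i => f (e i)) K = lsum f L /\
      (forall i, In i K <-> In (e i) L)).
    { clear - inj hz. induction L as [|j L IH]; intro n.
      - exists nil. repeat split; simpl; auto; constructor.
      - inversion n; subst. destruct (IH H2) as [K [nK [e1 e2]]].
        destruct (excluded_middle_informative (exists i, e i = j)) as [[i hi]|hn].
        + exists (i :: K). split; [constructor; [rewrite e2, hi; exact H1|exact nK]|].
          split; [simpl; rewrite hi, e1; reflexivity|]. intro i'. simpl. rewrite e2, <- hi.
          split; intros [h|h]; auto. subst; auto.
        + exists K. split; [exact nK|]. split.
          * simpl. rewrite (hz j), e1; [ring|]. intros i hi; apply hn; exists i; exact hi.
          * intro i. rewrite e2. simpl. split; [auto|]. intros [h|h]; [|exact h].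
            exfalso; apply hn; exists i; auto. }
    destruct (hK L n) as [K [nK [e1 e2]]]. exists K. split; [exact nK|]. split; [|exact e1].
    intros i hi. apply e2, iL, in_map, hi. }
  destruct hL as [K [nK [iK eK]]]. rewrite <- eK. apply k; assumption.
Qed.

Lemma summable_inj {I J : Type} (e : I -> J) (f : J -> R) :
  (forall i1 i2, e i1 = e i2 -> i1 = i2) -> summable f -> summable (fun i => f (e i)).
Proof.
  intros inj [M hM]. exists M. intros L n. rewrite <- (lsum_map e (fun j => Rabs (f j))).
  apply hM. apply FinFun.Injective_map_NoDup; [intros x y; apply inj|exact n].
Qed.

Lemma Sum_reindex {I J : Type} (e : I -> J) (f : J -> R) :
  (forall i1 i2, e i1 = e i2 -> i1 = i2) ->
  (forall j, (forall i, e i <> j) -> f j = 0) ->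
  summable f -> Sum f = Sum (fun i => f (e i)).
Proof.
  intros inj hz hf. apply Sum_unique. apply is_sum_reindex with e; auto.
  apply Sum_correct, summable_inj; assumption.
Qed.

Lemma Sum_bij {I J : Type} (e : I -> J) (d : J -> I) (f : J -> R) :
  (forall i, d (e i) = i) -> (forall j, e (d j) = j) ->
  summable f -> Sum f = Sum (fun i => f (e i)).
Proof.
  intros h1 h2 hf. apply Sum_reindex; [| |exact hf].
  - intros i1 i2 h. rewrite <- (h1 i1), h, h1. reflexivity.
  - intros j h. exfalso. apply (h (d j)), h2.
Qed.

Lemma is_sum_tail {I : Type} (g : I -> R) (eps : R) :
  summable g -> 0 < eps -> exists L0, NoDup L0 /\
    forall L, NoDup L -> (forall i, In i L -> ~ In i L0) -> lsum (fun i => Rabs (g i)) L < eps.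
Proof.
  intros hg he. assert (ha := summable_abs g hg).
  assert (he2 : 0 < eps / 2) by lra.
  destruct (Sum_correct _ ha _ he2) as [L0 [n0 k]].
  exists L0. split; [exact n0|]. intros L n hd.
  assert (n1 : NoDup (L0 ++ L)). { apply NoDup_app; auto. intros a h1 h2. exact (hd a h2 h1). }
  assert (k1 := k L0 n0 (incl_refl L0)).
  assert (k2 := k (L0 ++ L) n1 (incl_appl L (incl_refl L0))).
  rewrite lsum_app in k2. apply Rabs_def2 in k1, k2. lra.
Qed.

Lemma Sum_lsum_close {I : Type} (f g : I -> R) (L0 : list I) (eps : R) :
  NoDup L0 -> (forall i, Rabs (f i) <= g i) -> summable g ->
  (forall L, NoDup L -> (forall i, In i L -> ~ In i L0) -> lsum (fun i => Rabs (g i)) L < eps) ->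
  Rabs (Sum f - lsum f L0) <= eps.
Proof.
  intros n0 hfg hg ht. apply Rnot_lt_le. intro hl.
  assert (hf := summable_dom f g hfg hg).
  set (e := Rabs (Sum f - lsum f L0) - eps). assert (he : 0 < e) by (unfold e; lra).
  destruct (Sum_correct f hf e he) as [L1 [_ k]].
  destruct (list_join L0 L1) as [L [n [i1 i2]]]. specialize (k L n i2).
  destruct (incl_split L0 L n0 n i1) as [L' [n' [pm hd]]].
  rewrite (lsum_perm f _ _ pm), lsum_app in k.
  specialize (ht L' n' hd).
  assert (Rabs (lsum f L') <= lsum (fun i => Rabs (g i)) L').
  { eapply Rle_trans; [apply Rabs_lsum|]. apply lsum_le. intros i _.
    eapply Rle_trans; [apply hfg|apply Rle_abs]. }
  assert (Rabs (Sum f - lsum f L0) <= Rabs (lsum f L0 + lsum f L' - Sum f) + Rabs (lsum f L')).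
  { replace (Sum f - lsum f L0) with (- (lsum f L0 + lsum f L' - Sum f) + lsum f L') by ring.
    eapply Rle_trans; [apply Rabs_triang|]. rewrite Rabs_Ropp. lra. }
  unfold e in k. lra.
Qed.

Lemma filterlim_lsum {T I : Type} (F : (T -> Prop) -> Prop) {FF : Filter F}
  (f : T -> I -> R) (l : I -> R) (L : list I) :
  (forall i, filterlim (fun t => f t i) F (locally (l i))) ->
  filterlim (fun t => lsum (f t) L) F (locally (lsum l L)).
Proof.
  intro h. induction L as [|a L IH]; simpl; [apply filterlim_const|].
  eapply filterlim_comp_2; [apply h|apply IH|apply (filterlim_plus (V := R_NormedModule))].
Qed.

(** Dominated convergence (Tannery) for any proper filter. A finite list [L0] leaves a tail of the
    majorant below eps/4; on [L0] the convergence is termwise, and both tails cost at most eps/4.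
    The filter is general because it serves for sequences and for punctured neighbourhoods alike. *)
Lemma filterlim_Sum {T I : Type} (F : (T -> Prop) -> Prop) {FF : ProperFilter F}
  (f : T -> I -> R) (l g : I -> R) :
  summable g -> F (fun t => forall i, Rabs (f t i) <= g i) ->
  (forall i, filterlim (fun t => f t i) F (locally (l i))) ->
  filterlim (fun t => Sum (f t)) F (locally (Sum l)).
Proof.
  intros hg hd hl.
  assert (hlg : forall i, Rabs (l i) <= g i).
  { intro i.
    assert (k : filterlim (fun t => Rabs (f t i)) F (locally (Rabs (l i)))).
    { eapply filterlim_comp; [apply hl|apply continuous_Rabs]. }
    apply (filterlim_le (F := F) (fun t => Rabs (f t i)) (fun _ => g i) (Rabs (l i)) (g i));
      [|exact k|apply filterlim_const].
    revert hd. apply filter_imp. intros t h; apply h. }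
  apply filterlim_locally. intros [eps he].
  assert (he3 : 0 < eps / 4) by lra.
  destruct (is_sum_tail g (eps / 4) hg he3) as [L0 [n0 ht]].
  assert (h0 := filterlim_lsum F f l L0 hl).
  assert (h1 := proj1 (filterlim_locally _ _) h0 (mkposreal _ he3)).
  generalize (filter_and _ _ hd h1). apply filter_imp. intros t [d1 d2].
  assert (c1 := Sum_lsum_close (f t) g L0 _ n0 d1 hg ht).
  assert (c2 := Sum_lsum_close l g L0 _ n0 hlg hg ht).
  unfold ball in *. simpl in *. unfold AbsRing_ball in *. unfold abs, minus, plus, opp in *. simpl in *.
  replace (Sum (f t) + - Sum l) with
    ((Sum (f t) - lsum (f t) L0) + (lsum (f t) L0 + - lsum l L0) + - (Sum l - lsum l L0)) by ring.
  eapply Rle_lt_trans; [apply Rabs_triang|]. rewrite Rabs_Ropp.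
  eapply Rle_lt_trans; [apply Rplus_le_compat_r, Rabs_triang|]. lra.
Qed.

Lemma NoDup_flat_map_pair {I J : Type} (K : I -> list J) (L : list I) :
  NoDup L -> (forall i, NoDup (K i)) ->
  NoDup (flat_map (fun i => map (fun j => (i, j)) (K i)) L).
Proof.
  intros n hK. induction L as [|a L IH]; simpl; [constructor|].
  inversion n; subst. apply NoDup_app.
  - apply FinFun.Injective_map_NoDup; [intros x y h; congruence|apply hK].
  - apply IH; assumption.
  - intros [i j] h1 h2. apply in_map_iff in h1. destruct h1 as [j' [e _]]. injection e; intros; subst.
    apply in_flat_map in h2. destruct h2 as [i' [hi' hj']]. apply in_map_iff in hj'.
    destruct hj' as [j2 [e2 _]]. injection e2; intros; subst. auto.
Qed.

Lemma lsum_flat {I J : Type} (K : I -> list J) (f : I * J -> R) (L : list I) :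
  lsum f (flat_map (fun i => map (fun j => (i, j)) (K i)) L)
  = lsum (fun i => lsum (fun j => f (i, j)) (K i)) L.
Proof.
  induction L as [|a L IH]; simpl; [reflexivity|].
  rewrite lsum_app, IH, lsum_map. reflexivity.
Qed.

Lemma summable_slice {I J : Type} (f : I * J -> R) (i : I) :
  summable f -> summable (fun j => f (i, j)).
Proof. intro hf. apply (summable_inj (fun j => (i, j)) f); [|exact hf]. congruence. Qed.

(** Fubini for unordered sums. Over each row [i] a finite list [K i] is chosen that contains the
    part of [L0] lying in that row and is close to the row sum; the union of these lists then
    contains [L0]. *)
Lemma is_sum_sigma {I J : Type} (f : I * J -> R) :
  summable f -> is_sum (fun i => Sum (fun j => f (i, j))) (Sum f).
Proof.
  intros hf eps he. assert (he2 : 0 < eps / 2) by lra.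
  destruct (Sum_correct f hf _ he2) as [L0 [n0 k]].
  exists (nodup eq_dec_classic (map fst L0)). split; [apply NoDup_nodup|].
  intros L n iL.
  (* The error allowed per row: over the rows of [L] the errors add up to less than eps/2. *)
  set (d := eps / 2 / (INR (length L) + 1)).
  assert (hd : 0 < d). { apply Rdiv_lt_0_compat; [lra|]. pose proof (pos_INR (length L)); lra. }
  assert (hK : forall i, exists K, NoDup K /\ (forall j, In (i, j) L0 -> In j K) /\
     Rabs (lsum (fun j => f (i, j)) K - Sum (fun j => f (i, j))) < d).
  { intro i. destruct (Sum_correct _ (summable_slice f i hf) d hd) as [K0 [_ kK]].
    destruct (list_join K0 (map snd (filter (fun p => if eq_dec_classic (fst p) i then true else false) L0)))
      as [K [nK [i1 i2]]].
    exists K. split; [exact nK|]. split; [|apply kK; assumption].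
    intros j hj. apply i2. apply in_map_iff. exists (i, j). split; [reflexivity|].
    apply filter_In. split; [exact hj|]. simpl. destruct eq_dec_classic; auto. }
  pose (K := fun i => proj1_sig (constructive_indefinite_description _ (hK i))).
  assert (hKs : forall i, NoDup (K i) /\ (forall j, In (i, j) L0 -> In j (K i)) /\
     Rabs (lsum (fun j => f (i, j)) (K i) - Sum (fun j => f (i, j))) < d).
  { intro i. unfold K. destruct constructive_indefinite_description as [x hx]. exact hx. }
  set (U := flat_map (fun i => map (fun j => (i, j)) (K i)) L).
  assert (nU : NoDup U).
  { apply NoDup_flat_map_pair; [exact n|]. intro i; apply hKs. }
  assert (iU : incl L0 U).
  { intros [i j] h. unfold U. apply in_flat_map. exists i. split.
    - apply iL, nodup_In, in_map_iff. exists (i, j); auto.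
    - apply in_map, hKs, h. }
  specialize (k U nU iU). unfold U in k. rewrite lsum_flat in k.
  assert (hc : Rabs (lsum (fun i => Sum (fun j => f (i, j))) L
     - lsum (fun i => lsum (fun j => f (i, j)) (K i)) L) <= INR (length L) * d).
  { clearbody K d. clear - hKs. induction L as [|a L IH].
    - simpl. rewrite Rminus_diag, Rabs_R0. lra.
    - cbn [lsum length]. rewrite S_INR. destruct (hKs a) as [_ [_ h]].
      rewrite Rabs_minus_sym in h.
      match goal with |- Rabs ((?x + ?y) - (?z + ?w)) <= _ => replace (x + y - (z + w)) with ((x - z) + (y - w)) by ring end.
      eapply Rle_trans; [apply Rabs_triang|]. lra. }
  assert (INR (length L) * d < eps / 2).
  { unfold d. pose proof (pos_INR (length L)).
    apply Rmult_lt_reg_r with (INR (length L) + 1); [lra|]. field_simplify; [|lra]. lra. }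
  match goal with |- Rabs (?x - ?s) < _ =>
    match type of hc with Rabs (_ - ?y) <= _ => replace (x - s) with ((x - y) + (y - s)) by ring end end.
  eapply Rle_lt_trans; [apply Rabs_triang|]. lra.
Qed.

Lemma Sum_sigma {I J : Type} (f : I * J -> R) :
  summable f -> Sum f = Sum (fun i => Sum (fun j => f (i, j))).
Proof. intro hf. symmetry. apply Sum_unique, is_sum_sigma, hf. Qed.

Lemma Sum_swap {I J : Type} (f : I * J -> R) :
  summable f ->
  Sum (fun i => Sum (fun j => f (i, j))) = Sum (fun j => Sum (fun i => f (i, j))).
Proof.
  intro hf. rewrite <- Sum_sigma by exact hf.
  rewrite (Sum_bij (fun p : J * I => (snd p, fst p)) (fun p : I * J => (snd p, fst p)) f);
    [|intros []; reflexivity|intros []; reflexivity|exact hf].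
  rewrite Sum_sigma; [reflexivity|].
  apply (summable_inj (fun p : J * I => (snd p, fst p)) f); [|exact hf].
  intros [] []; simpl; congruence.
Qed.

Lemma summable_pair {I J : Type} (f : I * J -> R) (a : I -> R) (b : J -> R) :
  (forall i j, Rabs (f (i, j)) <= a i * b j) -> (forall i, 0 <= a i) -> (forall j, 0 <= b j) ->
  summable a -> summable b -> summable f.
Proof.
  intros hab pa pb ha hb. exists (Sum a * Sum b). intros L n.
  set (L1 := nodup eq_dec_classic (map fst L)). set (L2 := nodup eq_dec_classic (map snd L)).
  assert (h : lsum (fun p => Rabs (f p)) L <= lsum a L1 * lsum b L2).
  { set (U := flat_map (fun i => map (fun j => (i, j)) L2) L1).
    assert (eU : U = list_prod L1 L2).
    { unfold U. clear. clearbody L1 L2. induction L1 as [|x L1 IH]; simpl; [reflexivity|rewrite IH; reflexivity]. }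
    assert (nU : NoDup U).
    { apply NoDup_flat_map_pair; [|intros _]; apply NoDup_nodup. }
    assert (iU : incl L U).
    { intros [i j] hp. rewrite eU. apply in_prod; apply nodup_In, in_map_iff; exists (i, j); auto. }
    destruct (incl_split L U n nU iU) as [L' [_ [pm _]]].
    apply Rle_trans with (lsum (fun p => a (fst p) * b (snd p)) L).
    - apply lsum_le. intros [i j] _. apply hab.
    - apply Rle_trans with (lsum (fun p => a (fst p) * b (snd p)) U).
      + rewrite (lsum_perm _ _ _ pm), lsum_app.
        assert (0 <= lsum (fun p => a (fst p) * b (snd p)) L'); [|lra].
        apply lsum_ge0. intros [i j] _. apply Rmult_le_pos; auto.
      + unfold U. rewrite lsum_flat. simpl. apply Req_le. clear.
        assert (e : forall c, lsum (fun j => c * b j) L2 = c * lsum b L2).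
        { intro c. rewrite (lsum_ext _ (fun j => c * b j + 0 * b j)) by (intros; ring). rewrite lsum_lin. ring. }
        induction L1 as [|x L1 IH]; simpl; [ring|]. rewrite IH, e. ring. }
  eapply Rle_trans; [exact h|].
  assert (0 <= lsum a L1) by (apply lsum_ge0; auto). assert (0 <= lsum b L2) by (apply lsum_ge0; auto).
  apply Rmult_le_compat; auto; apply Sum_ge_lsum; auto; apply NoDup_nodup.
Qed.

(** * Series indexed by the natural numbers *)

Lemma lsum_seq (f : nat -> R) (N : nat) : lsum f (seq 0 (S N)) = sum_n f N.
Proof.
  induction N as [|N IH].
  - simpl. rewrite sum_O. ring.
  - rewrite seq_S, lsum_app, IH, sum_Sn. unfold plus; simpl. ring.
Qed.

Lemma is_lim_seq_Sum (f : nat -> R) : summable f -> is_lim_seq (sum_n f) (Sum f).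
Proof.
  intro hf. apply is_lim_seq_spec. intros [eps he].
  destruct (Sum_correct f hf eps he) as [L0 [_ k]].
  exists (list_max L0). intros N hN. simpl. rewrite <- lsum_seq. apply k; [apply seq_NoDup|].
  intros i hi. apply in_seq. split; [lia|].
  assert (h := proj1 (list_max_le L0 (list_max L0)) (Nat.le_refl _)).
  rewrite Forall_forall in h. specialize (h i hi). lia.
Qed.

Lemma summable_nat (f : nat -> R) (M : R) :
  (forall N, sum_n (fun i => Rabs (f i)) N <= M) -> summable f.
Proof.
  intro h. exists M. intros L n.
  set (N := list_max L). apply Rle_trans with (lsum (fun i => Rabs (f i)) (seq 0 (S N))).
  - assert (iL : incl L (seq 0 (S N))).
    { intros i hi. apply in_seq. split; [lia|].
      assert (hm := proj1 (list_max_le L (list_max L)) (Nat.le_refl _)).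
      rewrite Forall_forall in hm. specialize (hm i hi). unfold N. lia. }
    destruct (incl_split L _ n (seq_NoDup (S N) 0) iL) as [L' [_ [pm _]]].
    rewrite (lsum_perm _ _ _ pm), lsum_app.
    assert (0 <= lsum (fun i => Rabs (f i)) L') by (apply lsum_ge0; intros; apply Rabs_pos). lra.
  - rewrite lsum_seq. apply h.
Qed.

Lemma summable_geom (r : R) : 0 <= r < 1 -> summable (fun n => r ^ n).
Proof.
  intros hr. apply summable_nat with (/ (1 - r)). intro N.
  rewrite (sum_n_ext _ (fun n => r ^ n)).
  2:{ intro n. apply Rabs_pos_eq, pow_le; lra. }
  rewrite sum_n_Reals, tech3 by lra. apply Rmult_le_reg_r with (1 - r); [lra|].
  field_simplify; [|lra|lra]. assert (0 <= r ^ S N) by (apply pow_le; lra). simpl in *. lra.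
Qed.

Lemma Sum_geom (r : R) : 0 <= r < 1 -> Sum (fun n => r ^ n) = / (1 - r).
Proof.
  intro hr. assert (h := is_lim_seq_Sum _ (summable_geom r hr)).
  assert (h2 : is_series (fun n => r ^ n) (/ (1 - r))).
  { apply is_series_geom. rewrite Rabs_pos_eq; lra. }
  assert (h3 : is_lim_seq (sum_n (fun n => r ^ n)) (/ (1 - r))) by exact h2.
  apply is_lim_seq_unique in h, h3. rewrite h in h3. injection h3; auto.
Qed.

(** * Complex families and theta series *)

Lemma Sum_sumtype {I J : Type} (f : I + J -> R) :
  summable f -> Sum f = Sum (fun i => f (inl i)) + Sum (fun j => f (inr j)).
Proof.
  intro hf.
  pose (fl := fun p : I + J => match p with inl i => f (inl i) | inr _ => 0 end).
  pose (fr := fun p : I + J => match p with inl _ => 0 | inr j => f (inr j) end).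
  assert (hl : summable fl).
  { apply summable_dom with (fun p => Rabs (f p)); [|apply summable_abs, hf].
    intros [i|j]; simpl; [lra|rewrite Rabs_R0; apply Rabs_pos]. }
  assert (hr : summable fr).
  { apply summable_dom with (fun p => Rabs (f p)); [|apply summable_abs, hf].
    intros [i|j]; simpl; [rewrite Rabs_R0; apply Rabs_pos|lra]. }
  rewrite (Sum_ext f (fun p => fl p + fr p)) by (intros [i|j]; simpl; ring).
  rewrite Sum_plus by assumption. f_equal.
  - change (Sum fl = Sum (fun i => fl (inl i))). apply (Sum_reindex inl); [congruence| |exact hl]. intros [i|j] h; [destruct (h i); reflexivity|reflexivity].
  - change (Sum fr = Sum (fun j => fr (inr j))). apply (Sum_reindex inr); [congruence| |exact hr]. intros [i|j] h; [reflexivity|destruct (h j); reflexivity].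
Qed.

Lemma Rabs_Re_le (z : C) : Rabs (Re z) <= Cmod z.
Proof. apply re_le_Cmod. Qed.

Lemma Rabs_Im_le (z : C) : Rabs (Im z) <= Cmod z.
Proof. eapply Rle_trans; [apply Rmax_r|apply Rmax_Cmod]. Qed.

Lemma Ceq_parts (z w : C) : Re z = Re w -> Im z = Im w -> z = w.
Proof. destruct z, w; simpl; congruence. Qed.

Definition Csummable {I : Type} (f : I -> C) : Prop := summable (fun i => Cmod (f i)).

Definition Csum {I : Type} (f : I -> C) : C := (Sum (fun i => Re (f i)), Sum (fun i => Im (f i))).

Lemma Csummable_re {I : Type} (f : I -> C) : Csummable f -> summable (fun i => Re (f i)).
Proof. apply summable_dom. intro; apply Rabs_Re_le. Qed.

Lemma Csummable_im {I : Type} (f : I -> C) : Csummable f -> summable (fun i => Im (f i)).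
Proof. apply summable_dom. intro; apply Rabs_Im_le. Qed.

Lemma Csummable_dom {I : Type} (f : I -> C) (g : I -> R) :
  (forall i, Cmod (f i) <= g i) -> summable g -> Csummable f.
Proof.
  intros h. apply summable_dom. intro i. rewrite Rabs_pos_eq by apply Cmod_ge_0. apply h.
Qed.

Lemma Csummable_ext {I : Type} (f g : I -> C) :
  (forall i, f i = g i) -> Csummable f -> Csummable g.
Proof. intro h. apply summable_ext. intro i; rewrite h; reflexivity. Qed.

Lemma Csum_ext {I : Type} (f g : I -> C) : (forall i, f i = g i) -> Csum f = Csum g.
Proof. intro h. unfold Csum. f_equal; apply Sum_ext; intro i; rewrite h; reflexivity. Qed.

Lemma Csummable_plus {I : Type} (f g : I -> C) :
  Csummable f -> Csummable g -> Csummable (fun i => f i + g i)%C.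
Proof.
  intros hf hg. apply Csummable_dom with (fun i => Cmod (f i) + Cmod (g i)).
  - intro; apply Cmod_triangle.
  - apply summable_plus; assumption.
Qed.

Lemma Csummable_scal {I : Type} (c : C) (f : I -> C) :
  Csummable f -> Csummable (fun i => c * f i)%C.
Proof.
  intros hf. apply Csummable_dom with (fun i => Cmod c * Cmod (f i)).
  - intro; rewrite Cmod_mult; lra.
  - apply summable_scal; assumption.
Qed.

Lemma Csum_plus {I : Type} (f g : I -> C) :
  Csummable f -> Csummable g -> Csum (fun i => f i + g i)%C = (Csum f + Csum g)%C.
Proof.
  intros hf hg. unfold Csum, Cplus. simpl.
  f_equal; apply Sum_plus; (apply Csummable_re || apply Csummable_im); assumption.
Qed.

Lemma Csum_scal {I : Type} (c : C) (f : I -> C) :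
  Csummable f -> Csum (fun i => c * f i)%C = (c * Csum f)%C.
Proof.
  intros hf. assert (h1 := Csummable_re f hf). assert (h2 := Csummable_im f hf).
  unfold Csum, Cmult. simpl. unfold Re, Im in *. f_equal.
  - rewrite Sum_minus by (apply summable_scal; assumption). rewrite !Sum_scal by assumption. reflexivity.
  - rewrite Sum_plus by (apply summable_scal; assumption). rewrite !Sum_scal by assumption. reflexivity.
Qed.

Lemma Csum_RtoC {I : Type} (f : I -> R) : Csum (fun i => RtoC (f i)) = RtoC (Sum f).
Proof.
  unfold Csum, RtoC. simpl. f_equal. apply Sum_unique. apply (is_sum_finite _ nil); [constructor|reflexivity].
Qed.

Lemma Csummable_inj {I J : Type} (e : I -> J) (f : J -> C) :
  (forall i1 i2, e i1 = e i2 -> i1 = i2) -> Csummable f -> Csummable (fun i => f (e i)).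
Proof. intros h hf. exact (summable_inj e (fun j => Cmod (f j)) h hf). Qed.

Lemma Csum_reindex {I J : Type} (e : I -> J) (f : J -> C) :
  (forall i1 i2, e i1 = e i2 -> i1 = i2) ->
  (forall j, (forall i, e i <> j) -> f j = 0) ->
  Csummable f -> Csum f = Csum (fun i => f (e i)).
Proof.
  intros inj hz hf. unfold Csum. f_equal.
  - apply (Sum_reindex e (fun j => Re (f j))); [exact inj| |apply Csummable_re, hf].
    intros j h; rewrite hz by exact h; reflexivity.
  - apply (Sum_reindex e (fun j => Im (f j))); [exact inj| |apply Csummable_im, hf].
    intros j h; rewrite hz by exact h; reflexivity.
Qed.

Lemma Csum_bij {I J : Type} (e : I -> J) (d : J -> I) (f : J -> C) :
  (forall i, d (e i) = i) -> (forall j, e (d j) = j) ->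
  Csummable f -> Csum f = Csum (fun i => f (e i)).
Proof.
  intros h1 h2 hf. apply Csum_reindex; [| |exact hf].
  - intros i1 i2 h. rewrite <- (h1 i1), h, h1. reflexivity.
  - intros j h. exfalso. apply (h (d j)), h2.
Qed.

Lemma Csum_shift (f : Z -> C) (k : Z) : Csummable f -> Csum f = Csum (fun j => f (j + k)%Z).
Proof. apply (Csum_bij (fun j => (j + k)%Z) (fun j => (j - k)%Z)); intro; lia. Qed.

Lemma Csummable_shift (f : Z -> C) (k : Z) : Csummable f -> Csummable (fun j => f (j + k)%Z).
Proof. apply (Csummable_inj (fun j => (j + k)%Z)). intros; lia. Qed.

Lemma Csum_opp (f : Z -> C) : Csummable f -> Csum f = Csum (fun j => f (- j)%Z).
Proof. apply (Csum_bij (fun j => (- j)%Z) (fun j => (- j)%Z)); intro; lia. Qed.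

Lemma Csum_sigma {I J : Type} (f : I * J -> C) :
  Csummable f -> Csum f = Csum (fun i => Csum (fun j => f (i, j))).
Proof.
  intro hf. unfold Csum. f_equal.
  - apply (Sum_sigma (fun p => Re (f p))), Csummable_re, hf.
  - apply (Sum_sigma (fun p => Im (f p))), Csummable_im, hf.
Qed.

Lemma Csum_sumtype {I J : Type} (f : I + J -> C) :
  Csummable f -> Csum f = (Csum (fun i => f (inl i)) + Csum (fun j => f (inr j)))%C.
Proof.
  intro hf. unfold Csum, Cplus. simpl. f_equal.
  - apply (Sum_sumtype (fun p => Re (f p))), Csummable_re, hf.
  - apply (Sum_sumtype (fun p => Im (f p))), Csummable_im, hf.
Qed.

Lemma Csummable_pair {I J : Type} (f : I -> C) (g : J -> C) :
  Csummable f -> Csummable g -> Csummable (fun p : I * J => f (fst p) * g (snd p))%C.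
Proof.
  intros hf hg. unfold Csummable.
  apply summable_pair with (fun i => Cmod (f i)) (fun j => Cmod (g j)); auto using Cmod_ge_0.
  intros i j. simpl. rewrite Rabs_pos_eq by apply Cmod_ge_0. rewrite Cmod_mult. lra.
Qed.

Lemma Csum_mult {I J : Type} (f : I -> C) (g : J -> C) :
  Csummable f -> Csummable g ->
  (Csum f * Csum g)%C = Csum (fun p : I * J => f (fst p) * g (snd p))%C.
Proof.
  intros hf hg. rewrite Csum_sigma by (apply Csummable_pair; assumption). cbn [fst snd].
  rewrite (Csum_ext (fun i => Csum _) (fun i => Csum g * f i)%C).
  - rewrite Csum_scal by exact hf. ring.
  - intro i. rewrite Csum_scal by exact hg. ring.
Qed.

(* Every (m, n) is (a + b, a - b) or (a + b + 1, a - b), according to the parity of m + n. *)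
Lemma Csum_mult_parity (f g : Z -> C) :
  Csummable f -> Csummable g ->
  (Csum f * Csum g)%C =
  (Csum (fun a => Csum (fun b => f (a + b)%Z * g (a - b)%Z)) +
   Csum (fun a => Csum (fun b => f (a + b + 1)%Z * g (a - b)%Z)))%C.
Proof.
  intros hf hg. rewrite Csum_mult by assumption.
  assert (hp := Csummable_pair f g hf hg).
  pose (e := fun s : Z * Z + Z * Z => match s with
     | inl (a, b) => (a + b, a - b)%Z | inr (a, b) => (a + b + 1, a - b)%Z end).
  assert (einj : forall s t, e s = e t -> s = t).
  { intros [[a b]|[a b]] [[c d]|[c d]] h; injection h; intros h1 h2; (f_equal; f_equal; lia) || (exfalso; lia). }
  rewrite (Csum_reindex e _ einj); [| |exact hp].
  - rewrite Csum_sumtype by exact (Csummable_inj e (fun p => f (fst p) * g (snd p))%C einj hp). f_equal.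
    + rewrite Csum_sigma; [reflexivity|].
      apply (Csummable_inj (fun p => e (inl p)) (fun p => f (fst p) * g (snd p))%C); [|exact hp]. intros p q h. apply einj in h. congruence.
    + rewrite Csum_sigma; [reflexivity|].
      apply (Csummable_inj (fun p => e (inr p)) (fun p => f (fst p) * g (snd p))%C); [|exact hp]. intros p q h. apply einj in h. congruence.
  - intros [m n] h. exfalso.
    pose proof (Z.div_mod (m + n) 2 ltac:(lia)). pose proof (Z.mod_pos_bound (m + n) 2 ltac:(lia)).
    set (q := ((m + n) / 2)%Z) in *.
    assert ((m + n) mod 2 = 0 \/ (m + n) mod 2 = 1)%Z as [h0|h0] by lia.
    + apply (h (inl (q, (m - q)%Z))). simpl. f_equal; lia.
    + apply (h (inr (q, (m - q - 1)%Z))). simpl. f_equal; lia.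
Qed.

(** * Limits of complex sequences *)

Definition Clim (u : nat -> C) (l : C) : Prop :=
  is_lim_seq (fun n => Re (u n)) (Re l) /\ is_lim_seq (fun n => Im (u n)) (Im l).

Lemma Clim_unique (u : nat -> C) (l1 l2 : C) : Clim u l1 -> Clim u l2 -> l1 = l2.
Proof.
  intros [a b] [c d]. apply is_lim_seq_unique in a, b, c, d.
  apply Ceq_parts; [rewrite a in c; injection c; auto|rewrite b in d; injection d; auto].
Qed.

Lemma Clim_ext (u v : nat -> C) (l : C) : (forall n, u n = v n) -> Clim u l -> Clim v l.
Proof.
  intros h [a b]; split; [revert a|revert b]; apply is_lim_seq_ext; intro n; rewrite h; reflexivity.
Qed.

Lemma Clim_const (c : C) : Clim (fun _ => c) c.
Proof. split; apply is_lim_seq_const. Qed.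

Lemma Clim_mult (u v : nat -> C) (l m : C) :
  Clim u l -> Clim v m -> Clim (fun n => u n * v n)%C (l * m)%C.
Proof.
  intros [a b] [c d]; split.
  - apply is_lim_seq_minus'; apply is_lim_seq_mult'; assumption.
  - apply is_lim_seq_plus'; apply is_lim_seq_mult'; assumption.
Qed.

Lemma Clim_minus (u v : nat -> C) (l m : C) :
  Clim u l -> Clim v m -> Clim (fun n => u n - v n)%C (l - m)%C.
Proof.
  intros [a b] [c d]; split.
  - apply is_lim_seq_minus' with (1 := a) (2 := c).
  - apply is_lim_seq_minus' with (1 := b) (2 := d).
Qed.

Lemma Clim_subseq (u : nat -> C) (l : C) (phi : nat -> nat) :
  filterlim phi eventually eventually -> Clim u l -> Clim (fun n => u (phi n)) l.
Proof.
  intros h [a b]; split.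
  - apply (is_lim_seq_subseq (fun n => Re (u n)) _ phi h a).
  - apply (is_lim_seq_subseq (fun n => Im (u n)) _ phi h b).
Qed.

Lemma Clim_RtoC (u : nat -> R) (l : R) : is_lim_seq u l <-> Clim (fun n => RtoC (u n)) (RtoC l).
Proof.
  split.
  - intro h. split; simpl; [exact h|apply is_lim_seq_const].
  - intros [h _]. exact h.
Qed.

Lemma Cmod_sqrt (z : C) : Cmod z = sqrt (Re z ^ 2 + Im z ^ 2).
Proof. reflexivity. Qed.

Lemma Clim_Cmod (u : nat -> C) (l : C) : Clim u l -> is_lim_seq (fun n => Cmod (u n)) (Cmod l).
Proof.
  intros [a b].
  apply is_lim_seq_ext with (fun n => sqrt (Re (u n) * Re (u n) + Im (u n) * Im (u n))).
  { intro n. rewrite Cmod_sqrt. f_equal. ring. }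
  rewrite Cmod_sqrt.
  replace (Re l ^ 2 + Im l ^ 2) with (Re l * Re l + Im l * Im l) by ring.
  apply (is_lim_seq_continuous sqrt); [apply continuity_pt_filterlim, continuous_sqrt|].
  apply is_lim_seq_plus'; apply is_lim_seq_mult'; assumption.
Qed.

Lemma Clim_Cmod0 (u : nat -> C) (l : C) :
  is_lim_seq (fun n => Cmod (u n - l)%C) 0 -> Clim u l.
Proof.
  intro h. split.
  - apply is_lim_seq_ext with (fun n => Re (u n - l)%C + Re l).
    { intro n. simpl. unfold Re. simpl. ring. }
    replace (Finite (Re l)) with (Finite (0 + Re l)) by (f_equal; ring).
    apply is_lim_seq_plus'; [|apply is_lim_seq_const].
    apply is_lim_seq_abs_0. apply is_lim_seq_le_le with (fun _ => 0) (fun n => Cmod (u n - l)%C);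
      [|apply is_lim_seq_const|exact h]. intro n. split; [apply Rabs_pos|apply Rabs_Re_le].
  - apply is_lim_seq_ext with (fun n => Im (u n - l)%C + Im l).
    { intro n. simpl. unfold Im. simpl. ring. }
    replace (Finite (Im l)) with (Finite (0 + Im l)) by (f_equal; ring).
    apply is_lim_seq_plus'; [|apply is_lim_seq_const].
    apply is_lim_seq_abs_0. apply is_lim_seq_le_le with (fun _ => 0) (fun n => Cmod (u n - l)%C);
      [|apply is_lim_seq_const|exact h]. intro n. split; [apply Rabs_pos|apply Rabs_Im_le].
Qed.

Lemma Clim_inv (u : nat -> C) (l : C) :
  (forall n, u n <> 0) -> l <> 0 -> Clim u l -> Clim (fun n => / u n)%C (/ l)%C.
Proof.
  intros hu hl h. apply Clim_Cmod0.
  apply is_lim_seq_ext with (fun n => Cmod (u n - l)%C * / (Cmod (u n) * Cmod l)).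
  { intro n. assert (Cmod (u n) <> 0) by (intro e; apply Cmod_eq_0 in e; exact (hu n e)).
    assert (Cmod l <> 0) by (intro e; apply Cmod_eq_0 in e; exact (hl e)).
    rewrite <- Cmod_mult, <- Cmod_inv by (apply Cmult_neq_0; auto). rewrite <- Cmod_mult.
    rewrite <- Cmod_opp. f_equal. field. auto. }
  assert (Cmod l <> 0) by (intro e; apply Cmod_eq_0 in e; exact (hl e)).
  replace 0 with (0 * / (Cmod l * Cmod l)) by ring.
  apply is_lim_seq_mult'.
  - assert (h2 := Clim_Cmod _ _ (Clim_minus _ _ _ _ h (Clim_const l))).
    replace (l - l)%C with (RtoC 0) in h2 by ring. rewrite Cmod_0 in h2. exact h2.
  - apply (is_lim_seq_inv _ (Cmod l * Cmod l)).
    + apply is_lim_seq_mult'; [apply Clim_Cmod; exact h|apply is_lim_seq_const].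
    + intro e. injection e. intro e2. apply Rmult_integral in e2. tauto.
Qed.

Lemma Clim_Csum {I : Type} (f : nat -> I -> C) (l : I -> C) (g : I -> R) :
  summable g -> (forall n i, Cmod (f n i) <= g i) -> (forall i, Clim (fun n => f n i) (l i)) ->
  Clim (fun n => Csum (f n)) (Csum l).
Proof.
  intros hg hd hl. split; simpl.
  - apply (filterlim_Sum eventually (fun n i => Re (f n i)) (fun i => Re (l i)) g hg).
    + apply filter_forall. intros n i. eapply Rle_trans; [apply Rabs_Re_le|apply hd].
    + intro i. apply hl.
  - apply (filterlim_Sum eventually (fun n i => Im (f n i)) (fun i => Im (l i)) g hg).
    + apply filter_forall. intros n i. eapply Rle_trans; [apply Rabs_Im_le|apply hd].
    + intro i. apply hl.
Qed.

(** * Integer powers of complex numbers *)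

Definition zpow (x : C) (k : Z) : C :=
  match k with
  | Z0 => 1
  | Zpos p => (x ^ Pos.to_nat p)%C
  | Zneg p => (/ x ^ Pos.to_nat p)%C
  end.

Lemma zpow_0 (x : C) : zpow x 0 = 1.
Proof. reflexivity. Qed.

Lemma zpow_nat (x : C) (n : nat) : zpow x (Z.of_nat n) = (x ^ n)%C.
Proof.
  destruct n; [reflexivity|]. cbn [Z.of_nat zpow]. rewrite SuccNat2Pos.id_succ. reflexivity.
Qed.

(** With [Z_nat_diff] this avoids sign cases: exponents are written as differences of naturals, and
    the laws of [zpow] become those of natural powers. *)
Lemma zpow_sub (x : C) (n m : nat) :
  x <> 0 -> zpow x (Z.of_nat n - Z.of_nat m) = (x ^ n / x ^ m)%C.
Proof.
  intro hx. destruct (le_lt_dec m n) as [h|h].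
  - replace (Z.of_nat n - Z.of_nat m)%Z with (Z.of_nat (n - m)) by lia. rewrite zpow_nat.
    replace n with ((n - m) + m)%nat at 2 by lia. rewrite Cpow_add_r. field. apply Cpow_nz, hx.
  - replace (Z.of_nat n - Z.of_nat m)%Z with (- Z.of_nat (m - n))%Z by lia.
    assert (e : zpow x (- Z.of_nat (m - n)) = (/ x ^ (m - n))%C).
    { destruct (m - n)%nat as [|k] eqn:E; [lia|]. cbn [Z.of_nat Z.opp zpow].
      rewrite SuccNat2Pos.id_succ. reflexivity. }
    rewrite e. replace (x ^ m)%C with (x ^ (m - n) * x ^ n)%C by (rewrite <- Cpow_add_r; f_equal; lia).
    field. split; apply Cpow_nz, hx.
Qed.

Lemma Z_nat_diff (k : Z) : exists n m, k = (Z.of_nat n - Z.of_nat m)%Z.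
Proof. exists (Z.to_nat k), (Z.to_nat (- k)). lia. Qed.

Lemma zpow_add (x : C) (k l : Z) : x <> 0 -> zpow x (k + l) = (zpow x k * zpow x l)%C.
Proof.
  intro hx. destruct (Z_nat_diff k) as [a [b ->]]. destruct (Z_nat_diff l) as [c [d ->]].
  replace (Z.of_nat a - Z.of_nat b + (Z.of_nat c - Z.of_nat d))%Z
    with (Z.of_nat (a + c) - Z.of_nat (b + d))%Z by lia.
  rewrite !zpow_sub by exact hx. rewrite !Cpow_add_r. field. split; apply Cpow_nz, hx.
Qed.

Lemma zpow_neq0 (x : C) (k : Z) : x <> 0 -> zpow x k <> 0.
Proof.
  intros hx h. assert (e : (zpow x k * zpow x (- k))%C = 1).
  { rewrite <- zpow_add by exact hx. rewrite Z.add_opp_diag_r. reflexivity. }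
  rewrite h, Cmult_0_l in e. apply C1_nz. symmetry; exact e.
Qed.

Lemma zpow_1 (x : C) : zpow x 1 = x.
Proof. change (zpow x 1) with (x ^ 1)%C. apply Cpow_1_r. Qed.

Lemma zpow_opp (x : C) (k : Z) : x <> 0 -> zpow x (- k) = (/ zpow x k)%C.
Proof.
  intro hx. assert (hk := zpow_neq0 x k hx).
  assert (e : (zpow x k * zpow x (- k))%C = 1).
  { rewrite <- zpow_add by exact hx. rewrite Z.add_opp_diag_r. reflexivity. }
  rewrite <- (Cmult_1_l (/ zpow x k)%C), <- e. field. exact hk.
Qed.

Lemma zpow_m1 (x : C) : x <> 0 -> zpow x (-1) = (/ x)%C.
Proof. intro hx. change (-1)%Z with (- (1))%Z. rewrite zpow_opp, zpow_1; auto. Qed.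

Lemma zpow_sub1 (x : C) (k l : Z) : x <> 0 -> zpow x (k - l) = (zpow x k / zpow x l)%C.
Proof.
  intro hx. unfold Z.sub. rewrite zpow_add, zpow_opp by exact hx. reflexivity.
Qed.

Lemma zpow_mul_l (x y : C) (k : Z) :
  x <> 0 -> y <> 0 -> zpow (x * y)%C k = (zpow x k * zpow y k)%C.
Proof.
  intros hx hy. destruct (Z_nat_diff k) as [a [b ->]].
  rewrite !zpow_sub; auto using Cmult_neq_0. rewrite !Cpow_mult_l. field. split; apply Cpow_nz; assumption.
Qed.

Lemma Cinv_neq0 (x : C) : x <> 0 -> (/ x)%C <> 0.
Proof. intros hx e. assert (h := Cinv_r x hx). rewrite e, Cmult_0_r in h. apply C1_nz; symmetry; exact h. Qed.

Lemma zpow_inv_l (x : C) (k : Z) : x <> 0 -> zpow (/ x)%C k = (/ zpow x k)%C.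
Proof.
  intro hx. assert (hi := Cinv_neq0 x hx).
  assert (h := zpow_mul_l x (/ x)%C k hx hi). rewrite Cinv_r in h by exact hx.
  assert (e : zpow 1 k = 1).
  { destruct k; simpl; rewrite ?Cpow_1_l; try reflexivity. field. }
  rewrite e in h. assert (hk := zpow_neq0 x k hx).
  replace (zpow (/ x)%C k) with (/ zpow x k * (zpow x k * zpow (/ x)%C k))%C by (field; exact hk).
  rewrite <- h. ring.
Qed.

Lemma zpow_pow (x : C) (n : nat) (k : Z) : x <> 0 -> zpow (x ^ n)%C k = zpow x (Z.of_nat n * k).
Proof.
  intro hx. destruct (Z_nat_diff k) as [a [b ->]].
  replace (Z.of_nat n * (Z.of_nat a - Z.of_nat b))%Z with (Z.of_nat (n * a) - Z.of_nat (n * b))%Z by lia.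
  rewrite !zpow_sub; auto using Cpow_nz. rewrite <- !Cpow_mult_r. reflexivity.
Qed.

Lemma zpow_mul (x : C) (k l : Z) : x <> 0 -> zpow (zpow x k) l = zpow x (k * l).
Proof.
  intro hx. destruct (Z_nat_diff k) as [a [b ->]].
  rewrite zpow_sub by exact hx. unfold Cdiv.
  rewrite zpow_mul_l by (try apply Cinv_neq0; apply Cpow_nz; exact hx).
  rewrite zpow_inv_l by (apply Cpow_nz; exact hx). rewrite !zpow_pow by exact hx.
  rewrite Z.mul_sub_distr_r, zpow_sub1 by exact hx. reflexivity.
Qed.

(** * Theta series over Z with a parametric exponent *)

Lemma summable_half_Z : summable (fun j : Z => (1 / 2) ^ Z.abs_nat j).
Proof.
  apply (summable_ext (fun j : Z => (fun p : bool * nat => (1 / 2) ^ snd p) (Z.ltb j 0, Z.abs_nat j)));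
    [reflexivity|].
  apply (summable_inj (fun j : Z => (Z.ltb j 0, Z.abs_nat j)) (fun p : bool * nat => (1 / 2) ^ snd p)).
  - intros i j h. injection h. intros h1 h2.
    destruct (Z.ltb_spec i 0), (Z.ltb_spec j 0); try discriminate; lia.
  - apply summable_pair with (fun _ => 1) (fun n => (1 / 2) ^ n).
    + intros b n. simpl. rewrite Rabs_pos_eq by (apply pow_le; lra). lra.
    + intros; lra.
    + intros; apply pow_le; lra.
    + apply (summable_finite _ (true :: false :: nil)). intros []; simpl; tauto.
    + apply summable_geom; lra.
Qed.

Fixpoint trin (n : nat) : nat := match n with O => O | S m => trin m + m end.

Lemma trin_spec (n : nat) : (2 * Z.of_nat (trin n) = Z.of_nat n * Z.of_nat n - Z.of_nat n)%Z.
Proof. induction n as [|n IH]; [reflexivity|]. simpl trin. lia. Qed.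

(** The ratio of consecutive values of (2w)^n r^(n(n-1)/2) is 2w r^n, which is eventually at most 1;
    so this sequence is bounded, and removing the factor 2^n leaves the geometric majorant. *)
Lemma pow_trin_bound (w r : R) :
  0 <= w -> 0 <= r < 1 -> exists K, 0 <= K /\ forall n, w ^ n * r ^ trin n <= K * (1 / 2) ^ n.
Proof.
  intros hw hr.
  assert (hm : exists m, forall n, (m <= n)%nat -> 2 * w * r ^ n <= 1).
  { assert (he : 0 < / (2 * w + 1)) by (apply Rinv_0_lt_compat; lra).
    assert (hr' : Rabs r < 1) by (rewrite Rabs_pos_eq; lra).
    destruct (pow_lt_1_zero r hr' _ he) as [m h].
    exists m. intros n hn. specialize (h n hn). rewrite Rabs_pos_eq in h by (apply pow_le; lra).
    apply Rle_trans with (2 * w * / (2 * w + 1)).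
    - apply Rmult_le_compat_l; lra.
    - apply Rmult_le_reg_r with (2 * w + 1); [lra|]. field_simplify; lra. }
  destruct hm as [m hm].
  pose (b := fun n => (2 * w) ^ n * r ^ trin n).
  assert (hb0 : forall n, 0 <= b n) by (intro n; apply Rmult_le_pos; apply pow_le; lra).
  assert (hS : forall n, b (S n) = b n * (2 * w * r ^ n)).
  { intro n. unfold b. simpl. rewrite pow_add. ring. }
  assert (h1 : exists K, forall n, (n <= m)%nat -> b n <= K).
  { clear hm. induction m as [|m [K hK]].
    - exists (b 0%nat). intros n h. replace n with 0%nat by lia. lra.
    - exists (Rmax K (b (S m))). intros n h. destruct (Nat.eq_dec n (S m)) as [->|ne].
      + apply Rmax_r.
      + eapply Rle_trans; [apply hK; lia|apply Rmax_l]. }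
  destruct h1 as [K hK]. exists K. split; [eapply Rle_trans; [apply (hb0 0%nat)|apply hK; lia]|].
  assert (hall : forall n, b n <= K).
  { intro n. destruct (le_lt_dec n m) as [h|h]; [apply hK; exact h|].
    assert (forall k, b (m + k)%nat <= K).
    { induction k as [|k IH].
      - rewrite Nat.add_0_r. apply hK; lia.
      - rewrite Nat.add_succ_r, hS. specialize (hm (m + k)%nat ltac:(lia)). specialize (hb0 (m + k)%nat). nra. }
    replace n with (m + (n - m))%nat by lia. apply H. }
  intro n. specialize (hall n). unfold b in hall.
  replace (w ^ n * r ^ trin n) with ((2 * w) ^ n * r ^ trin n * (1 / 2) ^ n).
  - apply Rmult_le_compat_r; [apply pow_le; lra|exact hall].
  - rewrite Rpow_mult_distr. assert (2 ^ n * (1 / 2) ^ n = 1).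
    { rewrite <- Rpow_mult_distr. replace (2 * (1 / 2)) with 1 by field. apply pow1. }
    replace (2 ^ n * w ^ n * r ^ trin n * (1 / 2) ^ n) with ((2 ^ n * (1 / 2) ^ n) * (w ^ n * r ^ trin n)) by ring.
    rewrite H. ring.
Qed.

Lemma Cmod_neq0_pos (z : C) : z <> 0 -> 0 < Cmod z.
Proof. apply Cmod_gt_0. Qed.

Lemma Cmod_zpow_le (z : C) (j : Z) (w : R) :
  z <> 0 -> Cmod z <= w -> / Cmod z <= w -> Cmod (zpow z j) <= w ^ Z.abs_nat j.
Proof.
  intros hz h1 h2. assert (hm := Cmod_neq0_pos z hz).
  destruct j as [|p|p]; simpl.
  - rewrite Cmod_1. lra.
  - rewrite Cmod_pow. apply pow_incr. lra.
  - rewrite Cmod_inv by (apply Cpow_nz, hz). rewrite Cmod_pow, <- pow_inv.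
    apply pow_incr. split; [left; apply Rinv_0_lt_compat, hm|exact h2].
Qed.

Lemma Cmod_zpow_nonneg (x : C) (k : Z) (n : nat) :
  Cmod x < 1 -> (Z.of_nat n <= k)%Z -> Cmod (zpow x k) <= Cmod x ^ n.
Proof.
  intros hx hk. replace k with (Z.of_nat (n + Z.to_nat (k - Z.of_nat n))) by lia.
  rewrite zpow_nat, Cmod_pow, pow_add. pose proof (Cmod_ge_0 x).
  rewrite <- (Rmult_1_r (Cmod x ^ n)) at 2. apply Rmult_le_compat_l; [apply pow_le; lra|].
  rewrite <- (pow1 (Z.to_nat (k - Z.of_nat n))). apply pow_incr. lra.
Qed.

(** The hypothesis says that [e j] is at least the triangular number of |j|. It fits every exponent
    used below: squares, pronic numbers, [tri], [expA] and [expB]. *)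
Lemma theta_bound (z x : C) (e : Z -> Z) :
  z <> 0 -> Cmod x < 1 -> (forall j, j * j - Z.abs j <= 2 * e j)%Z ->
  exists K, 0 <= K /\ forall j, Cmod (zpow z j * zpow x (e j))%C <= K * (1 / 2) ^ Z.abs_nat j.
Proof.
  intros hz hx he. set (w := Rmax (Cmod z) (/ Cmod z)).
  assert (hm := Cmod_neq0_pos z hz). pose proof (Cmod_ge_0 x).
  assert (hw : 0 <= w) by (eapply Rle_trans; [|apply Rmax_l]; lra).
  destruct (pow_trin_bound w (Cmod x) hw ltac:(lra)) as [K [hK0 hK]].
  exists K. split; [exact hK0|]. intro j. eapply Rle_trans; [|apply hK]. rewrite Cmod_mult.
  apply Rmult_le_compat; auto using Cmod_ge_0.
  - apply Cmod_zpow_le; [exact hz|apply Rmax_l|apply Rmax_r].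
  - apply Cmod_zpow_nonneg; [exact hx|]. specialize (he j). assert (h := trin_spec (Z.abs_nat j)).
    rewrite Zabs2Nat.id_abs in h. lia.
Qed.

Lemma theta_summable (z x : C) (e : Z -> Z) :
  z <> 0 -> Cmod x < 1 -> (forall j, j * j - Z.abs j <= 2 * e j)%Z ->
  Csummable (fun j => zpow z j * zpow x (e j))%C.
Proof.
  intros hz hx he. destruct (theta_bound z x e hz hx he) as [K [_ hK]].
  apply Csummable_dom with (1 := hK). apply summable_scal, summable_half_Z.
Qed.

Definition theta (e : Z -> Z) (z x : C) : C := Csum (fun j => zpow z j * zpow x (e j))%C.

Definition tri (j : Z) : Z := (j * (j + 1) / 2)%Z.

Lemma tri_spec (j : Z) : (2 * tri j = j * (j + 1))%Z.
Proof.
  unfold tri. assert (h : (j * (j + 1) mod 2 = 0)%Z).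
  { rewrite Z.mul_mod, Z.add_mod by lia. assert (h := Z.mod_pos_bound j 2 ltac:(lia)).
    assert (j mod 2 = 0 \/ j mod 2 = 1)%Z as [->| ->] by lia; reflexivity. }
  rewrite (Z.div_mod (j * (j + 1)) 2) at 2 by lia. lia.
Qed.

Lemma le_pronic (j : Z) : (j * j - Z.abs j <= 2 * (j * j + j))%Z.
Proof. destruct (Z.abs_spec j); nia. Qed.

Lemma le_square (j : Z) : (j * j - Z.abs j <= 2 * (j * j))%Z.
Proof. destruct (Z.abs_spec j); nia. Qed.

Lemma le_tri (j : Z) : (j * j - Z.abs j <= 2 * tri j)%Z.
Proof. rewrite tri_spec. destruct (Z.abs_spec j); nia. Qed.

(** After the parity substitution the exponents separate: tri(a+b) + tri(a-b) = (a^2 + a) + b^2 and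
    tri(a+b+1) + tri(a-b) = (a+1)^2 + (b^2 + b). This one formula yields both the duplication
    formulas and the three-term relation. *)
Lemma theta_tri_mult (u v x : C) :
  u <> 0 -> v <> 0 -> x <> 0 -> Cmod x < 1 ->
  (theta tri u x * theta tri v x)%C =
  (theta (fun j => j * j + j)%Z (u * v) x * theta (fun j => j * j)%Z (u / v) x +
   / v * theta (fun j => j * j)%Z (u * v) x * theta (fun j => j * j + j)%Z (u / v) x)%C.
Proof.
  intros hu hv hx hx1.
  assert (htri : forall j, (j * j - Z.abs j <= 2 * tri j)%Z) by (intro j; apply le_tri).
  assert (huv := Cmult_neq_0 u v hu hv). assert (huv' := Cmult_neq_0 u _ hu (Cinv_neq0 v hv)).
  assert (hf : forall z : C, z <> 0 -> Csummable (fun j => zpow z j * zpow x (j * j))%C).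
  { intros z hz. apply (theta_summable z x (fun j => j * j)%Z); auto. intro j; apply le_square. }
  assert (hg : forall z : C, z <> 0 -> Csummable (fun j => zpow z j * zpow x (j * j + j))%C).
  { intros z hz. apply (theta_summable z x (fun j => j * j + j)%Z); auto. intro j; apply le_pronic. }
  unfold theta. rewrite Csum_mult_parity by (apply theta_summable; auto).
  f_equal.
  - rewrite (Csum_ext _ (fun a => Csum (fun j => zpow (u / v) j * zpow x (j * j)) * (zpow (u * v) a * zpow x (a * a + a)))%C).
    + rewrite Csum_scal by (apply hg; exact huv). ring.
    + intro a. rewrite Cmult_comm, <- Csum_scal by (apply hf; exact huv'). apply Csum_ext. intro b.
      unfold Cdiv. rewrite !zpow_mul_l by (auto using Cinv_neq0). rewrite zpow_inv_l by exact hv.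
      rewrite zpow_sub1, zpow_add by assumption.
      assert (e : (zpow x (tri (a + b)) * zpow x (tri (a - b)))%C = (zpow x (a * a + a) * zpow x (b * b))%C).
      { rewrite <- !zpow_add by exact hx. f_equal. pose proof (tri_spec (a + b)). pose proof (tri_spec (a - b)). nia. }
      transitivity (zpow u a * zpow u b * zpow v a / zpow v b * (zpow x (tri (a + b)) * zpow x (tri (a - b))))%C.
      { field. apply zpow_neq0, hv. }
      rewrite e. field. apply zpow_neq0, hv.
  (* In the odd part u (uv)^a equals (1/v) (uv)^(a+1), which matches the exponent (a+1)^2; a shift
     of [a] by one gives the series of squares with the prefactor 1/v. *)
  - rewrite (Csum_ext _ (fun a => Csum (fun j => zpow (u / v) j * zpow x (j * j + j)) * (u * (zpow (u * v) a * zpow x ((a + 1) * (a + 1)))))%C).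
    + rewrite Csum_scal.
      2:{ apply Csummable_ext with (fun a => (/ v) * (zpow (u * v) (a + 1) * zpow x ((a + 1) * (a + 1))))%C.
          - intro a. rewrite zpow_add, zpow_1 by exact huv. field. exact hv.
          - apply Csummable_scal. apply (Csummable_shift (fun a => zpow (u * v) a * zpow x (a * a))%C). apply hf; exact huv. }
      rewrite (Csum_ext (fun a => u * _)%C (fun a => (/ v) * (zpow (u * v) (a + 1) * zpow x ((a + 1) * (a + 1))))%C).
      2:{ intro a. rewrite zpow_add, zpow_1 by exact huv. field. exact hv. }
      rewrite Csum_scal.
      2:{ apply (Csummable_shift (fun a => zpow (u * v) a * zpow x (a * a))%C). apply hf; exact huv. }
      rewrite <- (Csum_shift (fun a => zpow (u * v) a * zpow x (a * a))%C 1) by (apply hf; exact huv). ring.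
    + intro a. rewrite Cmult_comm, <- Csum_scal by (apply hg; exact huv'). apply Csum_ext. intro b.
      unfold Cdiv. rewrite !zpow_mul_l by (auto using Cinv_neq0). rewrite zpow_inv_l by exact hv.
      rewrite zpow_sub1, !(zpow_add u), zpow_1 by assumption.
      assert (e : (zpow x (tri (a + b + 1)) * zpow x (tri (a - b)))%C = (zpow x ((a + 1) * (a + 1)) * zpow x (b * b + b))%C).
      { rewrite <- !zpow_add by exact hx. f_equal. pose proof (tri_spec (a + b + 1)). pose proof (tri_spec (a - b)). nia. }
      transitivity (zpow u a * zpow u b * u * zpow v a / zpow v b * (zpow x (tri (a + b + 1)) * zpow x (tri (a - b))))%C.
      { field. apply zpow_neq0, hv. }
      rewrite e. field. apply zpow_neq0, hv.
Qed.

(** * The Jacobi triple product *)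

(** The Gaussian binomial coefficient with an integer lower index. It vanishes unless 0 <= m <= n,
    so finite sums can be written over all of Z and shifted without boundary terms. *)
Fixpoint gbin (x : C) (n : nat) (m : Z) : C :=
  match n with
  | O => if Z.eq_dec m 0 then 1 else 0
  | S n' => (gbin x n' (m - 1) + zpow x m * gbin x n' m)%C
  end.

Lemma gbin_out (x : C) (n : nat) (m : Z) : (m < 0 \/ Z.of_nat n < m)%Z -> gbin x n m = 0.
Proof.
  revert m. induction n as [|n IH]; intros m h; cbn [gbin].
  - destruct Z.eq_dec; [lia|reflexivity].
  - rewrite !IH by lia. ring.
Qed.

(** The mirror image of the defining Pascal rule. Both rules are needed: the finite triple product
    and Schur's recurrence each apply one of either kind. *)
Lemma gbin_pascal (x : C) (n : nat) (m : Z) :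
  x <> 0 -> gbin x (S n) m = (gbin x n m + zpow x (Z.of_nat (S n) - m) * gbin x n (m - 1))%C.
Proof.
  intro hx. revert m. induction n as [|n IH]; intro m.
  - cbn [gbin]. destruct (Z.eq_dec m 0) as [->|h0]; destruct Z.eq_dec as [h1|h1]; try lia;
      rewrite ?zpow_0; try ring. replace m with 1%Z by lia. cbn. ring.
  - change (gbin x (S (S n)) m) with (gbin x (S n) (m - 1) + zpow x m * gbin x (S n) m)%C.
    rewrite (IH (m - 1)%Z) at 1. rewrite (IH m) at 1.
    change (gbin x (S n) (m - 1)) with (gbin x n (m - 1 - 1) + zpow x (m - 1) * gbin x n (m - 1))%C.
    change (gbin x (S n) m) with (gbin x n (m - 1) + zpow x m * gbin x n m)%C.
    replace (Z.of_nat (S n) - (m - 1))%Z with (Z.of_nat (S (S n)) - m)%Z by lia.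
    assert (e1 : (zpow x m * zpow x (Z.of_nat (S n) - m))%C = zpow x (Z.of_nat (S n)))
      by (rewrite <- zpow_add by exact hx; f_equal; lia).
    assert (e2 : (zpow x (Z.of_nat (S (S n)) - m) * zpow x (m - 1))%C = zpow x (Z.of_nat (S n)))
      by (rewrite <- zpow_add by exact hx; f_equal; lia).
    transitivity (gbin x n (m - 1) + zpow x (Z.of_nat (S (S n)) - m) * gbin x n (m - 1 - 1) +
      zpow x m * gbin x n m + (zpow x m * zpow x (Z.of_nat (S n) - m)) * gbin x n (m - 1))%C; [ring|].
    rewrite e1, <- e2. ring.
Qed.

Fixpoint qpoch (x : C) (n : nat) : C :=
  match n with
  | O => 1
  | S n' => (qpoch x n' * (1 - x ^ S n'))%C
  end.

Lemma gbin_qpoch (x : C) (n m : nat) :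
  x <> 0 -> (m <= n)%nat -> (gbin x n (Z.of_nat m) * (qpoch x m * qpoch x (n - m)))%C = qpoch x n.
Proof.
  intro hx. revert m. induction n as [|n IH]; intros m hm.
  - replace m with O by lia. simpl. ring.
  - cbn [gbin]. destruct m as [|m].
    + rewrite gbin_out by lia. change (zpow x (Z.of_nat 0)) with (RtoC 1). rewrite Nat.sub_0_r.
      specialize (IH 0%nat ltac:(lia)). rewrite Nat.sub_0_r in IH. cbn [qpoch] in *. rewrite <- IH at 2. ring.
    + replace (Z.of_nat (S m) - 1)%Z with (Z.of_nat m) by lia. rewrite Nat.sub_succ.
      assert (h1 := IH m ltac:(lia)). rewrite zpow_nat.
      destruct (Nat.eq_dec m n) as [->|ne].
      * rewrite (gbin_out x n (Z.of_nat (S n))) by lia. rewrite Nat.sub_diag in *. cbn [qpoch] in *. rewrite <- h1 at 2. ring.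
      * assert (h2 := IH (S m) ltac:(lia)).
        replace (n - m)%nat with (S (n - S m)) in * by lia. cbn [qpoch] in *.
        assert (e : (x ^ S m * x ^ S (n - S m))%C = (x ^ S n)%C) by (rewrite <- Cpow_add_r; f_equal; lia).
        transitivity ((1 - x ^ S m) * qpoch x n + x ^ S m * (1 - x ^ S (n - S m)) * qpoch x n)%C.
        { rewrite <- h1 at 1. rewrite <- h2. ring. }
        transitivity (qpoch x n * (1 - x ^ S m * x ^ S (n - S m)))%C; [ring|]. rewrite e. reflexivity.
Qed.

Fixpoint jprod (u x : C) (n : nat) : C :=
  match n with
  | O => 1
  | S n' => (jprod u x n' * ((1 + u * x ^ S n') * (1 + x ^ n' / u)))%C
  end.

Lemma Csummable_finite {I : Type} (f : I -> C) (L : list I) :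
  (forall i, ~ In i L -> f i = 0) -> Csummable f.
Proof. intro h. apply (summable_finite _ L). intros i hi. rewrite h by exact hi. apply Cmod_0. Qed.

Lemma Z_list (n : nat) : exists L : list Z, forall j : Z, (Z.abs j <= Z.of_nat n)%Z -> In j L.
Proof.
  exists (map (fun k => Z.of_nat k - Z.of_nat n)%Z (seq 0 (2 * n + 1))). intros j h.
  apply in_map_iff. exists (Z.to_nat (j + Z.of_nat n)). split; [lia|]. apply in_seq. lia.
Qed.

Lemma Csummable_compact (f : Z -> C) (n : nat) :
  (forall j, (Z.of_nat n < Z.abs j)%Z -> f j = 0) -> Csummable f.
Proof.
  intro h. destruct (Z_list n) as [L hL]. apply Csummable_finite with L.
  intros j hj. apply h. destruct (Z_lt_le_dec (Z.of_nat n) (Z.abs j)); [assumption|]. exfalso; auto.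
Qed.

Definition jterm (u x : C) (n : nat) (j : Z) : C :=
  (zpow u j * zpow x (tri j) * gbin x (2 * n) (Z.of_nat n + j))%C.

Lemma jterm_summable (u x : C) (n : nat) : Csummable (jterm u x n).
Proof.
  apply Csummable_compact with n. intros j h. unfold jterm. rewrite gbin_out by lia. ring.
Qed.

(** Cauchy's finite form of the triple product. The new pair of factors expands as (1 + x^(2n+1)) +
    u x^(n+1) + x^n/u; in the sum, these terms leave j fixed or shift it by one, and passing from
    [2n] to [2n+2] by the two Pascal rules produces the same terms. *)
Lemma jprod_finite (u x : C) (n : nat) :
  u <> 0 -> x <> 0 -> jprod u x n = Csum (jterm u x n).
Proof.
  intros hu hx. induction n as [|n IH].
  - cbn [jprod].
    rewrite (Csum_reindex (fun _ : unit => 0%Z)); [| | |apply jterm_summable].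
    + unfold jterm. cbn. rewrite (Csum_ext _ (fun _ => RtoC 1)).
      2:{ intro. cbn. ring. }
      rewrite (Csum_RtoC (fun _ => 1)). rewrite (Sum_unique _ (lsum (fun _ : unit => 1) (tt :: nil))).
      * cbn. f_equal. ring.
      * apply is_sum_finite; [constructor; [intros []|constructor]|]. intros [] h. destruct h; left; reflexivity.
    + intros [] []; reflexivity.
    + intros j h. unfold jterm. change (gbin x (2 * 0) (Z.of_nat 0 + j)) with (if Z.eq_dec (Z.of_nat 0 + j) 0 then RtoC 1 else RtoC 0). destruct Z.eq_dec as [e|ne]; [|ring].
      exfalso. apply (h tt). simpl in e. lia.
  - cbn [jprod]. rewrite IH. set (t := jterm u x n). assert (ht := jterm_summable u x n : Csummable t).
    rewrite (Csum_ext (jterm u x (S n)) (fun j => (1 + x ^ (2 * n + 1)) * t j +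
       (u * x ^ S n * t (j + -1)%Z + x ^ n / u * t (j + 1)%Z))%C).
    + rewrite !Csum_plus; repeat apply Csummable_plus; try apply Csummable_scal; try apply Csummable_shift; try exact ht.
      rewrite !Csum_scal by (try apply Csummable_shift; exact ht).
      rewrite <- !(Csum_shift t) by exact ht.
      replace (2 * n + 1)%nat with (S n + n)%nat by lia. rewrite Cpow_add_r. field. exact hu.
    + intro j. unfold t, jterm. replace (2 * S n)%nat with (S (S (2 * n))) by lia.
      set (A := gbin x (2 * n)).
      change (gbin x (S (S (2 * n))) (Z.of_nat (S n) + j)) with
        (gbin x (S (2 * n)) (Z.of_nat (S n) + j - 1) + zpow x (Z.of_nat (S n) + j) * gbin x (S (2 * n)) (Z.of_nat (S n) + j))%C.
      rewrite !gbin_pascal by exact hx. fold A.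
      replace (Z.of_nat (S n) + j - 1)%Z with (Z.of_nat n + j)%Z by lia.
      replace (Z.of_nat n + j - 1)%Z with (Z.of_nat n + (j + -1))%Z by lia.
      replace (Z.of_nat (S n) + j)%Z with (Z.of_nat n + (j + 1))%Z by lia.
      replace (Z.of_nat (S (2 * n)) - (Z.of_nat n + j))%Z with (Z.of_nat (S n) - j)%Z by lia.
      replace (Z.of_nat (S (2 * n)) - (Z.of_nat n + (j + 1)))%Z with (Z.of_nat n - j)%Z by lia.
      rewrite !(zpow_add u) by exact hu. rewrite zpow_m1, zpow_1 by exact hu.
      assert (e1 : (zpow x (tri j) * zpow x (Z.of_nat (S n) - j))%C = (x ^ S n * zpow x (tri (j + -1)))%C).
      { rewrite <- zpow_nat, <- !zpow_add by exact hx. f_equal. pose proof (tri_spec j). pose proof (tri_spec (j + -1)). lia. }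
      assert (e2 : (zpow x (tri j) * zpow x (Z.of_nat n + (j + 1)))%C = (x ^ n * zpow x (tri (j + 1)))%C).
      { rewrite <- zpow_nat, <- !zpow_add by exact hx. f_equal. pose proof (tri_spec j). pose proof (tri_spec (j + 1)). lia. }
      assert (e3 : (zpow x (Z.of_nat n + (j + 1)) * zpow x (Z.of_nat n - j))%C = (x ^ (2 * n + 1))%C).
      { rewrite <- zpow_nat, <- !zpow_add by exact hx. f_equal. lia. }
      transitivity (zpow u j * (zpow x (tri j) * A (Z.of_nat n + j)%Z
          + (zpow x (tri j) * zpow x (Z.of_nat (S n) - j)) * A (Z.of_nat n + (j + -1))%Z
          + (zpow x (tri j) * zpow x (Z.of_nat n + (j + 1))) * A (Z.of_nat n + (j + 1))%Z
          + zpow x (tri j) * (zpow x (Z.of_nat n + (j + 1)) * zpow x (Z.of_nat n - j)) * A (Z.of_nat n + j)%Z))%C.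
      { ring_simplify. replace (Z.of_nat n + (j + 1) - 1)%Z with (Z.of_nat n + j)%Z by lia. ring. }
      rewrite e1, e2, e3. field. exact hu.
Qed.

(** * Bounds and limit of (x; x)_n *)

Lemma exp_ge_1p (y : R) : 1 + y <= exp y.
Proof. destruct (Req_dec y 0) as [->|h]; [rewrite exp_0; lra|left; apply exp_ineq1; exact h]. Qed.

Lemma exp_le (a b : R) : a <= b -> exp a <= exp b.
Proof. intros [h| ->]; [left; apply exp_increasing; exact h|lra]. Qed.

Lemma geom_partial (r : R) (n : nat) : 0 <= r < 1 -> sum_n (fun k => r ^ S k) n <= / (1 - r).
Proof.
  intro hr. rewrite <- (Sum_geom r hr). rewrite <- lsum_seq.
  rewrite <- (lsum_map S (fun k => r ^ k)). apply Sum_ge_lsum.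
  - intro; apply pow_le; lra.
  - apply summable_geom; exact hr.
  - apply FinFun.Injective_map_NoDup; [intros a b h; lia|apply seq_NoDup].
Qed.

Definition qlow (r : R) : R := exp (- (/ (1 - r) / (1 - r))).

Definition qupp (r : R) : R := exp (/ (1 - r)).

Lemma Cmod_pow_S_le (x : C) (n : nat) : Cmod x < 1 -> Cmod x ^ S n <= Cmod x.
Proof.
  intro h. pose proof (Cmod_ge_0 x). simpl. rewrite <- (Rmult_1_r (Cmod x)) at 3.
  apply Rmult_le_compat_l; [lra|]. rewrite <- (pow1 n). apply pow_incr; lra.
Qed.

Lemma Cmod_1m_ge (y : C) : 1 - Cmod y <= Cmod (1 - y).
Proof.
  assert (h := Cmod_triangle (1 - y) y). replace (1 - y + y)%C with (RtoC 1) in h by ring.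
  rewrite Cmod_1 in h. lra.
Qed.

(** With r = |x|, each factor 1 - x^k lies in modulus between exp(-r^k/(1-r)) and exp(r^k); the
    geometric series then sums the exponents. The lower bound is uniform in n, hence the infinite
    product is nonzero and quotients pass to the limit. *)
Lemma qpoch_bounds (x : C) (n : nat) :
  Cmod x < 1 -> qlow (Cmod x) <= Cmod (qpoch x n) <= qupp (Cmod x).
Proof.
  intro hx. set (r := Cmod x) in *. assert (hr : 0 <= r) by apply Cmod_ge_0.
  destruct n as [|n].
  - cbn. rewrite Cmod_1. unfold qlow, qupp. assert (0 < / (1 - r)) by (apply Rinv_0_lt_compat; lra).
    split.
    + apply Rle_trans with (exp 0); [|rewrite exp_0; lra]. apply exp_le. assert (0 < / (1 - r) / (1 - r)) by (apply Rdiv_lt_0_compat; lra). lra.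
    + apply Rle_trans with (exp 0); [rewrite exp_0; lra|]. apply exp_le. lra.
  - assert (h : exp (- (sum_n (fun k => r ^ S k) n / (1 - r))) <= Cmod (qpoch x (S n)) <= exp (sum_n (fun k => r ^ S k) n)).
    { assert (hstep : forall k, exp (- (r ^ S k / (1 - r))) <= Cmod (1 - x ^ S k)%C <= exp (r ^ S k)).
      { intro k. assert (hk := Cmod_pow_S_le x k hx). fold r in hk.
        assert (hk0 : 0 <= r ^ S k) by (apply pow_le; exact hr). split.
        - apply Rle_trans with (1 - r ^ S k).
          2:{ unfold r. rewrite <- Cmod_pow. apply Cmod_1m_ge. }
          rewrite exp_Ropp. rewrite <- (Rinv_inv (1 - r ^ S k)). apply Rinv_le_contravar; [apply Rinv_0_lt_compat; lra|].
          eapply Rle_trans; [|apply exp_ge_1p].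
          apply Rle_trans with (1 + r ^ S k / (1 - r ^ S k)).
          + apply Req_le. field. lra.
          + apply Rplus_le_compat_l, Rmult_le_compat_l; [lra|]. apply Rinv_le_contravar; lra.
        - eapply Rle_trans; [apply Cmod_triangle|]. rewrite Cmod_opp, Cmod_1, Cmod_pow. apply exp_ge_1p. }
      induction n as [|n IH].
      - cbn [qpoch]. rewrite Cmult_1_l, sum_O. apply hstep.
      - rewrite sum_Sn. unfold plus; cbn [qpoch] in *; simpl in IH |- *.
        rewrite Cmod_mult. specialize (hstep (S n)).
        replace (- ((sum_n (fun k => r * r ^ k) n + r * (r * r ^ n)) / (1 - r)))
          with (- (sum_n (fun k => r * r ^ k) n / (1 - r)) + - (r * (r * r ^ n) / (1 - r))) by (field; lra).
        rewrite !exp_plus. simpl in hstep.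
        split; apply Rmult_le_compat; try apply IH; try apply hstep; try (left; apply exp_pos); apply Cmod_ge_0. }
    assert (hg := geom_partial r n ltac:(lra)). unfold qlow, qupp.
    split.
    + eapply Rle_trans; [|apply h]. apply exp_le. apply Ropp_le_contravar.
      apply Rmult_le_compat_r; [left; apply Rinv_0_lt_compat; lra|exact hg].
    + eapply Rle_trans; [apply h|]. apply exp_le. exact hg.
Qed.

Lemma qlow_pos (r : R) : 0 < qlow r.
Proof. apply exp_pos. Qed.

Lemma qupp_pos (r : R) : 0 < qupp r.
Proof. apply exp_pos. Qed.

Lemma qpoch_neq0 (x : C) (n : nat) : Cmod x < 1 -> qpoch x n <> 0.
Proof.
  intros hx e. assert (h := proj1 (qpoch_bounds x n hx)). rewrite e, Cmod_0 in h.
  pose proof (qlow_pos (Cmod x)). lra.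
Qed.

(* The telescoped series of (x; x)_oo = lim qpoch x n. *)
Definition qinf (x : C) : C := (1 - Csum (fun n => qpoch x n * x ^ S n))%C.

Lemma Clim_sum (f : nat -> C) : Csummable f ->
  Clim (fun n => (sum_n (fun k => Re (f k)) n, sum_n (fun k => Im (f k)) n)) (Csum f).
Proof.
  intro hf. split; simpl; apply is_lim_seq_Sum; [apply Csummable_re|apply Csummable_im]; exact hf.
Qed.

Lemma filterlim_S : filterlim S eventually eventually.
Proof. intros P [N h]. exists N. intros n hn. apply h. lia. Qed.

Lemma Clim_of_S (u : nat -> C) (l : C) : Clim (fun n => u (S n)) l -> Clim u l.
Proof.
  intros [a b]. split; apply is_lim_seq_incr_1; assumption.
Qed.

Lemma qinf_lim (x : C) : Cmod x < 1 -> Clim (qpoch x) (qinf x).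
Proof.
  intro hx. set (f := fun n => (qpoch x n * x ^ S n)%C).
  assert (hf : Csummable f).
  { apply Csummable_dom with (fun n => qupp (Cmod x) * Cmod x * Cmod x ^ n).
    - intro n. unfold f. rewrite Cmod_mult, Cmod_pow. rewrite Rmult_assoc.
      apply Rmult_le_compat_r; [apply (pow_le (Cmod x) (S n)), Cmod_ge_0|apply qpoch_bounds; exact hx].
    - apply summable_scal, summable_geom. split; [apply Cmod_ge_0|exact hx]. }
  apply Clim_of_S. unfold qinf. fold f.
  apply Clim_ext with (fun n => (1 - (sum_n (fun k => Re (f k)) n, sum_n (fun k => Im (f k)) n))%C).
  - induction n as [|n IH].
    + rewrite !sum_O. unfold f. cbn [qpoch]. apply Ceq_parts; simpl; ring.
    + change (qpoch x (S (S n))) with (qpoch x (S n) * (1 - x ^ S (S n)))%C.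
      transitivity (qpoch x (S n) - f (S n))%C; [|unfold f; ring]. rewrite <- IH.
      rewrite !sum_Sn. apply Ceq_parts; simpl; unfold plus; simpl; ring.
  - apply Clim_minus; [apply Clim_const|apply Clim_sum, hf].
Qed.

Lemma qinf_neq0 (x : C) : Cmod x < 1 -> qinf x <> 0.
Proof.
  intros hx e. assert (h := Clim_Cmod _ _ (qinf_lim x hx)). rewrite e, Cmod_0 in h.
  assert (h2 := is_lim_seq_le (fun _ => qlow (Cmod x)) _ (qlow (Cmod x)) 0
    (fun n => proj1 (qpoch_bounds x n hx)) (is_lim_seq_const _) h).
  simpl in h2. pose proof (qlow_pos (Cmod x)). lra.
Qed.

Lemma Cmod_div_le (a b : C) (p m : R) :
  0 < m -> m <= Cmod b -> Cmod a <= p -> Cmod (a / b) <= p / m.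
Proof.
  intros hm hb ha. assert (b <> 0) by (intro e; rewrite e, Cmod_0 in hb; lra).
  rewrite Cmod_div by assumption. apply Rmult_le_compat; auto using Cmod_ge_0.
  - left; apply Rinv_0_lt_compat; lra.
  - apply Rinv_le_contravar; lra.
Qed.

Lemma gbin_nat (x : C) (n m : nat) :
  x <> 0 -> Cmod x < 1 -> (m <= n)%nat ->
  gbin x n (Z.of_nat m) = (qpoch x n / (qpoch x m * qpoch x (n - m)))%C.
Proof.
  intros hx hx1 hm. rewrite <- (gbin_qpoch x n m hx hm). field. split; apply qpoch_neq0; exact hx1.
Qed.

(** Uniform in both indices, this supplies the domination when n tends to infinity in the triple
    product and in Schur's sums. *)
Lemma gbin_bound (x : C) : x <> 0 -> Cmod x < 1 ->
  forall n m, Cmod (gbin x n m) <= qupp (Cmod x) / (qlow (Cmod x) * qlow (Cmod x)).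
Proof.
  intros hx hx1 n m. set (a := qlow (Cmod x)). assert (ha : 0 < a) by apply qlow_pos.
  assert (hu := qupp_pos (Cmod x)).
  destruct (Z_lt_le_dec m 0) as [h|h]; [|destruct (Z_lt_le_dec (Z.of_nat n) m) as [h2|h2]].
  1,2: rewrite gbin_out by lia; rewrite Cmod_0; apply Rlt_le, Rdiv_lt_0_compat; nra.
  replace m with (Z.of_nat (Z.to_nat m)) by lia. rewrite gbin_nat by (auto; lia).
  apply Cmod_div_le; [nra| |apply qpoch_bounds; exact hx1].
  rewrite Cmod_mult. assert (h3 := qpoch_bounds x (Z.to_nat m) hx1).
  assert (h4 := qpoch_bounds x (n - Z.to_nat m) hx1). fold a in h3, h4. nra.
Qed.

(** The hypothesis says that the lower index and its complement both tend to infinity; the three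
    factors of the quotient then all tend to (x; x)_oo, and one power of its inverse remains. *)
Lemma gbin_lim (x : C) (n : nat -> nat) (m : nat -> Z) :
  x <> 0 -> Cmod x < 1 -> (forall K : nat, exists N, forall k, (N <= k)%nat ->
    (Z.of_nat K <= m k /\ m k + Z.of_nat K <= Z.of_nat (n k))%Z) ->
  Clim (fun k => gbin x (n k) (m k)) (/ qinf x)%C.
Proof.
  intros hx hx1 h.
  assert (hq := qinf_neq0 x hx1).
  assert (l1 : filterlim (fun k => Z.to_nat (m k)) eventually eventually).
  { intros P [K hK]. destruct (h K) as [N hN]. exists N. intros k hk. apply hK. specialize (hN k hk). lia. }
  assert (l2 : filterlim (fun k => (n k - Z.to_nat (m k))%nat) eventually eventually).
  { intros P [K hK]. destruct (h K) as [N hN]. exists N. intros k hk. apply hK. specialize (hN k hk). lia. }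
  assert (l3 : filterlim n eventually eventually).
  { intros P [K hK]. destruct (h K) as [N hN]. exists N. intros k hk. apply hK. specialize (hN k hk). lia. }
  assert (hl := qinf_lim x hx1).
  assert (hd : Clim (fun k => (qpoch x (n k) * / (qpoch x (Z.to_nat (m k)) * qpoch x (n k - Z.to_nat (m k))))%C)
     (qinf x * / (qinf x * qinf x))%C).
  { apply Clim_mult; [apply Clim_subseq; assumption|]. apply Clim_inv.
    - intro k. apply Cmult_neq_0; apply qpoch_neq0, hx1.
    - apply Cmult_neq_0; exact hq.
    - apply Clim_mult; [apply (Clim_subseq _ _ _ l1 hl)|apply (Clim_subseq _ _ _ l2 hl)]. }
  replace (qinf x * / (qinf x * qinf x))%C with (/ qinf x)%C in hd by (field; exact hq).
  destruct (h 0%nat) as [N hN].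
  assert (e : forall k, (N <= k)%nat -> (qpoch x (n k) * / (qpoch x (Z.to_nat (m k)) * qpoch x (n k - Z.to_nat (m k))))%C = gbin x (n k) (m k)).
  { intros k hk. specialize (hN k hk). rewrite <- (Z2Nat.id (m k)) at 3 by lia. rewrite gbin_nat by (auto; lia). reflexivity. }
  destruct hd as [d1 d2]. split; [revert d1|revert d2]; apply is_lim_seq_ext_loc; exists N; intros k hk; rewrite e by exact hk; reflexivity.
Qed.

(** The finite identity in the limit, by domination over j. The statement keeps the finite products,
    because later lemmas regroup their factors before passing to the limit. *)
Lemma triple_product (u x : C) :
  u <> 0 -> x <> 0 -> Cmod x < 1 ->
  Clim (fun n => jprod u x n * qinf x)%C (theta tri u x).
Proof.
  intros hu hx hx1. assert (hq := qinf_neq0 x hx1).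
  assert (htri : forall j, (j * j - Z.abs j <= 2 * tri j)%Z) by (intro; apply le_tri).
  destruct (theta_bound u x tri hu hx1 htri) as [K [hK0 hK]].
  set (B := qupp (Cmod x) / (qlow (Cmod x) * qlow (Cmod x))).
  replace (theta tri u x) with ((theta tri u x * / qinf x) * qinf x)%C by (field; exact hq).
  apply Clim_mult; [|apply Clim_const].
  apply Clim_ext with (fun n => Csum (jterm u x n)); [intro n; symmetry; apply jprod_finite; assumption|].
  replace (theta tri u x * / qinf x)%C with (Csum (fun j => (/ qinf x) * (zpow u j * zpow x (tri j))))%C.
  2:{ rewrite Csum_scal by (apply theta_summable; auto). unfold theta. ring. }
  apply Clim_Csum with (fun j => B * K * (1 / 2) ^ Z.abs_nat j).
  - apply summable_scal, summable_half_Z.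
  - intros n j. unfold jterm. rewrite Cmod_mult, Rmult_comm, Rmult_assoc.
    apply Rmult_le_compat; auto using Cmod_ge_0. apply gbin_bound; assumption.
  - intro j. unfold jterm.
    replace (/ qinf x * (zpow u j * zpow x (tri j)))%C with ((zpow u j * zpow x (tri j)) * / qinf x)%C by ring.
    apply Clim_mult; [apply Clim_const|]. apply gbin_lim; [exact hx|exact hx1|].
    intro N. exists (N + Z.to_nat (Z.abs j))%nat. intros k hk. lia.
Qed.

(** * The Rogers-Ramanujan continued fraction *)

Lemma Csum_single (f : Z -> C) (k : Z) : (forall j, j <> k -> f j = 0) -> Csum f = f k.
Proof.
  intro h.
  assert (hp : forall g : Z -> R, (forall j, j <> k -> g j = 0) -> Sum g = g k).
  { intros g hg. apply Sum_unique. replace (g k) with (lsum g (k :: nil)) by (simpl; ring).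
    apply is_sum_finite; [constructor; [intros []|constructor]|]. intros j hj. apply hg.
    intro e; apply hj; left; auto. }
  unfold Csum. rewrite (hp (fun j => Re (f j))), (hp (fun j => Im (f j))).
  - symmetry; apply surjective_pairing.
  - intros j hj; rewrite h by exact hj; reflexivity.
  - intros j hj; rewrite h by exact hj; reflexivity.
Qed.

(** Schur's sum with lower index floor((n - 5j)/2) + c. The choice c = 0 with [expA] gives the
    numerators of the convergents, c = 1 with [expB] the denominators. *)
Definition schur (c : Z) (e : Z -> Z) (x : C) (n : nat) : C :=
  Csum (fun j => zpow (-1) j * zpow x (e j) * gbin x n ((Z.of_nat n - 5 * j) / 2 + c))%C.

Lemma schur_summable (c : Z) (e : Z -> Z) (x : C) (n k : nat) : (0 <= c <= 1)%Z -> (k <= 2)%nat ->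
  Csummable (fun j => zpow (-1) j * zpow x (e j) * gbin x n ((Z.of_nat (n + k) - 5 * j) / 2 + c))%C.
Proof.
  intros hc hk. apply Csummable_compact with (n + 4)%nat. intros j h.
  rewrite gbin_out; [ring|].
  assert (h2 := Z.div_mod (Z.of_nat (n + k) - 5 * j) 2 ltac:(lia)).
  assert (h3 := Z.mod_pos_bound (Z.of_nat (n + k) - 5 * j) 2 ltac:(lia)). lia.
Qed.

Lemma RtoC_neq0 (x : R) : x <> 0 -> RtoC x <> 0.
Proof. intros h e. apply h. injection e. auto. Qed.

Lemma Cm1_neq0 : RtoC (-1) <> 0.
Proof. apply RtoC_neq0; lra. Qed.

(* Schur's recurrence: after the two Pascal rules the remainders of consecutive indices cancel. *)
Lemma schur_rec (c : Z) (e : Z -> Z) (x : C) (n : nat) :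
  (0 <= c <= 1)%Z -> x <> 0 -> (forall j, e j - e (j - 1) = 5 * j - 2 * c - 2)%Z ->
  schur c e x (S (S n)) = (schur c e x (S n) + x ^ S n * schur c e x n)%C.
Proof.
  intros hc hx he. unfold schur.
  set (t := fun k m j => (zpow (-1) j * zpow x (e j) * gbin x m ((Z.of_nat (m + k) - 5 * j) / 2 + c))%C).
  set (w := fun j => (zpow (-1) j * zpow x (e j))%C).
  set (m := fun j => ((Z.of_nat (S (S n)) - 5 * j) / 2 + c)%Z).
  (* [rho j] is the term left over at an index with n - 5j even, where the defining Pascal rule
     comes first and the mirror rule second. At an odd index the order is reversed and the leftover
     is -[rho (j + 1)]. Summed over j these cancel by a shift. *)
  set (rho := fun j => if Z.even (Z.of_nat n - 5 * j) then (w j * zpow x (m j) * gbin x n (m j))%C else RtoC 0).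
  assert (hrho : Csummable rho).
  { apply Csummable_compact with (n + 4)%nat. intros j h. unfold rho. destruct Z.even; [|reflexivity].
    rewrite gbin_out; [ring|]. unfold m.
    assert (h2 := Z.div_mod (Z.of_nat (S (S n)) - 5 * j) 2 ltac:(lia)).
    assert (h3 := Z.mod_pos_bound (Z.of_nat (S (S n)) - 5 * j) 2 ltac:(lia)). lia. }
  assert (h2 := schur_summable c e x (S (S n)) 0 hc ltac:(lia)).
  assert (h1 := schur_summable c e x (S n) 0 hc ltac:(lia)).
  assert (h0 := schur_summable c e x n 0 hc ltac:(lia)).
  rewrite Nat.add_0_r in h2, h1, h0.
  assert (key : forall j, (zpow (-1) j * zpow x (e j) * gbin x (S (S n)) ((Z.of_nat (S (S n)) - 5 * j) / 2 + c))%C =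
     ((zpow (-1) j * zpow x (e j) * gbin x (S n) ((Z.of_nat (S n) - 5 * j) / 2 + c) +
      x ^ S n * (zpow (-1) j * zpow x (e j) * gbin x n ((Z.of_nat n - 5 * j) / 2 + c))) + (rho j + (-1) * rho (j + 1)%Z))%C).
  { intro j. fold (m j). fold (w j).
    assert (ev1 : Z.even (Z.of_nat n - 5 * (j + 1)) = negb (Z.even (Z.of_nat n - 5 * j))).
    { replace (Z.of_nat n - 5 * (j + 1))%Z with (Z.of_nat n - 5 * j + 5 * -1)%Z by lia.
      rewrite Z.even_add. destruct (Z.even (Z.of_nat n - 5 * j)); reflexivity. }
    unfold rho. rewrite ev1.
    destruct (Z.even (Z.of_nat n - 5 * j)) eqn:ev.
    - apply Z.even_spec in ev. destruct ev as [p hp].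
      assert (e2 : m j = (p + 1 + c)%Z).
      { unfold m. replace (Z.of_nat (S (S n)) - 5 * j)%Z with ((p + 1) * 2)%Z by lia. rewrite Z.div_mul by lia. lia. }
      replace ((Z.of_nat (S n) - 5 * j) / 2 + c)%Z with (m j - 1)%Z.
      2:{ rewrite e2. replace (Z.of_nat (S n) - 5 * j)%Z with (1 + p * 2)%Z by lia. rewrite Z.div_add by lia. simpl. lia. }
      replace ((Z.of_nat n - 5 * j) / 2 + c)%Z with (m j - 1)%Z.
      2:{ rewrite e2. replace (Z.of_nat n - 5 * j)%Z with (p * 2)%Z by lia. rewrite Z.div_mul by lia. lia. }
      simpl negb. cbv iota.
      change (gbin x (S (S n)) (m j)) with (gbin x (S n) (m j - 1) + zpow x (m j) * gbin x (S n) (m j))%C.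
      rewrite (gbin_pascal x n (m j)) by exact hx.
      assert (e3 : (zpow x (m j) * zpow x (Z.of_nat (S n) - m j))%C = (x ^ S n)%C)
        by (rewrite <- zpow_nat, <- zpow_add by exact hx; f_equal; lia).
      rewrite <- e3. ring.
    - assert (od : Z.odd (Z.of_nat n - 5 * j) = true) by (rewrite <- Z.negb_even, ev; reflexivity).
      apply Z.odd_spec in od. destruct od as [p hp].
      assert (e2 : m j = (p + 1 + c)%Z).
      { unfold m. replace (Z.of_nat (S (S n)) - 5 * j)%Z with (1 + (p + 1) * 2)%Z by lia. rewrite Z.div_add by lia. simpl. lia. }
      replace ((Z.of_nat (S n) - 5 * j) / 2 + c)%Z with (m j).
      2:{ rewrite e2. replace (Z.of_nat (S n) - 5 * j)%Z with ((p + 1) * 2)%Z by lia. rewrite Z.div_mul by lia. lia. }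
      replace ((Z.of_nat n - 5 * j) / 2 + c)%Z with (m j - 1)%Z.
      2:{ rewrite e2. replace (Z.of_nat n - 5 * j)%Z with (1 + p * 2)%Z by lia. rewrite Z.div_add by lia. simpl. lia. }
      simpl negb. cbv iota.
      assert (e4 : m (j + 1)%Z = (m j - 2)%Z).
      { rewrite e2. unfold m. replace (Z.of_nat (S (S n)) - 5 * (j + 1))%Z with ((p - 1) * 2)%Z by lia. rewrite Z.div_mul by lia. lia. }
      rewrite e4.
      rewrite (gbin_pascal x (S n) (m j)) by exact hx.
      change (gbin x (S n) (m j - 1)) with (gbin x n (m j - 1 - 1) + zpow x (m j - 1) * gbin x n (m j - 1))%C.
      replace (m j - 1 - 1)%Z with (m j - 2)%Z by lia.
      assert (e3 : (zpow x (Z.of_nat (S (S n)) - m j) * zpow x (m j - 1))%C = (x ^ S n)%C)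
        by (rewrite <- zpow_nat, <- zpow_add by exact hx; f_equal; lia).
      assert (e5 : (w (j + 1)%Z * zpow x (m j - 2))%C = (- (w j * zpow x (Z.of_nat (S (S n)) - m j)))%C).
      { unfold w. rewrite (zpow_add (-1)) by exact Cm1_neq0. rewrite zpow_1.
        assert (e6 : (zpow x (e (j + 1)%Z) * zpow x (m j - 2))%C = (zpow x (e j) * zpow x (Z.of_nat (S (S n)) - m j))%C).
        { rewrite <- !zpow_add by exact hx. f_equal. specialize (he (j + 1)%Z).
          replace (j + 1 - 1)%Z with j in he by lia. lia. }
        transitivity (zpow (-1) j * - (1) * (zpow x (e (j + 1)%Z) * zpow x (m j - 2)))%C; [ring|]. rewrite e6. ring. }
      rewrite e5, <- e3. ring. }
  rewrite (Csum_ext _ _ key).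
  rewrite !Csum_plus; try (repeat (apply Csummable_plus || apply Csummable_scal)); try assumption;
    try (apply Csummable_shift; exact hrho).
  rewrite Csum_scal by (exact h0). rewrite Csum_scal by (apply Csummable_shift; exact hrho).
  rewrite <- (Csum_shift rho 1) by exact hrho. ring.
Qed.

Lemma schur_lim (c : Z) (e : Z -> Z) (x : C) :
  (0 <= c <= 1)%Z -> x <> 0 -> Cmod x < 1 -> (forall j, j * j - Z.abs j <= 2 * e j)%Z ->
  Clim (schur c e x) (theta e (-1) x * / qinf x)%C.
Proof.
  intros hc hx hx1 he. assert (hq := qinf_neq0 x hx1).
  destruct (theta_bound (-1) x e Cm1_neq0 hx1 he) as [K [hK0 hK]].
  set (B := qupp (Cmod x) / (qlow (Cmod x) * qlow (Cmod x))).
  replace (theta e (-1) x * / qinf x)%C with (Csum (fun j => (/ qinf x) * (zpow (-1) j * zpow x (e j))))%C.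
  2:{ rewrite Csum_scal by (apply theta_summable; auto using Cm1_neq0). unfold theta. ring. }
  apply Clim_Csum with (fun j => B * K * (1 / 2) ^ Z.abs_nat j).
  - apply summable_scal, summable_half_Z.
  - intros n j. rewrite Cmod_mult, Rmult_comm, Rmult_assoc.
    apply Rmult_le_compat; auto using Cmod_ge_0. apply gbin_bound; assumption.
  - intro j.
    replace (/ qinf x * (zpow (-1) j * zpow x (e j)))%C with ((zpow (-1) j * zpow x (e j)) * / qinf x)%C by ring.
    apply Clim_mult; [apply Clim_const|]. apply (gbin_lim x (fun n => n)); [exact hx|exact hx1|].
    intro N. exists (2 * N + 5 * Z.to_nat (Z.abs j) + 3)%nat. intros k hk.
    assert (h2 := Z.div_mod (Z.of_nat k - 5 * j) 2 ltac:(lia)).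
    assert (h3 := Z.mod_pos_bound (Z.of_nat k - 5 * j) 2 ltac:(lia)). lia.
Qed.

(** * Continuants of the continued fraction *)

Fixpoint cont (q : R) (n k : nat) : R :=
  match n with
  | O => 1
  | S n1 => match n1 with
            | O => 1
            | S n2 => cont q n1 (S k) + q ^ k * cont q n2 (S (S k))
            end
  end.

Lemma cont_pos (q : R) (n k : nat) : 0 <= q -> 1 <= cont q n k.
Proof.
  intro hq. assert (h : forall n, (forall k, 1 <= cont q n k) /\ (forall k, 1 <= cont q (S n) k)).
  { clear n k. induction n as [|n [I1 I2]]; split; intro k.
    - simpl; lra.
    - simpl; lra.
    - apply I2.
    - change (1 <= cont q (S n) (S k) + q ^ k * cont q n (S (S k))).
      specialize (I1 (S (S k))). specialize (I2 (S k)). assert (0 <= q ^ k) by (apply pow_le; exact hq). nra. }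
  apply h.
Qed.

Lemma rr_tail_cont (q : R) (n k : nat) :
  0 <= q -> rr_tail q n k = cont q (S n) k / cont q n (S k).
Proof.
  intro hq. revert k. induction n as [|n IH]; intro k.
  - simpl. field.
  - cbn [rr_tail]. rewrite IH.
    change (cont q (S (S n)) k) with (cont q (S n) (S k) + q ^ k * cont q n (S (S k))).
    assert (h1 := cont_pos q (S n) (S k) hq). assert (h2 := cont_pos q n (S (S k)) hq). field. lra.
Qed.

(** The definition unfolds a continuant at the front of the fraction, which matches [rr_tail]. This
    is the expansion at the far end, with the starting index k fixed, and has the form of Schur's
    recurrence. *)
Lemma cont_rec (q : R) (n k : nat) :
  cont q (S (S n)) k = cont q (S n) k + q ^ (k + n) * cont q n k.
Proof.
  assert (h : forall n, (forall k, cont q (S (S n)) k = cont q (S n) k + q ^ (k + n) * cont q n k) /\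
    (forall k, cont q (S (S (S n))) k = cont q (S (S n)) k + q ^ (k + S n) * cont q (S n) k)).
  { clear n k. induction n as [|n [I1 I2]]; split; intro k.
    - simpl. rewrite Nat.add_0_r. ring.
    - simpl. replace (k + 1)%nat with (S k) by lia. simpl. ring.
    - apply I2.
    - change (cont q (S (S (S (S n)))) k) with (cont q (S (S (S n))) (S k) + q ^ k * cont q (S (S n)) (S (S k))).
      rewrite (I2 (S k)), (I1 (S (S k))).
      change (cont q (S (S (S n))) k) with (cont q (S (S n)) (S k) + q ^ k * cont q (S n) (S (S k))).
      change (cont q (S (S n)) k) with (cont q (S n) (S k) + q ^ k * cont q n (S (S k))).
      replace (S k + S n)%nat with (k + S (S n))%nat by lia.
      replace (S (S k) + n)%nat with (k + S (S n))%nat by lia. ring. }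
  apply h.
Qed.

Definition expA (j : Z) : Z := (j * (5 * j + 1) / 2)%Z.

Definition expB (j : Z) : Z := (j * (5 * j - 3) / 2)%Z.

Lemma expA_tri (j : Z) : expA j = (5 * tri j - 2 * j)%Z.
Proof.
  unfold expA. replace (j * (5 * j + 1))%Z with ((5 * tri j - 2 * j) * 2)%Z by (pose proof (tri_spec j); lia).
  apply Z.div_mul; lia.
Qed.

Lemma expB_tri (j : Z) : expB j = (5 * tri j - 4 * j)%Z.
Proof.
  unfold expB. replace (j * (5 * j - 3))%Z with ((5 * tri j - 4 * j) * 2)%Z by (pose proof (tri_spec j); lia).
  apply Z.div_mul; lia.
Qed.

Lemma le_expA (j : Z) : (j * j - Z.abs j <= 2 * expA j)%Z.
Proof. rewrite expA_tri. pose proof (tri_spec j). destruct (Z.abs_spec j); nia. Qed.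

Lemma le_expB (j : Z) : (j * j - Z.abs j <= 2 * expB j)%Z.
Proof. rewrite expB_tri. pose proof (tri_spec j). destruct (Z.abs_spec j); nia. Qed.

(** For n <= 1 every index j other than 0 puts the lower index outside the range 0..n, so a single
    term survives. *)
Lemma schur_small (c : Z) (e : Z -> Z) (x : C) (n : nat) :
  (0 <= c <= 1)%Z -> (n <= 1)%nat -> e 0%Z = 0%Z ->
  schur c e x n = gbin x n c.
Proof.
  intros hc hn he. unfold schur. rewrite (Csum_single _ 0).
  - rewrite he. change (zpow x 0) with (RtoC 1). change (zpow (-1) 0) with (RtoC 1).
    replace ((Z.of_nat n - 5 * 0) / 2 + c)%Z with c; [ring|].
    replace (Z.of_nat n - 5 * 0)%Z with (Z.of_nat n) by lia. rewrite Z.div_small by lia. lia.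
  - intros j hj. rewrite gbin_out; [ring|].
    assert (h2 := Z.div_mod (Z.of_nat n - 5 * j) 2 ltac:(lia)).
    assert (h3 := Z.mod_pos_bound (Z.of_nat n - 5 * j) 2 ltac:(lia)). lia.
Qed.

Lemma cont_schurA (q : R) (n : nat) : q <> 0 -> RtoC (cont q n 1) = schur 0 expA q n.
Proof.
  intro hq. assert (hx := RtoC_neq0 q hq).
  assert (h : forall n, RtoC (cont q n 1) = schur 0 expA q n /\ RtoC (cont q (S n) 1) = schur 0 expA q (S n)).
  { clear n. induction n as [|n [I1 I2]]; split.
    - rewrite schur_small by (reflexivity || lia). reflexivity.
    - rewrite schur_small by (reflexivity || lia). cbn. ring.
    - exact I2.
    - rewrite schur_rec; [|lia|exact hx|].
      + rewrite <- I1, <- I2, cont_rec. replace (1 + n)%nat with (S n) by lia.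
        rewrite RtoC_plus, RtoC_mult, RtoC_pow. reflexivity.
      + intro j. rewrite !expA_tri. pose proof (tri_spec j). pose proof (tri_spec (j - 1)). lia. }
  apply h.
Qed.

(** The shift by one is due to the start at q^2: the recurrence of [cont q n 2] has the coefficient
    q^(n+2), which Schur's sum has one index later. *)
Lemma cont_schurB (q : R) (n : nat) : q <> 0 -> RtoC (cont q n 2) = schur 1 expB q (S n).
Proof.
  intro hq. assert (hx := RtoC_neq0 q hq).
  assert (hr : forall n, schur 1 expB q (S (S n)) = (schur 1 expB q (S n) + RtoC q ^ S n * schur 1 expB q n)%C).
  { intro k. apply schur_rec; [lia|exact hx|].
    intro j. rewrite !expB_tri. pose proof (tri_spec j). pose proof (tri_spec (j - 1)). lia. }
  assert (h : forall n, RtoC (cont q n 2) = schur 1 expB q (S n) /\ RtoC (cont q (S n) 2) = schur 1 expB q (S (S n))).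
  { clear n. induction n as [|n [I1 I2]]; split.
    - rewrite schur_small by (reflexivity || lia). cbn. ring.
    - rewrite hr. rewrite !schur_small by (reflexivity || lia). cbn. ring.
    - exact I2.
    - rewrite hr. rewrite <- I1, <- I2, cont_rec. replace (2 + n)%nat with (S (S n)) by lia.
      rewrite RtoC_plus, RtoC_mult, RtoC_pow. reflexivity. }
  apply h.
Qed.

(** * Product forms of A and B *)

Definition thA (q : R) : R := Re (theta expA (-1) q).

Definition thB (q : R) : R := Re (theta expB (-1) q).

Fixpoint rpoch (q : R) (n : nat) : R :=
  match n with
  | O => 1
  | S n' => rpoch q n' * (1 - q ^ S n')
  end.

Lemma rpoch_qpoch (q : R) (n : nat) : qpoch q n = RtoC (rpoch q n).
Proof.
  induction n as [|n IH]; [reflexivity|]. cbn [qpoch rpoch]. rewrite IH, RtoC_mult, RtoC_minus, RtoC_pow. reflexivity.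
Qed.

Definition eulerT (q : R) : R := Re (qinf q).

Lemma Clim_real (u : nat -> R) (l : C) : Clim (fun n => RtoC (u n)) l -> l = RtoC (Re l) /\ is_lim_seq u (Re l).
Proof.
  intros [h1 h2]. split; [|exact h1]. apply Ceq_parts; [reflexivity|]. simpl in *.
  assert (h3 := is_lim_seq_unique _ _ h2). rewrite Lim_seq_const in h3. injection h3. auto.
Qed.

Lemma Cmod_RtoC_lt1 (q : R) : 0 < q < 1 -> Cmod q < 1.
Proof. intro h. rewrite Cmod_R, Rabs_pos_eq; lra. Qed.

Lemma eulerT_lim (q : R) : 0 < q < 1 -> RtoC (eulerT q) = qinf q /\ is_lim_seq (rpoch q) (eulerT q).
Proof.
  intro hq. assert (h := qinf_lim q (Cmod_RtoC_lt1 q hq)).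
  apply (Clim_ext _ (fun n => RtoC (rpoch q n))) in h; [|intro; apply rpoch_qpoch].
  destruct (Clim_real _ _ h) as [h1 h2]. split; [symmetry; exact h1|exact h2].
Qed.

Lemma rpoch_low (q : R) (n : nat) : 0 < q < 1 -> qlow q <= rpoch q n.
Proof.
  intro hq. assert (h := proj1 (qpoch_bounds q n (Cmod_RtoC_lt1 q hq))).
  rewrite rpoch_qpoch, !Cmod_R, (Rabs_pos_eq q) in h by lra.
  rewrite Rabs_pos_eq in h; [exact h|]. clear h. induction n as [|n IH]; cbn [rpoch]; [lra|].
  apply Rmult_le_pos; [exact IH|]. assert (q ^ S n <= 1); [|lra]. rewrite <- (pow1 (S n)). apply pow_incr; lra.
Qed.

Lemma is_lim_seq_ge (u : nat -> R) (l c : R) : (forall n, c <= u n) -> is_lim_seq u l -> c <= l.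
Proof. intros h hl. apply (is_lim_seq_le (fun _ => c) u c l h (is_lim_seq_const c) hl). Qed.

Lemma eulerT_pos (q : R) : 0 < q < 1 -> 0 < eulerT q.
Proof.
  intro hq. assert (qlow q <= eulerT q).
  { apply is_lim_seq_ge with (rpoch q); [intro; apply rpoch_low; exact hq|apply eulerT_lim; exact hq]. }
  pose proof (qlow_pos q). lra.
Qed.

Fixpoint rprod (f : nat -> R) (n : nat) : R :=
  match n with
  | O => 1
  | S n' => rprod f n' * f n'
  end.

Lemma pow_le_pow (q : R) (m n : nat) : 0 < q < 1 -> (m <= n)%nat -> q ^ n <= q ^ m.
Proof.
  intros hq h. replace n with (m + (n - m))%nat by lia. rewrite pow_add.
  assert (0 < q ^ m) by (apply pow_lt; lra). assert (q ^ (n - m) <= 1).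
  { rewrite <- (pow1 (n - m)). apply pow_incr; lra. } nra.
Qed.

Lemma rprod_pos (f : nat -> R) (n : nat) : (forall i, 0 < f i) -> 0 < rprod f n.
Proof. intro h. induction n as [|n IH]; cbn; [lra|]. apply Rmult_lt_0_compat; auto. Qed.

Lemma rprod_low (q : R) (e : nat -> nat) (n : nat) :
  0 < q < 1 -> (forall i, (S i <= e i)%nat) -> qlow q <= rprod (fun i => 1 - q ^ e i) n.
Proof.
  intros hq he. eapply Rle_trans; [apply (rpoch_low q n hq)|].
  assert (h : 0 < rpoch q n <= rprod (fun i => 1 - q ^ e i) n); [|apply h].
  induction n as [|n [I1 I2]]; cbn [rprod rpoch]; [lra|].
  assert (h1 := pow_le_pow q (S n) (e n) hq (he n)).
  assert (h2 := pow_le_pow q 1 (S n) hq ltac:(lia)). rewrite pow_1 in h2.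
  split; [apply Rmult_lt_0_compat; lra|]. apply Rmult_le_compat; lra.
Qed.

Lemma rprod_mult (f g : nat -> R) (n : nat) : rprod (fun i => f i * g i) n = rprod f n * rprod g n.
Proof. induction n as [|n IH]; cbn; [ring|rewrite IH; ring]. Qed.

Lemma rprod_ext (f g : nat -> R) (n : nat) : (forall i, f i = g i) -> rprod f n = rprod g n.
Proof. intro h. induction n as [|n IH]; cbn; [reflexivity|rewrite IH, h; reflexivity]. Qed.

Lemma jprod_real (u x : R) (n : nat) : u <> 0 ->
  jprod u x n = RtoC (rprod (fun i => (1 + u * x ^ S i) * (1 + x ^ i / u)) n).
Proof.
  intro hu. induction n as [|n IH]; [reflexivity|]. cbn [jprod rprod]. rewrite IH.
  rewrite !RtoC_mult, !RtoC_plus, RtoC_mult, RtoC_div, !RtoC_pow by exact hu. reflexivity.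
Qed.

Lemma triple_product_real (u x : R) : u <> 0 -> 0 < x < 1 ->
  theta tri u x = RtoC (Re (theta tri u x)) /\
  is_lim_seq (fun n => rprod (fun i => (1 + u * x ^ S i) * (1 + x ^ i / u)) n * eulerT x) (Re (theta tri u x)).
Proof.
  intros hu hx. assert (h := triple_product u x (RtoC_neq0 u hu) (RtoC_neq0 x ltac:(lra)) (Cmod_RtoC_lt1 x hx)).
  apply Clim_real. eapply Clim_ext; [|exact h]. intro n.
  rewrite RtoC_mult, <- jprod_real by exact hu. destruct (eulerT_lim x hx) as [-> _]. reflexivity.
Qed.

Lemma pow5_bounds (q : R) : 0 < q < 1 -> 0 < q ^ 5 < 1.
Proof.
  intro h. split; [apply pow_lt; lra|]. assert (h2 := pow_le_pow q 1 5 h ltac:(lia)). rewrite pow_1 in h2. lra.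
Qed.

Lemma theta_ext (e1 e2 : Z -> Z) (u1 u2 x1 x2 : C) :
  (forall j, (zpow u1 j * zpow x1 (e1 j))%C = (zpow u2 j * zpow x2 (e2 j))%C) ->
  theta e1 u1 x1 = theta e2 u2 x2.
Proof. apply Csum_ext. Qed.

Lemma zpow_RtoC_pow (q : R) (n : nat) (k : Z) : q <> 0 -> zpow (RtoC (q ^ n)) k = zpow q (Z.of_nat n * k).
Proof. intro hq. rewrite RtoC_pow. apply zpow_pow, RtoC_neq0, hq. Qed.

(** The exponent 5 tri(j) - c j is that of the triple product in base q^5 at u = -q^(-c). Its
    factors become 1 - q^(5i+5-c) and 1 - q^(5i+c), so c = 2 gives the residues 3, 2 and c = 4 the
    residues 1, 4 modulo 5. *)
Lemma theta_pentagonal (e : Z -> Z) (c : nat) (q : R) :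
  0 < q < 1 -> (1 <= c <= 4)%nat -> (forall j, e j = 5 * tri j - Z.of_nat c * j)%Z ->
  theta e (-1) q = RtoC (Re (theta e (-1) q)) /\
  is_lim_seq (fun n => rprod (fun i => (1 - q ^ (5 * i + (5 - c))) * (1 - q ^ (5 * i + c))) n * eulerT (q ^ 5)) (Re (theta e (-1) q)).
Proof.
  intros hq hc he. assert (hqc : 0 < q ^ c) by (apply pow_lt; lra).
  assert (hu : - / q ^ c <> 0) by (assert (0 < / q ^ c) by (apply Rinv_0_lt_compat; lra); lra).
  assert (hq0 : RtoC q <> 0) by (apply RtoC_neq0; lra).
  assert (e0 : theta e (-1) q = theta tri (RtoC (- / q ^ c)%R) (RtoC (q ^ 5)%R)).
  { apply theta_ext. intro j. rewrite zpow_RtoC_pow by lra. rewrite he.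
    replace (- / q ^ c) with ((-1) * / q ^ c) by ring. rewrite RtoC_mult, RtoC_inv, RtoC_pow by lra.
    rewrite zpow_mul_l by (try apply Cm1_neq0; apply Cinv_neq0, Cpow_nz, hq0).
    rewrite zpow_inv_l by (apply Cpow_nz, hq0). rewrite zpow_pow by exact hq0.
    rewrite zpow_sub1 by exact hq0. change (Z.of_nat 5) with 5%Z. unfold Cdiv. ring. }
  rewrite e0. destruct (triple_product_real (- / q ^ c) (q ^ 5) hu (pow5_bounds q hq)) as [h1 h2].
  split; [exact h1|]. eapply is_lim_seq_ext; [|exact h2]. intro n. cbv beta. f_equal.
  apply rprod_ext. intro i. f_equal.
  - replace ((q ^ 5) ^ S i) with (q ^ (5 * i + (5 - c)) * q ^ c).
    2:{ rewrite <- pow_add, <- pow_mult. f_equal. lia. }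
    clear - hqc. revert hqc. generalize (q ^ (5 * i + (5 - c))), (q ^ c). intros p d hd. field. lra.
  - rewrite <- pow_mult, pow_add. clear - hqc. revert hqc. generalize (q ^ (5 * i)), (q ^ c). intros p d hd. field. lra.
Qed.

Lemma expA_spec4 (j : Z) : expA j = (5 * tri j - Z.of_nat 2 * j)%Z.
Proof. apply expA_tri. Qed.

Lemma expB_spec4 (j : Z) : expB j = (5 * tri j - Z.of_nat 4 * j)%Z.
Proof. apply expB_tri. Qed.

Lemma thA_lim (q : R) : 0 < q < 1 -> theta expA (-1) q = RtoC (thA q) /\
  is_lim_seq (fun n => rprod (fun i => (1 - q ^ (5 * i + 3)) * (1 - q ^ (5 * i + 2))) n * eulerT (q ^ 5)) (thA q).
Proof. intro hq. apply (theta_pentagonal expA 2 q hq ltac:(lia) expA_spec4). Qed.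

Lemma thB_lim (q : R) : 0 < q < 1 -> theta expB (-1) q = RtoC (thB q) /\
  is_lim_seq (fun n => rprod (fun i => (1 - q ^ (5 * i + 1)) * (1 - q ^ (5 * i + 4))) n * eulerT (q ^ 5)) (thB q).
Proof. intro hq. apply (theta_pentagonal expB 4 q hq ltac:(lia) expB_spec4). Qed.

Lemma penta_pos (q l : R) (a b : nat) : 0 < q < 1 -> (1 <= a)%nat -> (1 <= b)%nat ->
  is_lim_seq (fun n => rprod (fun i => (1 - q ^ (5 * i + a)) * (1 - q ^ (5 * i + b))) n * eulerT (q ^ 5)) l -> 0 < l.
Proof.
  intros hq ha hb hl. assert (hT := eulerT_pos (q ^ 5) (pow5_bounds q hq)).
  assert (hc := qlow_pos q).
  assert (qlow q * qlow q * eulerT (q ^ 5) <= l).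
  { apply is_lim_seq_ge with (2 := hl). intro n. apply Rmult_le_compat_r; [left; exact hT|]. rewrite rprod_mult.
    assert (h1 := rprod_low q (fun i => (5 * i + a)%nat) n hq ltac:(intro i; cbv beta; lia)).
    assert (h2 := rprod_low q (fun i => (5 * i + b)%nat) n hq ltac:(intro i; cbv beta; lia)).
    cbv beta in h1, h2. apply Rmult_le_compat; [left; exact hc|left; exact hc|exact h1|exact h2]. }
  eapply Rlt_le_trans; [|exact H]. repeat apply Rmult_lt_0_compat; assumption.
Qed.

Lemma thA_pos (q : R) : 0 < q < 1 -> 0 < thA q.
Proof. intro hq. apply (penta_pos q (thA q) 3 2 hq); [lia|lia|apply thA_lim, hq]. Qed.

Lemma thB_pos (q : R) : 0 < q < 1 -> 0 < thB q.
Proof. intro hq. apply (penta_pos q (thB q) 1 4 hq); [lia|lia|apply thB_lim, hq]. Qed.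

Lemma is_lim_seq_uniq (u : nat -> R) (l1 l2 : R) : is_lim_seq u l1 -> is_lim_seq u l2 -> l1 = l2.
Proof. intros a b. apply is_lim_seq_unique in a, b. rewrite a in b. injection b. auto. Qed.

Lemma rpoch_split5 (q : R) (n : nat) :
  rpoch q (5 * n) = rprod (fun i => (1 - q ^ (5 * i + 3)) * (1 - q ^ (5 * i + 2))) n *
    rprod (fun i => (1 - q ^ (5 * i + 1)) * (1 - q ^ (5 * i + 4))) n * rpoch (q ^ 5) n.
Proof.
  induction n as [|n IH]; [cbn; ring|]. cbn [rprod].
  replace (5 * S n)%nat with (S (S (S (S (S (5 * n)))))) by lia. cbn [rpoch]. rewrite IH, <- pow_mult.
  replace (S (S (S (S (S (5 * n))))))%nat with (5 * S n)%nat by lia.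
  replace (S (S (S (S (5 * n)))))%nat with (5 * n + 4)%nat by lia.
  replace (S (S (S (5 * n))))%nat with (5 * n + 3)%nat by lia.
  replace (S (S (5 * n)))%nat with (5 * n + 2)%nat by lia.
  replace (S (5 * n))%nat with (5 * n + 1)%nat by lia. ring.
Qed.

Lemma filterlim_mul_nat (d : nat) : (1 <= d)%nat -> filterlim (fun n => (d * n)%nat) eventually eventually.
Proof. intros hd P [N h]. exists N. intros n hn. apply h. nia. Qed.

(** The products of A and B together run over the exponents prime to 5; each also carries a factor
    T(q^5), one of which supplies the multiples of 5 and completes T(q). *)
Lemma thA_thB (q : R) : 0 < q < 1 -> thA q * thB q = eulerT q * eulerT (q ^ 5).
Proof.
  intro hq. destruct (thA_lim q hq) as [_ hA]. destruct (thB_lim q hq) as [_ hB].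
  destruct (eulerT_lim q hq) as [_ hT]. destruct (eulerT_lim (q ^ 5) (pow5_bounds q hq)) as [_ hT5].
  assert (h5 := is_lim_seq_subseq _ _ _ (filterlim_mul_nat 5 ltac:(lia)) hT).
  apply is_lim_seq_uniq with (fun n => (rprod (fun i => (1 - q ^ (5 * i + 3)) * (1 - q ^ (5 * i + 2))) n * eulerT (q ^ 5)) *
    (rprod (fun i => (1 - q ^ (5 * i + 1)) * (1 - q ^ (5 * i + 4))) n * eulerT (q ^ 5))).
  - apply is_lim_seq_mult'; assumption.
  - apply is_lim_seq_ext with (fun n => rpoch q (5 * n) * (/ rpoch (q ^ 5) n) * (eulerT (q ^ 5) * eulerT (q ^ 5))).
    + intro n. rewrite rpoch_split5. field. assert (h := rpoch_low (q ^ 5) n (pow5_bounds q hq)).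
      pose proof (qlow_pos (q ^ 5)). lra.
    + assert (hp := eulerT_pos (q ^ 5) (pow5_bounds q hq)).
      replace (eulerT q * eulerT (q ^ 5)) with (eulerT q * / eulerT (q ^ 5) * (eulerT (q ^ 5) * eulerT (q ^ 5))) by (field; lra).
      apply is_lim_seq_mult'; [apply is_lim_seq_mult'; [exact h5|]|apply is_lim_seq_const].
      apply (is_lim_seq_inv _ (eulerT (q ^ 5))); [exact hT5|]. intro e. injection e. intro e2. exact (Rgt_not_eq _ _ hp e2).
Qed.

(** Numerators and denominators of the convergents tend to A/T and B/T, and T cancels in the
    quotient. *)
Lemma RR_theta (q : R) : 0 < q < 1 -> RR q = Rpower q (1 / 5) * (thB q / thA q).
Proof.
  intro hq. assert (hx : RtoC q <> 0) by (apply RtoC_neq0; lra). assert (hx1 := Cmod_RtoC_lt1 q hq).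
  assert (hT := eulerT_pos q hq). assert (hAp := thA_pos q hq). assert (hBp := thB_pos q hq).
  destruct (eulerT_lim q hq) as [eT _]. destruct (thA_lim q hq) as [eA _]. destruct (thB_lim q hq) as [eB _].
  assert (lA : is_lim_seq (fun n => cont q n 1) (thA q * / eulerT q)).
  { apply Clim_RtoC. rewrite RtoC_mult, RtoC_inv by lra. rewrite <- eA, eT.
    eapply Clim_ext; [|apply (schur_lim 0 expA q ltac:(lia) hx hx1 le_expA)].
    intro n. symmetry; apply cont_schurA; lra. }
  assert (lB : is_lim_seq (fun n => cont q n 2) (thB q * / eulerT q)).
  { apply Clim_RtoC. rewrite RtoC_mult, RtoC_inv by lra. rewrite <- eB, eT.
    eapply Clim_ext; [|apply (Clim_subseq _ _ S filterlim_S (schur_lim 1 expB q ltac:(lia) hx hx1 le_expB))].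
    intro n. symmetry; apply cont_schurB; lra. }
  assert (l : is_lim_seq (fun n => rr_tail q n 1) (thA q / thB q)).
  { apply is_lim_seq_ext with (fun n => cont q (S n) 1 * / cont q n 2).
    - intro n. rewrite rr_tail_cont by lra. reflexivity.
    - replace (thA q / thB q) with ((thA q * / eulerT q) * / (thB q * / eulerT q)) by (field; lra).
      assert (0 < thB q * / eulerT q) by (apply Rmult_lt_0_compat; [lra|apply Rinv_0_lt_compat; lra]).
      apply is_lim_seq_mult'.
      + apply (is_lim_seq_incr_1 (fun n => cont q n 1)). exact lA.
      + apply (is_lim_seq_inv _ (thB q * / eulerT q)); [exact lB|]. intro e; injection e; lra. }
  unfold RR. rewrite (is_lim_seq_unique _ _ l). simpl. field. lra.
Qed.

(** * The quintic relation *)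

Lemma Csum_mod5 (f : Z -> C) : Csummable f ->
  Csum f = (Csum (fun m => f (5 * m)%Z) + Csum (fun m => f (5 * m + 1)%Z) + Csum (fun m => f (5 * m + 2)%Z) +
    Csum (fun m => f (5 * m + -2)%Z) + Csum (fun m => f (5 * m + -1)%Z))%C.
Proof.
  intro hf.
  pose (e := fun s : Z + Z + Z + Z + Z => match s with
    | inl (inl (inl (inl m))) => (5 * m)%Z | inl (inl (inl (inr m))) => (5 * m + 1)%Z
    | inl (inl (inr m)) => (5 * m + 2)%Z | inl (inr m) => (5 * m + -2)%Z | inr m => (5 * m + -1)%Z end).
  assert (einj : forall s t, e s = e t -> s = t).
  { intros [[[[a|a]|a]|a]|a] [[[[b|b]|b]|b]|b] h; unfold e in h; try (exfalso; lia); assert (a = b) as -> by lia; reflexivity. }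
  assert (hs := Csummable_inj e f einj hf).
  rewrite (Csum_reindex e f einj); [| |exact hf].
  - rewrite Csum_sumtype by exact hs.
    assert (hs1 : Csummable (fun s => f (e (inl s)))) by (apply (Csummable_inj (fun s => e (inl s)) f); [intros a b h; apply einj in h; congruence|exact hf]).
    rewrite Csum_sumtype by exact hs1.
    assert (hs2 : Csummable (fun s => f (e (inl (inl s))))) by (apply (Csummable_inj (fun s => e (inl (inl s))) f); [intros a b h; apply einj in h; congruence|exact hf]).
    rewrite Csum_sumtype by exact hs2.
    assert (hs3 : Csummable (fun s => f (e (inl (inl (inl s)))))) by (apply (Csummable_inj (fun s => e (inl (inl (inl s)))) f); [intros a b h; apply einj in h; congruence|exact hf]).
    rewrite Csum_sumtype by exact hs3. reflexivity.
  - intros j h. exfalso.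
    assert (h2 := Z.div_mod (j + 2) 5 ltac:(lia)). assert (h3 := Z.mod_pos_bound (j + 2) 5 ltac:(lia)).
    set (m := ((j + 2) / 5)%Z) in *. set (r := ((j + 2) mod 5)%Z) in *.
    assert (r = 0 \/ r = 1 \/ r = 2 \/ r = 3 \/ r = 4)%Z as [h4|[h4|[h4|[h4|h4]]]] by lia.
    + apply (h (inl (inr m))). unfold e. lia.
    + apply (h (inr m)). unfold e. lia.
    + apply (h (inl (inl (inl (inl m))))). unfold e. lia.
    + apply (h (inl (inl (inl (inr m))))). unfold e. lia.
    + apply (h (inl (inl (inr m)))). unfold e. lia.
Qed.

(** The reflection j -> -1 - j preserves tri(j) and changes the sign of (-1)^j. This removes the
    class j = 2 modulo 5 in the dissection. *)
Lemma theta_tri_m1 (x : C) : x <> 0 -> Cmod x < 1 -> theta tri (-1) x = 0.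
Proof.
  intros hx hx1.
  assert (hs := theta_summable (-1) x tri Cm1_neq0 hx1 le_tri).
  assert (h : theta tri (-1) x = (- (1) * theta tri (-1) x)%C).
  { unfold theta at 1. rewrite (Csum_bij (fun j => (-1 - j)%Z) (fun j => (-1 - j)%Z)); [|intro; lia|intro; lia|exact hs].
    unfold theta. rewrite <- Csum_scal by exact hs. apply Csum_ext. intro j.
    replace (tri (-1 - j)) with (tri j) by (pose proof (tri_spec j); pose proof (tri_spec (-1 - j)); lia).
    replace (-1 - j)%Z with (j + (-1 + -2 * j))%Z by lia.
    rewrite (zpow_add (-1)), (zpow_add (-1) (-1)), zpow_m1, <- (zpow_mul (-1) (-2)) by exact Cm1_neq0.
    change (zpow (-1) (-2)) with (/ (RtoC (-1) ^ 2))%C.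
    replace (/ (RtoC (-1) ^ 2))%C with (RtoC 1).
    2:{ rewrite <- RtoC_pow, <- RtoC_inv by lra. f_equal. field. }
    replace (/ RtoC (-1))%C with (RtoC (-1)) by (rewrite <- RtoC_inv by lra; f_equal; field).
    assert (e1 : zpow 1 j = 1).
    { destruct j; simpl; rewrite ?Cpow_1_l; try reflexivity. field. }
    rewrite e1. ring. }
  assert (h2 : (2 * theta tri (-1) x)%C = 0).
  { transitivity (theta tri (-1) x + theta tri (-1) x)%C; [ring|]. rewrite h at 2. ring. }
  replace (theta tri (-1) x) with (/ 2 * (2 * theta tri (-1) x))%C by field. rewrite h2. ring.
Qed.

Lemma zpow_unit5 (z : C) (m r : Z) : z <> 0 -> (z ^ 5)%C = 1 -> zpow (- z) (5 * m + r) = (zpow (-1) m * zpow (- z) r)%C.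
Proof.
  intros hz h5.
  assert (hz' : (- z)%C <> 0) by (intro e; apply hz; rewrite <- (Copp_0); rewrite <- e; ring).
  rewrite zpow_add by exact hz'. f_equal.
  change 5%Z with (Z.of_nat 5). rewrite <- zpow_pow by exact hz'. f_equal.
  transitivity (- (z ^ 5))%C; [ring|]. rewrite h5. ring.
Qed.

(* Modulo 5, the indices 0 and -1 give the expA part, 1 and -2 the expB part, and those = 2 cancel in pairs. *)
Lemma theta_dissect (z x : C) : z <> 0 -> (z ^ 5)%C = 1 -> x <> 0 -> Cmod x < 1 ->
  theta tri (- z) x = ((1 - / z) * (theta expA (-1) (x ^ 5) - (z + 1 + / z) * x * theta expB (-1) (x ^ 5)))%C.
Proof.
  intros hz h5 hx hx1.
  assert (hz' : (- z)%C <> 0) by (intro e; apply hz; rewrite <- (Copp_0); rewrite <- e; ring).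
  assert (hy : (x ^ 5)%C <> 0) by (apply Cpow_nz, hx).
  assert (hy1 : Cmod (x ^ 5) < 1).
  { rewrite Cmod_pow. apply Rle_lt_trans with (Cmod x); [|exact hx1]. apply (Cmod_pow_S_le x 4 hx1). }
  assert (sA := theta_summable (-1) _ expA Cm1_neq0 hy1 le_expA).
  assert (sB := theta_summable (-1) _ expB Cm1_neq0 hy1 le_expB).
  assert (eopp : forall m, zpow (-1) (- m) = zpow (-1) m).
  { intro m. rewrite zpow_opp, <- zpow_inv_l by exact Cm1_neq0. f_equal. rewrite <- RtoC_inv by lra. f_equal. field. }
  assert (tA : Csum (fun m => zpow (-1) m * zpow (x ^ 5) (expA (- m)))%C = theta expA (-1) (x ^ 5)).
  { unfold theta. rewrite (Csum_opp _ sA). apply Csum_ext. intro m. rewrite eopp. reflexivity. }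
  assert (tB : Csum (fun m => zpow (-1) m * zpow (x ^ 5) (expB (- m)))%C = theta expB (-1) (x ^ 5)).
  { unfold theta. rewrite (Csum_opp _ sB). apply Csum_ext. intro m. rewrite eopp. reflexivity. }
  assert (sA' : Csummable (fun m => zpow (-1) m * zpow (x ^ 5) (expA (- m)))%C).
  { apply theta_summable; [exact Cm1_neq0|exact hy1|]. intro m. assert (h := le_expA (- m)). lia. }
  assert (sB' : Csummable (fun m => zpow (-1) m * zpow (x ^ 5) (expB (- m)))%C).
  { apply theta_summable; [exact Cm1_neq0|exact hy1|]. intro m. assert (h := le_expB (- m)). lia. }
  assert (hp : forall k l j, (tri j = 5 * k + l)%Z -> zpow x (tri j) = (zpow (x ^ 5) k * zpow x l)%C).
  { intros k l j h. rewrite h, zpow_pow, zpow_add by exact hx. reflexivity. }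
  unfold theta at 1. rewrite Csum_mod5 by (apply theta_summable; auto using le_tri).
  rewrite (Csum_ext (fun m => zpow (- z) (5 * m) * _)%C (fun m => zpow (-1) m * zpow (x ^ 5) (expA m))%C).
  2:{ intro m. rewrite (hp (expA m) 0%Z) by (rewrite expA_tri; pose proof (tri_spec m); pose proof (tri_spec (5 * m)); lia).
      replace (zpow (- z) (5 * m)) with (zpow (- z) (5 * m + 0)) by (f_equal; lia).
      rewrite zpow_unit5 by assumption. rewrite !zpow_0. ring. }
  rewrite (Csum_ext (fun m => zpow (- z) (5 * m + 1) * _)%C (fun m => (- z * x) * (zpow (-1) m * zpow (x ^ 5) (expB (- m))))%C).
  2:{ intro m. rewrite (hp (expB (- m)) 1%Z) by (rewrite expB_tri; pose proof (tri_spec (- m)); pose proof (tri_spec (5 * m + 1)); lia).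
      rewrite zpow_unit5 by assumption. rewrite !zpow_1. ring. }
  rewrite (Csum_ext (fun m => zpow (- z) (5 * m + 2) * _)%C (fun m => (z * z * x ^ 3) * (zpow (-1) m * zpow ((x ^ 5) ^ 5) (tri m)))%C).
  2:{ intro m. rewrite (hp (5 * tri m)%Z 3%Z) by (pose proof (tri_spec m); pose proof (tri_spec (5 * m + 2)); lia).
      rewrite zpow_unit5 by assumption. rewrite (zpow_pow (x ^ 5)) by exact hy.
      change (zpow (- z) 2) with ((- z) ^ 2)%C. change (zpow x 3) with (x ^ 3)%C. change (Z.of_nat 5) with 5%Z. ring. }
  rewrite (Csum_ext (fun m => zpow (- z) (5 * m + -2) * _)%C (fun m => (/ z * / z * x) * (zpow (-1) m * zpow (x ^ 5) (expB m)))%C).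
  2:{ intro m. rewrite (hp (expB m) 1%Z) by (rewrite expB_tri; pose proof (tri_spec m); pose proof (tri_spec (5 * m + -2)); lia).
      rewrite zpow_unit5 by assumption. rewrite zpow_1. change (zpow (- z) (-2)) with (/ ((- z) ^ 2))%C. field. exact hz. }
  rewrite (Csum_ext (fun m => zpow (- z) (5 * m + -1) * _)%C (fun m => (- / z) * (zpow (-1) m * zpow (x ^ 5) (expA (- m))))%C).
  2:{ intro m. rewrite (hp (expA (- m)) 0%Z) by (rewrite expA_tri; pose proof (tri_spec (- m)); pose proof (tri_spec (5 * m + -1)); lia).
      rewrite zpow_unit5 by assumption. rewrite zpow_0, zpow_m1 by exact hz'. field. exact hz. }
  rewrite !Csum_scal; try assumption.
  - rewrite tA, tB. fold (theta expA (-1) (x ^ 5)). fold (theta expB (-1) (x ^ 5)). fold (theta tri (-1) ((x ^ 5) ^ 5)).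
    rewrite theta_tri_m1.
    + field. exact hz.
    + apply Cpow_nz, hy.
    + rewrite Cmod_pow. apply Rle_lt_trans with (Cmod (x ^ 5)); [|exact hy1]. apply (Cmod_pow_S_le (x ^ 5) 4 hy1).
  - apply theta_summable; [exact Cm1_neq0| |exact le_tri].
    rewrite Cmod_pow. apply Rle_lt_trans with (Cmod (x ^ 5)); [|exact hy1]. apply (Cmod_pow_S_le (x ^ 5) 4 hy1).
Qed.

(** * Primitive fifth roots of unity *)

Definition cyc5 (w : C) : Prop := (w ^ 4 + w ^ 3 + w ^ 2 + w + 1)%C = 0.

Lemma cyc5_unit (w : C) : cyc5 w -> (w ^ 5)%C = 1.
Proof.
  unfold cyc5. intro h. transitivity ((w - 1) * (w ^ 4 + w ^ 3 + w ^ 2 + w + 1) + 1)%C; [ring|]. rewrite h. ring.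
Qed.

Lemma cyc5_pow (w : C) : cyc5 w -> cyc5 (w ^ 2) /\ cyc5 (w ^ 3) /\ cyc5 (w ^ 4).
Proof.
  intro h. assert (h5 := cyc5_unit w h). unfold cyc5 in *.
  split; [|split].
  - transitivity (w ^ 5 * w ^ 3 + w ^ 5 * w + w ^ 4 + w ^ 2 + 1)%C; [ring|]. rewrite h5, <- h. ring.
  - transitivity (w ^ 5 * w ^ 5 * w ^ 2 + w ^ 5 * w ^ 4 + w ^ 5 * w + w ^ 3 + 1)%C; [ring|]. rewrite h5, <- h. ring.
  - transitivity (w ^ 5 * w ^ 5 * w ^ 5 * w + w ^ 5 * w ^ 5 * w ^ 2 + w ^ 5 * w ^ 3 + w ^ 4 + 1)%C; [ring|]. rewrite h5, <- h. ring.
Qed.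

(** Primitivity is expressed by the cyclotomic equation, so reducing w^4 makes this a ring
    identity. *)
Lemma cyc5_prod (w a y : C) : cyc5 w ->
  ((a - y) * (a - w * y) * (a - w ^ 2 * y) * (a - w ^ 3 * y) * (a - w ^ 4 * y))%C = (a ^ 5 - y ^ 5)%C.
Proof.
  intro h. assert (h4 : (w ^ 4)%C = (- w ^ 3 - w ^ 2 - w - 1)%C).
  { transitivity ((w ^ 4 + w ^ 3 + w ^ 2 + w + 1) - w ^ 3 - w ^ 2 - w - 1)%C; [ring|]. rewrite h. ring. }
  ring [h4].
Qed.

Lemma cyc5_neq (w : C) : cyc5 w -> w <> 0 /\ (1 - / w)%C <> 0.
Proof.
  intro h. assert (h5 := cyc5_unit w h).
  assert (hw : w <> 0). { intro e. rewrite e in h5. apply C1_nz. rewrite <- h5. ring. }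
  split; [exact hw|]. intro e.
  assert (e1 : w = 1). { transitivity (w * (1 - / w) + 1)%C; [field; exact hw|]. rewrite e. ring. }
  unfold cyc5 in h. rewrite e1, !Cpow_1_l in h. apply (f_equal Re) in h. simpl in h. lra.
Qed.

(** The triple product at -z without its first factor 1 - 1/z, so that both factors of a pair carry
    the same power of x. The leftover 1 - x^n/z in [jprod_jprod2] tends to 1. *)
Fixpoint jprod2 (z x : C) (n : nat) : C :=
  match n with
  | O => 1
  | S n' => (jprod2 z x n' * ((1 - z * x ^ S n') * (1 - x ^ S n' / z)))%C
  end.

Lemma jprod_jprod2 (z x : C) (n : nat) : z <> 0 ->
  (jprod (- z) x n * (1 - x ^ n / z))%C = ((1 - / z) * jprod2 z x n)%C.
Proof.
  intro hz. induction n as [|n IH]; cbn [jprod jprod2].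
  - simpl. field. exact hz.
  - transitivity (((1 - / z) * jprod2 z x n) * ((1 - z * x ^ S n) * (1 - x ^ S n / z)))%C; [|ring]. rewrite <- IH.
    transitivity (jprod (- z) x n * ((1 - z * x ^ S n) * (1 - x ^ n / z)) * (1 - x ^ S n / z))%C; [|ring].
    f_equal. f_equal. f_equal; field; exact hz.
Qed.

Lemma Clim_pow0 (x : C) : Cmod x < 1 -> Clim (fun n => x ^ n)%C 0.
Proof.
  intro hx. apply Clim_Cmod0. apply is_lim_seq_ext with (fun n => Cmod x ^ n).
  - intro n. rewrite <- Cmod_pow. f_equal. ring.
  - apply is_lim_seq_geom. rewrite Rabs_pos_eq; [exact hx|apply Cmod_ge_0].
Qed.

Lemma jprod2_lim (z x : C) : cyc5 z -> x <> 0 -> Cmod x < 1 ->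
  Clim (fun n => jprod2 z x n * qinf x)%C (theta expA (-1) (x ^ 5) - (z + 1 + / z) * x * theta expB (-1) (x ^ 5))%C.
Proof.
  intros h hx hx1. destruct (cyc5_neq z h) as [hz hz1].
  assert (hz' : (- z)%C <> 0) by (intro e; apply hz; rewrite <- (Copp_0); rewrite <- e; ring).
  assert (l1 := triple_product (- z) x hz' hx hx1).
  rewrite theta_dissect in l1 by (auto using cyc5_unit).
  set (L := (theta expA (-1) (x ^ 5) - (z + 1 + / z) * x * theta expB (-1) (x ^ 5))%C) in *.
  assert (l2 : Clim (fun n => (1 - x ^ n / z)%C) (1 - 0 * / z)%C).
  { apply Clim_minus; [apply Clim_const|]. apply Clim_mult; [apply Clim_pow0, hx1|apply Clim_const]. }
  assert (l3 := Clim_mult _ _ _ _ (Clim_const (/ (1 - / z))%C) (Clim_mult _ _ _ _ l1 l2)).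
  replace (/ (1 - / z) * ((1 - / z) * L * (1 - 0 * / z)))%C with L in l3.
  2:{ field. split; [exact hz|]. intro e. apply hz1. transitivity ((z - 1) / z)%C; [field; exact hz|]. rewrite e. field. exact hz. }
  eapply Clim_ext; [|exact l3]. intro n. simpl.
  transitivity (/ (1 - / z) * (jprod (- z) x n * (1 - x ^ n / z)) * qinf x)%C; [ring|].
  rewrite jprod_jprod2 by exact hz.
  transitivity ((/ (1 - / z) * (1 - / z)) * jprod2 z x n * qinf x)%C; [ring|].
  rewrite Cinv_l by exact hz1. ring.
Qed.

(** The values z, 1/z, z^2, 1/z^2 are the four primitive roots, and [qpoch x n] supplies the root 1;
    each level is therefore 1 - y^5. *)
Lemma jprod2_cyc (z x : C) (n : nat) : cyc5 z ->
  (jprod2 z x n * jprod2 (z ^ 2) x n * qpoch x n)%C = qpoch (x ^ 5) n.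
Proof.
  intro h. destruct (cyc5_neq z h) as [hz _]. assert (h5 := cyc5_unit z h).
  induction n as [|n IH]; cbn [jprod2 qpoch].
  - ring.
  - rewrite <- IH. set (y := (x ^ S n)%C).
    replace ((x ^ 5) ^ S n)%C with (y ^ 5)%C.
    2:{ unfold y. rewrite <- !Cpow_mult_r. f_equal. lia. }
    assert (e1 : (y / z)%C = (z ^ 4 * y)%C).
    { transitivity (z ^ 5 * (y / z))%C; [rewrite h5; ring|field; exact hz]. }
    assert (e2 : (y / z ^ 2)%C = (z ^ 3 * y)%C).
    { transitivity (z ^ 5 * (y / z ^ 2))%C; [rewrite h5; ring|field; exact hz]. }
    assert (hp := cyc5_prod z 1 y h). rewrite Cpow_1_l in hp.
    rewrite <- hp, e1, e2. ring.
Qed.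

(** The coefficients z + 1 + 1/z and z^2 + 1 + 1/z^2 have sum 1 and product -1, so multiplying the
    two dissections leaves a quadratic form in A and B free of z. *)
Lemma quad_product (z x : C) : cyc5 z -> x <> 0 -> Cmod x < 1 ->
  (theta expA (-1) (x ^ 5) ^ 2 - x * theta expA (-1) (x ^ 5) * theta expB (-1) (x ^ 5) - x ^ 2 * theta expB (-1) (x ^ 5) ^ 2)%C
  = (qinf (x ^ 5) * qinf x)%C.
Proof.
  intros h hx hx1. destruct (cyc5_neq z h) as [hz _]. destruct (cyc5_pow z h) as [h2 _].
  assert (h5 := cyc5_unit z h).
  assert (hy1 : Cmod (x ^ 5) < 1).
  { rewrite Cmod_pow. apply Rle_lt_trans with (Cmod x); [|exact hx1]. apply (Cmod_pow_S_le x 4 hx1). }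
  assert (hq := qinf_neq0 x hx1).
  set (A := theta expA (-1) (x ^ 5)). set (B := theta expB (-1) (x ^ 5)).
  assert (l := Clim_mult _ _ _ _ (jprod2_lim z x h hx hx1) (jprod2_lim (z ^ 2) x h2 hx hx1)). fold A B in l.
  assert (e : ((A - (z + 1 + / z) * x * B) * (A - (z ^ 2 + 1 + / z ^ 2) * x * B))%C = (A ^ 2 - x * A * B - x ^ 2 * B ^ 2)%C).
  { assert (e1 : (/ z)%C = (z ^ 4)%C) by (transitivity (z ^ 5 * / z)%C; [rewrite h5; ring|field; exact hz]).
    assert (e2 : (/ z ^ 2)%C = (z ^ 3)%C) by (transitivity (z ^ 5 * / z ^ 2)%C; [rewrite h5; ring|field; exact hz]).
    rewrite e1, e2. assert (h4 : (z ^ 4)%C = (- z ^ 3 - z ^ 2 - z - 1)%C).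
    { transitivity ((z ^ 4 + z ^ 3 + z ^ 2 + z + 1) - z ^ 3 - z ^ 2 - z - 1)%C; [ring|]. rewrite h. ring. }
    ring [h4]. }
  rewrite e in l. apply (Clim_unique _ _ _ l).
  apply Clim_ext with (fun n => qpoch (x ^ 5) n * (qinf x * qinf x * / qpoch x n))%C.
  - intro n. rewrite <- (jprod2_cyc z) by exact h. field. apply qpoch_neq0, hx1.
  - replace (qinf (x ^ 5) * qinf x)%C with (qinf (x ^ 5) * (qinf x * qinf x * / qinf x))%C by (field; exact hq).
    apply Clim_mult; [apply qinf_lim, hy1|]. apply Clim_mult; [apply Clim_const|].
    apply Clim_inv; [intro; apply qpoch_neq0, hx1|exact hq|apply qinf_lim, hx1].
Qed.

(** The root exp(2 pi i/5) in radicals: (sqrt 5 - 1)/4 is cos(2 pi/5). *)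
Definition zeta5 : C := ((sqrt 5 - 1) / 4, sqrt (1 - ((sqrt 5 - 1) / 4) ^ 2)).

Lemma sqrt5_sq : sqrt 5 * sqrt 5 = 5.
Proof. apply sqrt_sqrt; lra. Qed.

Lemma sqrt5_bounds : 2 < sqrt 5 < 3.
Proof. pose proof sqrt5_sq. pose proof (sqrt_pos 5). split; nra. Qed.

Lemma zeta5_cyc : cyc5 zeta5.
Proof.
  set (c := (sqrt 5 - 1) / 4).
  assert (hc : 4 * c ^ 2 + 2 * c - 1 = 0) by (unfold c; pose proof sqrt5_sq; nra).
  assert (hb := sqrt5_bounds).
  assert (hs : sqrt (1 - c ^ 2) * sqrt (1 - c ^ 2) = 1 - c ^ 2).
  { apply sqrt_sqrt. unfold c. nra. }
  assert (e : (zeta5 ^ 2)%C = (2 * c * zeta5 - 1)%C).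
  { unfold zeta5. fold c. apply Ceq_parts; simpl; unfold Re, Im; simpl; simpl in hs; nra. }
  unfold cyc5.
  (* The cyclotomic polynomial factors as (X^2 - 2cX + 1)(X^2 + (2c+1)X + 1) up to a multiple of
     4c^2 + 2c - 1, which vanishes for this c. *)
  transitivity ((zeta5 ^ 2 - 2 * c * zeta5 + 1) * (zeta5 ^ 2 + (2 * c + 1) * zeta5 + 1) + (4 * c ^ 2 + 2 * c - 1) * zeta5 ^ 2)%C; [ring|].
  rewrite e. replace (4 * c ^ 2 + 2 * c - 1)%C with (RtoC (4 * c ^ 2 + 2 * c - 1)%R).
  - rewrite hc. ring.
  - rewrite RtoC_minus, RtoC_plus, !RtoC_mult, RtoC_pow. reflexivity.
Qed.

Lemma Cmod_unit5 (w : C) : (w ^ 5)%C = 1 -> Cmod w = 1.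
Proof.
  intro h. apply (f_equal Cmod) in h. rewrite Cmod_pow, Cmod_1 in h. assert (h0 := Cmod_ge_0 w).
  destruct (Rtotal_order (Cmod w) 1) as [h1|[h1|h1]]; [|exact h1|].
  - assert (Cmod w ^ 5 <= Cmod w * 1) by (simpl; apply Rmult_le_compat_l; [lra|]; assert (0 <= Cmod w * Cmod w <= 1) by nra; nra). lra.
  - assert (1 < Cmod w ^ 5) by (apply Rlt_pow_R1; [lra|lia]). lra.
Qed.

(** For m prime to 5 the roots w^m run over all fifth roots and the five factors give 1 - x^(5m);
    for m divisible by 5 they all equal 1 - x^m. The truncation at 5n and the factor in x^25 on the
    left make the two sides match exactly. *)
Lemma qpoch_cyc5 (w x : C) (n : nat) : cyc5 w ->
  (qpoch x (5 * n) * qpoch (w * x) (5 * n) * qpoch (w ^ 2 * x) (5 * n) * qpoch (w ^ 3 * x) (5 * n) *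
   qpoch (w ^ 4 * x) (5 * n) * qpoch ((x ^ 5) ^ 5) n)%C = (qpoch (x ^ 5) (5 * n) * qpoch (x ^ 5) n ^ 5)%C.
Proof.
  intro h. assert (h5 := cyc5_unit w h). destruct (cyc5_pow w h) as [h2 [h3 h4]].
  assert (hw : forall r n, (w ^ (5 * n + r))%C = (w ^ r)%C).
  { intros r k. rewrite Cpow_add_r, Cpow_mult_r, h5, Cpow_1_l. ring. }
  induction n as [|n IH]; [cbn; ring|].
  replace (5 * S n)%nat with (S (S (S (S (S (5 * n)))))) by lia. cbn [qpoch].
  assert (step : forall r, cyc5 (w ^ r) -> ((1 - x ^ (5 * n + r)) * (1 - (w * x) ^ (5 * n + r)) * (1 - (w ^ 2 * x) ^ (5 * n + r)) *
     (1 - (w ^ 3 * x) ^ (5 * n + r)) * (1 - (w ^ 4 * x) ^ (5 * n + r)))%C = (1 - (x ^ 5) ^ (5 * n + r))%C).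
  { intros r hr. rewrite !(Cpow_mult_l _ x). rewrite <- !(Cpow_mult_r w).
    rewrite hw.
    assert (ek : forall k, (w ^ (k * (5 * n + r)))%C = ((w ^ r) ^ k)%C).
    { intro k. replace (k * (5 * n + r))%nat with (5 * (k * n) + r * k)%nat by lia. rewrite hw. apply Cpow_mult_r. }
    rewrite !ek. assert (hp := cyc5_prod (w ^ r) 1 (x ^ (5 * n + r)) hr). rewrite Cpow_1_l in hp.
    rewrite hp. f_equal. rewrite <- !Cpow_mult_r. f_equal. lia. }
  assert (s1 := step 1%nat ltac:(rewrite Cpow_1_r; exact h)). assert (s2 := step 2%nat h2).
  assert (s3 := step 3%nat h3). assert (s4 := step 4%nat h4).
  assert (last : forall v, (v ^ 5)%C = 1 -> ((v * x) ^ (5 * n + 5))%C = ((x ^ 5) ^ S n)%C).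
  { intros v hv. replace (5 * n + 5)%nat with (5 * S n)%nat by lia.
    rewrite Cpow_mult_l, !Cpow_mult_r, hv, Cpow_1_l. ring. }
  assert (l0 := last 1%C (Cpow_1_l 5)). rewrite Cmult_1_l in l0.
  assert (l1 := last w h5). assert (l2 := last (w ^ 2)%C (cyc5_unit _ h2)).
  assert (l3 := last (w ^ 3)%C (cyc5_unit _ h3)). assert (l4 := last (w ^ 4)%C (cyc5_unit _ h4)).
  replace (S (S (S (S (S (5 * n))))))%nat with (5 * n + 5)%nat by lia.
  replace (S (S (S (S (5 * n)))))%nat with (5 * n + 4)%nat by lia.
  replace (S (S (S (5 * n))))%nat with (5 * n + 3)%nat by lia.
  replace (S (S (5 * n)))%nat with (5 * n + 2)%nat by lia.
  replace (S (5 * n))%nat with (5 * n + 1)%nat by lia.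
  rewrite l0, l1, l2, l3, l4.
  replace ((x ^ 5) ^ (5 * n + 5))%C with (((x ^ 5) ^ 5) ^ S n)%C by (rewrite <- !Cpow_mult_r; f_equal; lia).
  rewrite <- s1, <- s2, <- s3, <- s4.
  match goal with |- ?lhs = _ => match type of IH with ?a = _ =>
    set (IA := a) in IH end end.
  generalize dependent (x ^ (5 * n + 1))%C. intros.
  set (t := (1 - (x ^ 5) ^ S n)%C).
  transitivity (IA * ((1 - c) * (1 - (w * x) ^ (5 * n + 1)) * (1 - (w ^ 2 * x) ^ (5 * n + 1)) *
     (1 - (w ^ 3 * x) ^ (5 * n + 1)) * (1 - (w ^ 4 * x) ^ (5 * n + 1))) *
     ((1 - x ^ (5 * n + 2)) * (1 - (w * x) ^ (5 * n + 2)) * (1 - (w ^ 2 * x) ^ (5 * n + 2)) *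
     (1 - (w ^ 3 * x) ^ (5 * n + 2)) * (1 - (w ^ 4 * x) ^ (5 * n + 2))) *
     ((1 - x ^ (5 * n + 3)) * (1 - (w * x) ^ (5 * n + 3)) * (1 - (w ^ 2 * x) ^ (5 * n + 3)) *
     (1 - (w ^ 3 * x) ^ (5 * n + 3)) * (1 - (w ^ 4 * x) ^ (5 * n + 3))) *
     ((1 - x ^ (5 * n + 4)) * (1 - (w * x) ^ (5 * n + 4)) * (1 - (w ^ 2 * x) ^ (5 * n + 4)) *
     (1 - (w ^ 3 * x) ^ (5 * n + 4)) * (1 - (w ^ 4 * x) ^ (5 * n + 4))) * t ^ 5 * (1 - ((x ^ 5) ^ 5) ^ S n))%C.
  - unfold IA. ring.
  - rewrite IH. ring.
Qed.

(** The quadratic form splits as (a - l y b)(a - m y b) with l the golden ratio and m = 1 - l. The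
    product over the roots raises l, m and x to the fifth power, and l^5 + m^5 = 11, l^5 m^5 =
    -1. *)
Lemma quad_cyc5 (w x a b : C) : cyc5 w ->
  ((a ^ 2 - x * a * b - x ^ 2 * b ^ 2) * (a ^ 2 - (w * x) * a * b - (w * x) ^ 2 * b ^ 2) *
   (a ^ 2 - (w ^ 2 * x) * a * b - (w ^ 2 * x) ^ 2 * b ^ 2) * (a ^ 2 - (w ^ 3 * x) * a * b - (w ^ 3 * x) ^ 2 * b ^ 2) *
   (a ^ 2 - (w ^ 4 * x) * a * b - (w ^ 4 * x) ^ 2 * b ^ 2))%C
  = (a ^ 10 - 11 * x ^ 5 * a ^ 5 * b ^ 5 - (x ^ 5) ^ 2 * b ^ 10)%C.
Proof.
  intro h. set (l := RtoC ((1 + sqrt 5) / 2)). set (m := (1 - l)%C).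
  assert (hl : (l ^ 2)%C = (l + 1)%C).
  { unfold l. rewrite <- RtoC_pow. replace (RtoC ((1 + sqrt 5) / 2) + 1)%C with (RtoC ((1 + sqrt 5) / 2 + 1)) by apply RtoC_plus.
    f_equal. pose proof sqrt5_sq. nra. }
  assert (e : forall y, (a ^ 2 - y * a * b - y ^ 2 * b ^ 2)%C = ((a - l * (y * b)) * (a - m * (y * b)))%C).
  { intro y. unfold m. ring [hl]. }
  rewrite !e.
  assert (h1 := cyc5_prod w a (l * (x * b)) h). assert (h2 := cyc5_prod w a (m * (x * b)) h).
  transitivity ((a ^ 5 - (l * (x * b)) ^ 5) * (a ^ 5 - (m * (x * b)) ^ 5))%C.
  - rewrite <- h1, <- h2. ring.
  - assert (e5 : (l ^ 5)%C = (5 * l + 3)%C) by ring [hl].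
    assert (em : (m ^ 5)%C = (8 - 5 * l)%C) by (unfold m; ring [hl]).
    rewrite !Cpow_mult_l, e5, em. ring [hl].
Qed.

Definition q5 (q : R) : R := Rpower q (1 / 5).

Lemma q5_bounds (q : R) : 0 < q < 1 -> 0 < q5 q < 1.
Proof.
  intro hq. unfold q5. split; [apply exp_pos|].
  assert (hl : ln q < 0) by (rewrite <- ln_1; apply ln_increasing; lra).
  assert (he := exp_increasing (1 / 5 * ln q) 0 ltac:(lra)). rewrite exp_0 in he. exact he.
Qed.

Lemma q5_pow5 (q : R) : 0 < q -> q5 q ^ 5 = q.
Proof.
  intro hq. unfold q5. rewrite <- Rpower_pow by apply exp_pos. rewrite Rpower_mult.
  replace (1 / 5 * INR 5) with 1 by (simpl; field). apply Rpower_1, hq.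
Qed.

Lemma RtoC_quintic (a b q t : R) :
  RtoC ((a ^ 10 - 11 * q * a ^ 5 * b ^ 5 - q ^ 2 * b ^ 10) * t) =
  ((RtoC a ^ 10 - 11 * RtoC q * RtoC a ^ 5 * RtoC b ^ 5 - RtoC q ^ 2 * RtoC b ^ 10) * RtoC t)%C.
Proof. rewrite <- !RtoC_pow, <- !RtoC_mult, <- !RtoC_minus, <- RtoC_mult. reflexivity. Qed.

(** A and B are the same for all five fifth roots y of q, so [quad_product] can be multiplied over
    them. The factors T(y^5) give T(q)^5, and the factors (y; y)_oo give T(q)^6/T(q^5). *)
Lemma thAB_quintic (q : R) : 0 < q < 1 ->
  (thA q ^ 10 - 11 * q * thA q ^ 5 * thB q ^ 5 - q ^ 2 * thB q ^ 10) * eulerT (q ^ 5) = eulerT q ^ 11.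
Proof.
  intro hq. set (w := zeta5). assert (h : cyc5 w) by apply zeta5_cyc.
  assert (h5 := cyc5_unit w h). destruct (cyc5_pow w h) as [h2 [h3 h4]].
  assert (hx' := q5_bounds q hq). set (x := RtoC (q5 q)).
  assert (hx : x <> 0) by (apply RtoC_neq0; lra).
  assert (hx1 : Cmod x < 1) by (apply Cmod_RtoC_lt1, hx').
  assert (ex5 : (x ^ 5)%C = RtoC q) by (unfold x; rewrite <- RtoC_pow, q5_pow5 by lra; reflexivity).
  assert (hv : forall v, (v ^ 5)%C = 1 -> (v * x)%C <> 0 /\ Cmod (v * x) < 1 /\ ((v * x) ^ 5)%C = RtoC q).
  { intros v e. split; [|split].
    - apply Cmult_neq_0; [|exact hx]. intro e0. rewrite e0 in e. apply C1_nz. rewrite <- e. ring.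
    - rewrite Cmod_mult, (Cmod_unit5 v e). lra.
    - rewrite Cpow_mult_l, e, ex5. ring. }
  set (A := theta expA (-1) q). set (B := theta expB (-1) q).
  assert (hquad : forall y : C, y <> 0 -> Cmod y < 1 -> (y ^ 5)%C = RtoC q ->
     (A ^ 2 - y * A * B - y ^ 2 * B ^ 2)%C = (qinf q * qinf y)%C).
  { intros y a b e. assert (k := quad_product w y h a b). rewrite e in k. exact k. }
  destruct (hv w h5) as [a1 [b1 c1]]. destruct (hv (w ^ 2)%C (cyc5_unit _ h2)) as [a2 [b2 c2]].
  destruct (hv (w ^ 3)%C (cyc5_unit _ h3)) as [a3 [b3 c3]]. destruct (hv (w ^ 4)%C (cyc5_unit _ h4)) as [a4 [b4 c4]].
  assert (key := quad_cyc5 w x A B h).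
  rewrite (hquad x hx hx1 ex5), (hquad _ a1 b1 c1), (hquad _ a2 b2 c2), (hquad _ a3 b3 c3), (hquad _ a4 b4 c4), ex5 in key.
  assert (hq1 := Cmod_RtoC_lt1 q hq). assert (hq51 := Cmod_RtoC_lt1 _ (pow5_bounds q hq)).
  assert (S5 : forall y : C, Cmod y < 1 -> Clim (fun n => qpoch y (5 * n)) (qinf y)).
  { intros y hy. exact (Clim_subseq _ _ _ (filterlim_mul_nat 5 ltac:(lia)) (qinf_lim y hy)). }
  assert (prod : (qinf x * qinf (w * x) * qinf (w ^ 2 * x) * qinf (w ^ 3 * x) * qinf (w ^ 4 * x) * qinf (RtoC (q ^ 5)))%C
     = (qinf q * (qinf q * (qinf q * (qinf q * (qinf q * qinf q)))))%C).
  { apply (Clim_unique (fun n => qpoch x (5 * n) * qpoch (w * x) (5 * n) * qpoch (w ^ 2 * x) (5 * n) * qpoch (w ^ 3 * x) (5 * n) *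
      qpoch (w ^ 4 * x) (5 * n) * qpoch (RtoC (q ^ 5)) n)%C).
    - exact (Clim_mult _ _ _ _ (Clim_mult _ _ _ _ (Clim_mult _ _ _ _ (Clim_mult _ _ _ _ (Clim_mult _ _ _ _
        (S5 _ hx1) (S5 _ b1)) (S5 _ b2)) (S5 _ b3)) (S5 _ b4)) (qinf_lim _ hq51)).
    - apply Clim_ext with (fun n => qpoch q (5 * n) * (qpoch q n * (qpoch q n * (qpoch q n * (qpoch q n * qpoch q n)))))%C.
      + intro n. assert (k := qpoch_cyc5 w x n h). rewrite ex5 in k. rewrite RtoC_pow, k. ring.
      + assert (l := qinf_lim _ hq1).
        exact (Clim_mult _ _ _ _ (S5 _ hq1) (Clim_mult _ _ _ _ l (Clim_mult _ _ _ _ l (Clim_mult _ _ _ _ l (Clim_mult _ _ _ _ l l))))). }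
  destruct (thA_lim q hq) as [eA _]. destruct (thB_lim q hq) as [eB _].
  destruct (eulerT_lim q hq) as [eT _]. destruct (eulerT_lim _ (pow5_bounds q hq)) as [eT5 _].
  apply RtoC_inj.
  rewrite RtoC_quintic, eT5, <- eA, <- eB, (RtoC_pow (eulerT q)), eT. fold A B. rewrite <- key.
  transitivity (qinf q ^ 5 * (qinf x * qinf (w * x) * qinf (w ^ 2 * x) * qinf (w ^ 3 * x) * qinf (w ^ 4 * x) * qinf (RtoC (q ^ 5))))%C; [ring|].
  rewrite prod. ring.
Qed.

Lemma RR_pos (q : R) : 0 < q < 1 -> 0 < RR q.
Proof.
  intro hq. rewrite RR_theta by exact hq. apply Rmult_lt_0_compat; [apply exp_pos|].
  apply Rdiv_lt_0_compat; [apply thB_pos, hq|apply thA_pos, hq].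
Qed.

Lemma RR_pow5 (q : R) : 0 < q < 1 -> RR q ^ 5 = q * (thB q / thA q) ^ 5.
Proof.
  intro hq. rewrite RR_theta by exact hq. fold (q5 q). rewrite Rpow_mult_distr, q5_pow5 by lra. reflexivity.
Qed.

Lemma RR_quintic (q : R) : 0 < q < 1 ->
  / RR q ^ 5 - 11 - RR q ^ 5 = eulerT q ^ 6 / (q * eulerT (q ^ 5) ^ 6).
Proof.
  intro hq. rewrite RR_pow5 by exact hq.
  assert (h := thAB_quintic q hq). assert (h2 := thA_thB q hq).
  assert (hA := thA_pos q hq). assert (hB := thB_pos q hq).
  assert (hT := eulerT_pos q hq). assert (hT5 := eulerT_pos _ (pow5_bounds q hq)).
  set (A := thA q) in *. set (B := thB q) in *. set (T := eulerT q) in *. set (T5 := eulerT (q ^ 5)) in *.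
  assert (h3 : A ^ 5 * B ^ 5 = T ^ 5 * T5 ^ 5) by (rewrite <- !Rpow_mult_distr, h2; reflexivity).
  transitivity ((A ^ 10 - 11 * q * A ^ 5 * B ^ 5 - q ^ 2 * B ^ 10) * T5 / (q * (A ^ 5 * B ^ 5) * T5)).
  - field. lra.
  - rewrite h, h3. field. lra.
Qed.

(** * The Weierstrass three-term relation *)

Lemma ln_1p_bound (t : R) : Rabs t <= 1 / 2 -> Rabs (ln (1 + t)) <= 2 * Rabs t.
Proof.
  intro h. apply Rabs_le_between in h.
  assert (h1 : ln (1 + t) <= t).
  { rewrite <- (ln_exp t) at 2. destruct (exp_ge_1p t) as [k|k]; [left; apply ln_increasing; lra|rewrite k; lra]. }
  assert (h2 : - t / (1 + t) >= - ln (1 + t)).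
  { rewrite <- ln_Rinv by lra. rewrite <- (ln_exp (- t / (1 + t))). apply Rle_ge.
    assert (e : / (1 + t) = 1 + - t / (1 + t)) by (field; lra). rewrite e.
    destruct (exp_ge_1p (- t / (1 + t))) as [k|k]; [left; apply ln_increasing; [|exact k]|rewrite k; lra].
    rewrite <- e. apply Rinv_0_lt_compat; lra. }
  assert (h3 : Rabs (- t / (1 + t)) <= 2 * Rabs t).
  { unfold Rdiv. rewrite Rabs_mult, Rabs_Ropp, Rmult_comm. apply Rmult_le_compat_r; [apply Rabs_pos|].
    rewrite Rabs_pos_eq by (left; apply Rinv_0_lt_compat; lra). replace 2 with (/ (1 / 2)) by field.
    apply Rinv_le_contravar; lra. }
  assert (h4 := Rle_abs t). assert (h5 := Rle_abs (- t / (1 + t))). pose proof (Rabs_pos t).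
  apply Rabs_le; lra.
Qed.

Lemma rprod_exp_ln (f : nat -> R) (n : nat) : (forall i, 0 < f i) -> rprod f (S n) = exp (sum_n (fun i => ln (f i)) n).
Proof.
  intro hf. induction n as [|n IH].
  - rewrite sum_O. cbn. rewrite exp_ln by apply hf. ring.
  - rewrite sum_Sn. unfold plus; simpl. rewrite exp_plus, <- IH, exp_ln by apply hf. reflexivity.
Qed.

Lemma rprod_lim (f : nat -> R) : (forall i, 0 < f i) -> summable (fun i => ln (f i)) ->
  is_lim_seq (rprod f) (exp (Sum (fun i => ln (f i)))).
Proof.
  intros hf hs. apply is_lim_seq_incr_1.
  apply is_lim_seq_ext with (fun n => exp (sum_n (fun i => ln (f i)) n)).
  - intro n. symmetry; apply rprod_exp_ln, hf.
  - apply (is_lim_seq_continuous exp); [apply derivable_continuous_pt, derivable_pt_exp|].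
    apply is_lim_seq_Sum, hs.
Qed.

Lemma pow_S_bounds (q : R) (n : nat) : 0 < q < 1 -> 0 < q ^ S n <= q.
Proof.
  intro h. split; [apply pow_lt; lra|]. assert (k := pow_le_pow q 1 (S n) h ltac:(lia)). rewrite pow_1 in k. exact k.
Qed.

(** The squared modulus of 1 - c exp(2it). *)
Definition sfac (c t : R) : R := 1 - 2 * c * cos (2 * t) + c ^ 2.

Lemma sfac_ge (c t : R) : 0 <= c -> (1 - c) ^ 2 <= sfac c t.
Proof. intro h. unfold sfac. pose proof (COS_bound (2 * t)). nra. Qed.

Lemma sfac_le (c t : R) : 0 <= c -> sfac c t <= (1 + c) ^ 2.
Proof. intro h. unfold sfac. pose proof (COS_bound (2 * t)). nra. Qed.

Lemma ln_1m_ge (c r : R) : 0 <= c <= r -> r < 1 -> - (c / (1 - r)) <= ln (1 - c).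
Proof.
  intros hc hr. rewrite <- (ln_exp (- (c / (1 - r)))).
  assert (h : exp (- (c / (1 - r))) <= 1 - c).
  { rewrite exp_Ropp. rewrite <- (Rinv_inv (1 - c)). apply Rinv_le_contravar; [apply Rinv_0_lt_compat; lra|].
    eapply Rle_trans; [|apply exp_ge_1p]. apply Rle_trans with (1 + c / (1 - c)); [apply Req_le; field; lra|].
    apply Rplus_le_compat_l, Rmult_le_compat_l; [lra|]. apply Rinv_le_contravar; lra. }
  destruct h as [h|h]; [left; apply ln_increasing; [apply exp_pos|exact h]|rewrite h; lra].
Qed.

Lemma ln_1p_le (c : R) : 0 <= c -> ln (1 + c) <= c.
Proof.
  intro h. rewrite <- (ln_exp c) at 2.
  destruct (exp_ge_1p c) as [k|k]; [left; apply ln_increasing; lra|rewrite k; lra].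
Qed.

Lemma ln_le_mono (a b : R) : 0 < a -> a <= b -> ln a <= ln b.
Proof. intros ha [h| ->]; [left; apply ln_increasing; assumption|lra]. Qed.

Lemma ln_sfac_bound (c r t : R) : 0 <= c <= r -> r < 1 -> Rabs (ln (sfac c t)) <= 2 / (1 - r) * c.
Proof.
  intros hc hr. assert (h1 := sfac_ge c t ltac:(lra)). assert (h2 := sfac_le c t ltac:(lra)).
  assert (h0 : 0 < (1 - c) ^ 2) by (apply pow_lt; lra).
  assert (k1 := ln_le_mono _ _ h0 h1). assert (k2 := ln_le_mono (sfac c t) _ ltac:(lra) h2).
  rewrite ln_pow in k1, k2 by lra. simpl in k1, k2.
  assert (k3 := ln_1m_ge c r hc hr). assert (k4 := ln_1p_le c ltac:(lra)).
  assert (k5 : c <= c / (1 - r)).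
  { unfold Rdiv. rewrite <- (Rmult_1_r c) at 1. apply Rmult_le_compat_l; [lra|]. rewrite <- Rinv_1 at 1. apply Rinv_le_contravar; lra. }
  replace (2 / (1 - r) * c) with (2 * (c / (1 - r))) by (field; lra). apply Rabs_le; lra.
Qed.

Lemma summable_pow_S (q : R) : 0 < q < 1 -> summable (fun i => q ^ S i).
Proof. intro hq. apply (summable_scal q (fun i => q ^ i)), summable_geom; lra. Qed.

Lemma summable_ln_sfac (q t : R) : 0 < q < 1 -> summable (fun i => ln (sfac (q ^ S i) t)).
Proof.
  intro hq. apply summable_dom with (fun i => 2 / (1 - q) * q ^ S i).
  - intro i. apply ln_sfac_bound; [|lra]. assert (h := pow_S_bounds q i hq). lra.
  - apply summable_scal, summable_pow_S, hq.
Qed.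

(** Defined through the sum of logarithms, so that dependence on t can be studied by dominated
    convergence; [sprod_lim] identifies it with the infinite product. *)
Definition sprod (q t : R) : R := exp (Sum (fun i => ln (sfac (q ^ S i) t))).

Lemma sfac_pos (q t : R) (i : nat) : 0 < q < 1 -> 0 < sfac (q ^ S i) t.
Proof.
  intro hq. assert (h := pow_S_bounds q i hq). eapply Rlt_le_trans; [|apply sfac_ge; lra]. apply pow_lt. lra.
Qed.

Lemma sprod_lim (q t : R) : 0 < q < 1 -> is_lim_seq (rprod (fun i => sfac (q ^ S i) t)) (sprod q t).
Proof. intro hq. apply rprod_lim; [intro; apply sfac_pos, hq|apply summable_ln_sfac, hq]. Qed.

Definition cis (t : R) : C := (cos t, sin t).

Lemma cis_add (a b : R) : cis (a + b) = (cis a * cis b)%C.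
Proof. unfold cis, Cmult. simpl. rewrite cos_plus, sin_plus. f_equal; ring. Qed.

Lemma cis_0 : cis 0 = 1.
Proof. unfold cis. rewrite cos_0, sin_0. reflexivity. Qed.

Lemma cis_opp (a : R) : (cis a * cis (- a))%C = 1.
Proof. rewrite <- cis_add, Rplus_opp_r. apply cis_0. Qed.

Lemma cis_neq0 (a : R) : cis a <> 0.
Proof. intro e. assert (h := cis_opp a). rewrite e, Cmult_0_l in h. apply C1_nz; symmetry; exact h. Qed.

Lemma cis_inv (a : R) : (/ cis a)%C = cis (- a).
Proof. rewrite <- (Cmult_1_l (/ cis a)%C), <- (cis_opp a). field. apply cis_neq0. Qed.

Lemma jprod2_cis (q t : R) (n : nat) : jprod2 (cis (2 * t)) q n = RtoC (rprod (fun i => sfac (q ^ S i) t) n).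
Proof.
  induction n as [|n IH]; [reflexivity|]. cbn [jprod2 rprod]. rewrite IH, RtoC_mult. f_equal.
  rewrite <- RtoC_pow. unfold Cdiv. rewrite cis_inv. unfold cis, sfac. rewrite cos_neg, sin_neg.
  assert (h := sin2_cos2 (2 * t)). unfold Rsqr in h.
  apply Ceq_parts; simpl; unfold Re, Im; simpl; nra.
Qed.

(** On the unit circle the paired factors of the triple product are squared moduli, hence real; only
    the factor 1 - 1/z stays complex. *)
Lemma theta_cis (q t : R) : 0 < q < 1 ->
  theta tri (- cis (2 * t)) q = ((1 - / cis (2 * t)) * RtoC (sprod q t * eulerT q))%C.
Proof.
  intro hq. set (z := cis (2 * t)). assert (hz : z <> 0) by apply cis_neq0.
  assert (hz' : (- z)%C <> 0) by (intro e; apply hz; rewrite <- (Copp_0); rewrite <- e; ring).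
  assert (hx1 := Cmod_RtoC_lt1 q hq). destruct (eulerT_lim q hq) as [eT _].
  assert (l1 := triple_product (- z) q hz' (RtoC_neq0 q ltac:(lra)) hx1).
  assert (l2 : Clim (fun n => (1 - RtoC q ^ n / z)%C) (1 - 0 * / z)%C).
  { apply Clim_minus; [apply Clim_const|]. apply Clim_mult; [apply Clim_pow0, hx1|apply Clim_const]. }
  assert (l3 := Clim_mult _ _ _ _ l1 l2).
  replace (theta tri (- z) q * (1 - 0 * / z))%C with (theta tri (- z) q) in l3 by ring.
  apply (Clim_unique _ _ _ l3).
  apply Clim_ext with (fun n => (1 - / z) * (RtoC (rprod (fun i => sfac (q ^ S i) t) n) * qinf q))%C.
  - intro n. rewrite <- jprod2_cis. fold z.
    transitivity ((jprod (- z) q n * (1 - RtoC q ^ n / z)) * qinf q)%C; [|ring].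
    rewrite jprod_jprod2 by exact hz. ring.
  - apply Clim_mult; [apply Clim_const|]. rewrite RtoC_mult, eT. apply Clim_mult; [|apply Clim_const].
    apply Clim_RtoC, sprod_lim, hq.
Qed.

(** Jacobi's theta_1 in t for the nome sqrt q, up to a factor independent of t; it plays the part of
    the Weierstrass sigma function. *)
Definition sig (q t : R) : R := sin t * sprod q t.

(* The skew form [u theta(-uv) theta(-u/v)] has rank two, and is a product of two real factors on the unit circle. *)
Lemma sig_rank2 (q : R) : 0 < q < 1 -> exists f g : R -> C, forall a b,
  (f a * g b - g a * f b)%C = RtoC (-4 * eulerT q ^ 2 * (sig q (a + b) * sig q (a - b))).
Proof.
  intro hq. assert (hx : RtoC q <> 0) by (apply RtoC_neq0; lra). assert (hx1 := Cmod_RtoC_lt1 q hq).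
  (* With u = cis(2a), v = cis(2b), [theta_tri_mult] is applied at -uv and -u/v: their product u^2
     and quotient v^2 separate the variables, and the prefactor u makes the form skew. *)
  exists (fun a => cis (2 * a) * theta (fun j => j * j + j)%Z (cis (2 * a) * cis (2 * a)) q)%C,
    (fun a => theta (fun j => j * j)%Z (cis (2 * a) * cis (2 * a)) q).
  intros a b. set (u := cis (2 * a)). set (v := cis (2 * b)).
  assert (hu : u <> 0) by apply cis_neq0. assert (hv : v <> 0) by apply cis_neq0.
  assert (h1 : (- (u * v))%C <> 0).
  { intro e. apply (Cmult_neq_0 u v hu hv). rewrite <- Copp_0, <- e. ring. }
  assert (h2 : (- (u / v))%C <> 0).
  { intro e. apply (Cmult_neq_0 u _ hu (Cinv_neq0 v hv)). rewrite <- Copp_0, <- e. unfold Cdiv. ring. }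
  assert (h := theta_tri_mult _ _ q h1 h2 hx hx1).
  replace (- (u * v) * - (u / v))%C with (u * u)%C in h by (field; exact hv).
  replace (- (u * v) / - (u / v))%C with (v * v)%C in h by (field; split; assumption).
  transitivity (u * (theta tri (- (u * v)) q * theta tri (- (u / v)) q))%C.
  - rewrite h. field. split; assumption.
  - assert (e1 : (u * v)%C = cis (2 * (a + b))) by (unfold u, v; rewrite <- cis_add; f_equal; ring).
    assert (e2 : (u / v)%C = cis (2 * (a - b))) by (unfold u, v, Cdiv; rewrite cis_inv, <- cis_add; f_equal; ring).
    rewrite e1, e2, !theta_cis by exact hq. unfold sig.
    assert (e3 : forall t, (1 - / cis (2 * t))%C = (2 * Ci * RtoC (sin t) * cis (- t))%C).
    { intro t. rewrite cis_inv. unfold cis. rewrite !cos_neg, !sin_neg, cos_2a_sin, sin_2a.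
      apply Ceq_parts; simpl; unfold Re, Im; simpl; ring. }
    rewrite !e3.
    transitivity (2 * Ci * (2 * Ci) * (u * (cis (- (a + b)) * cis (- (a - b)))) * RtoC (sin (a + b)) * RtoC (sin (a - b)) *
      RtoC (sprod q (a + b) * eulerT q) * RtoC (sprod q (a - b) * eulerT q))%C; [ring|].
    rewrite <- cis_add. replace (- (a + b) + - (a - b)) with (- (2 * a)) by ring. unfold u. rewrite cis_opp.
    replace (2 * Ci * (2 * Ci) * 1)%C with (RtoC (-4)) by (apply Ceq_parts; simpl; unfold Re, Im; simpl; ring).
    rewrite <- !RtoC_mult. f_equal. ring.
Qed.

(** The Plucker relation of the skew form at the four points x, h, y, 0. *)
Lemma sig_three_term (q x y h : R) : 0 < q < 1 ->
  sig q (x + h) * sig q (x - h) * sig q y ^ 2 - sig q (y + h) * sig q (y - h) * sig q x ^ 2 =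
  sig q (x + y) * sig q (x - y) * sig q h ^ 2.
Proof.
  intro hq. destruct (sig_rank2 q hq) as [f [g k]]. assert (hT := eulerT_pos q hq).
  set (w := fun a b => sig q (a + b) * sig q (a - b)). set (c := -4 * eulerT q ^ 2) in *.
  assert (hc : c <> 0) by (unfold c; assert (0 < eulerT q ^ 2) by (apply pow_lt; lra); lra).
  assert (key : w x h * w y 0 - w x y * w h 0 + w x 0 * w h y = 0).
  { apply (Rmult_eq_reg_l (c * c)); [|apply Rmult_integral_contrapositive; split; exact hc].
    apply RtoC_inj. rewrite Rmult_0_r.
    transitivity (RtoC (c * w x h) * RtoC (c * w y 0) - RtoC (c * w x y) * RtoC (c * w h 0) + RtoC (c * w x 0) * RtoC (c * w h y))%C.
    - rewrite <- !RtoC_mult, <- RtoC_minus, <- RtoC_plus. f_equal. ring.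
    - unfold w. rewrite <- !k. ring. }
  unfold w in key. rewrite !Rplus_0_r, !Rminus_0_r in key.
  assert (e : sig q (h - y) = - sig q (y - h)).
  { unfold sig. replace (h - y) with (- (y - h)) by ring. rewrite sin_neg.
    assert (es : sprod q (- (y - h)) = sprod q (y - h)).
    { unfold sprod. f_equal. apply Sum_ext. intro i. unfold sfac. rewrite <- (cos_neg (2 * - (y - h))).
      do 5 f_equal. ring. }
    rewrite es. ring. }
  rewrite e in key. rewrite (Rplus_comm h y) in key. lra.
Qed.

(** A chain rule along sequences in which the argument is a product s L and only the limit of L is
    known. The difference quotient of [f], extended by [d], is continuous at 0. *)
Lemma difference_quotient_seq (f : R -> R) (d : R) (s L : nat -> R) (l : R) :
  is_derive f 0 d -> (forall k, s k <> 0) -> is_lim_seq s 0 -> is_lim_seq L l ->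
  is_lim_seq (fun k => (f (s k * L k) - f 0) / s k) (d * l).
Proof.
  intros hf hs0 hs hL.
  set (g := fun y => if Req_EM_T y 0 then d else (f y - f 0) / y).
  assert (hg : continuous g 0).
  { apply continuity_pt_filterlim. apply is_derive_Reals in hf.
    intros eps he. destruct (hf eps he) as [[del hd] hdel]. exists del. split; [exact hd|].
    intros y [[_ hy] hy2]. simpl in *. unfold R_dist in *. unfold g.
    destruct (Req_EM_T 0 0) as [_|]; [|congruence]. destruct (Req_EM_T y 0) as [e|e]; [congruence|].
    rewrite Rminus_0_r in hy2. specialize (hdel y e hy2). rewrite Rplus_0_l in hdel. exact hdel. }
  assert (hg0 : g 0 = d) by (unfold g; destruct (Req_EM_T 0 0); congruence).
  assert (e : forall y, f y - f 0 = y * g y).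
  { intro y. unfold g. destruct (Req_EM_T y 0) as [->|h]; [ring|field; exact h]. }
  apply is_lim_seq_ext with (fun k => g (s k * L k) * L k).
  - intro k. rewrite e. field. apply hs0.
  - rewrite <- hg0. apply is_lim_seq_mult'; [|exact hL].
    apply (is_lim_seq_continuous g (fun k => s k * L k) 0).
    + apply continuity_pt_filterlim. exact hg.
    + replace (Finite 0) with (Finite (0 * l)) by (f_equal; ring). apply is_lim_seq_mult'; assumption.
Qed.

(** [sal c t] is the second derivative in t of ln([sfac c t]), so its sum over c = q^n, less 1/sin^2
    t, is (ln [sig])''. Together with [sbe] it gives the exact expansion in sin^2 h of [sfac_shift],
    which makes finite differences exact and spares differentiating the series twice. *)
Definition sal (c t : R) : R := 8 * c * ((1 + c ^ 2) * cos (2 * t) - 2 * c) / sfac c t ^ 2.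

Definition sbe (c t : R) : R := 16 * c ^ 2 / sfac c t ^ 2.

Lemma sfac_shift (c t h : R) : sfac c t <> 0 ->
  sfac c (t + h) * sfac c (t - h) = sfac c t ^ 2 * (1 + sin h ^ 2 * (sal c t + sbe c t * sin h ^ 2)).
Proof.
  intro hD. transitivity (sfac c t ^ 2 + sin h ^ 2 * (8 * c * ((1 + c ^ 2) * cos (2 * t) - 2 * c) + 16 * c ^ 2 * sin h ^ 2)).
  - unfold sfac. replace (2 * (t + h)) with (2 * t + 2 * h) by ring. replace (2 * (t - h)) with (2 * t - 2 * h) by ring.
    rewrite cos_plus, cos_minus, (cos_2a_sin h), (sin_2a h).
    assert (h1 := sin2_cos2 (2 * t)). assert (h2 := sin2_cos2 h). unfold Rsqr in *.
    set (C := cos (2 * t)) in *. set (S := sin (2 * t)) in *. set (u := sin h) in *. set (v := cos h) in *.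
    assert (e1 : S * S = 1 - C * C) by lra. assert (e2 : v * v = 1 - u * u) by lra.
    transitivity ((1 - 2 * c * (C * (1 - 2 * u * u)) + c ^ 2) ^ 2 - 16 * c ^ 2 * (S * S) * (u * u) * (v * v)); [ring|].
    rewrite e1, e2. ring.
  - unfold sal, sbe. field. exact hD.
Qed.

Lemma sal_bound (c r t : R) : 0 <= c <= r -> r < 1 -> Rabs (sal c t) <= 32 / (1 - r) ^ 4 * c.
Proof.
  intros hc hr. assert (h1 := sfac_ge c t ltac:(lra)).
  assert (h0 : 0 < (1 - r) ^ 4) by (apply pow_lt; lra).
  assert (h2 : (1 - r) ^ 4 <= sfac c t ^ 2).
  { replace ((1 - r) ^ 4) with (((1 - r) ^ 2) ^ 2) by ring. apply pow_incr. split; [apply pow_le; lra|].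
    eapply Rle_trans; [|exact h1]. apply pow_incr; lra. }
  unfold sal, Rdiv. rewrite Rabs_mult, (Rabs_pos_eq (/ _)) by (left; apply Rinv_0_lt_compat; lra).
  replace (32 * / (1 - r) ^ 4 * c) with (32 * c * / (1 - r) ^ 4) by ring.
  apply Rmult_le_compat; [apply Rabs_pos|left; apply Rinv_0_lt_compat; lra| |apply Rinv_le_contravar; lra].
  rewrite Rabs_mult, (Rabs_pos_eq (8 * c)) by lra.
  assert (Rabs ((1 + c ^ 2) * cos (2 * t) - 2 * c) <= 4).
  { pose proof (COS_bound (2 * t)). assert (0 <= c ^ 2 <= 1) by (simpl; nra). apply Rabs_le. nra. }
  nra.
Qed.

Lemma sbe_bound (c r t : R) : 0 <= c <= r -> r < 1 -> 0 <= sbe c t <= 32 / (1 - r) ^ 4 * c.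
Proof.
  intros hc hr. assert (h1 := sfac_ge c t ltac:(lra)).
  assert (h0 : 0 < (1 - r) ^ 4) by (apply pow_lt; lra).
  assert (h2 : (1 - r) ^ 4 <= sfac c t ^ 2).
  { replace ((1 - r) ^ 4) with (((1 - r) ^ 2) ^ 2) by ring. apply pow_incr. split; [apply pow_le; lra|].
    eapply Rle_trans; [|exact h1]. apply pow_incr; lra. }
  unfold sbe, Rdiv. replace (32 * / (1 - r) ^ 4 * c) with (32 * c * / (1 - r) ^ 4) by ring. split.
  - apply Rmult_le_pos; [nra|left; apply Rinv_0_lt_compat; lra].
  - apply Rmult_le_compat; [nra|left; apply Rinv_0_lt_compat; lra|nra|apply Rinv_le_contravar; lra].
Qed.

Definition hseq (k : nat) : R := / (INR k + 2).

Lemma hseq_bounds (k : nat) : 0 < hseq k <= 1 / 2.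
Proof.
  unfold hseq. pose proof (pos_INR k). split; [apply Rinv_0_lt_compat; lra|].
  replace (1 / 2) with (/ 2) by field. apply Rinv_le_contravar; lra.
Qed.

Lemma hseq_lim : is_lim_seq hseq 0.
Proof.
  unfold hseq. apply (is_lim_seq_inv _ p_infty); [|discriminate].
  apply (is_lim_seq_plus _ _ p_infty 2); [apply is_lim_seq_INR|apply is_lim_seq_const|reflexivity].
Qed.

Definition sseq (k : nat) : R := sin (hseq k) ^ 2.

Lemma sseq_pos (k : nat) : 0 < sseq k.
Proof.
  unfold sseq. apply pow_lt. assert (h := hseq_bounds k). apply sin_gt_0; [lra|]. pose proof PI2_1. lra.
Qed.

Lemma sseq_lim : is_lim_seq sseq 0.
Proof.
  unfold sseq. replace (Finite 0) with (Finite (sin 0 ^ 2)) by (rewrite sin_0; f_equal; ring).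
  apply (is_lim_seq_continuous (fun x => sin x ^ 2) hseq 0); [|apply hseq_lim].
  apply derivable_continuous_pt. reg.
Qed.

Lemma sseq_le1 (k : nat) : sseq k <= 1.
Proof. unfold sseq. pose proof (SIN_bound (hseq k)). nra. Qed.

Lemma ln_1p_derive : is_derive (fun t => ln (1 + t)) 0 1.
Proof. auto_derive; [lra|field]. Qed.

(** The logarithm of sprod(t+h) sprod(t-h)/sprod(t)^2, divided by sin^2 h, along the sequence h =
    [hseq k]. *)
Definition slog (q t : R) (k : nat) : R :=
  Sum (fun i => ln (1 + sseq k * (sal (q ^ S i) t + sbe (q ^ S i) t * sseq k)) / sseq k).

Lemma slog_lim (q t : R) : 0 < q < 1 -> is_lim_seq (slog q t) (Sum (fun i => sal (q ^ S i) t)).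
Proof.
  intro hq. unfold slog. set (M := 32 / (1 - q) ^ 4).
  assert (hM : 0 < M) by (apply Rdiv_lt_0_compat; [lra|apply pow_lt; lra]).
  apply (filterlim_Sum eventually (fun k i => ln (1 + sseq k * (sal (q ^ S i) t + sbe (q ^ S i) t * sseq k)) / sseq k)
    (fun i => sal (q ^ S i) t) (fun i => 4 * M * q ^ S i)).
  - apply summable_scal, summable_pow_S, hq.
  (* The bound 1/(4M) on sin^2 h keeps the arguments of all logarithms within 1/2 of 1, uniformly in
     the factor index. *)
  - assert (he : 0 < / (4 * M)) by (apply Rinv_0_lt_compat; lra).
    destruct (proj2 (is_lim_seq_spec _ _) sseq_lim (mkposreal _ he)) as [N hN].
    exists N. intros k hk i. specialize (hN k hk). simpl in hN. rewrite Rminus_0_r in hN.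
    assert (hs := sseq_pos k). assert (hs1 := sseq_le1 k). rewrite Rabs_pos_eq in hN by lra.
    assert (hc := pow_S_bounds q i hq). set (c := q ^ S i) in *.
    assert (b1 := sal_bound c q t ltac:(lra) ltac:(lra)). assert (b2 := sbe_bound c q t ltac:(lra) ltac:(lra)). fold M in b1, b2.
    set (a := sal c t) in *. set (b := sbe c t) in *. set (s := sseq k) in *.
    assert (b3 : Rabs (a + b * s) <= 2 * M * c).
    { eapply Rle_trans; [apply Rabs_triang|]. rewrite (Rabs_pos_eq (b * s)) by nra. nra. }
    assert (b4 : Rabs (s * (a + b * s)) <= s * (2 * M * c)).
    { rewrite Rabs_mult, (Rabs_pos_eq s) by lra. apply Rmult_le_compat_l; lra. }
    assert (b5 : s * (2 * M * c) <= 1 / 2).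
    { assert (s * (4 * M) <= 1).
      { apply Rmult_le_reg_r with (/ (4 * M)); [exact he|]. rewrite Rmult_assoc, Rinv_r by lra. lra. }
      assert (c <= 1) by lra. nra. }
    assert (b6 := ln_1p_bound (s * (a + b * s)) ltac:(lra)).
    unfold Rdiv. rewrite Rabs_mult, (Rabs_pos_eq (/ s)) by (left; apply Rinv_0_lt_compat; lra).
    apply Rmult_le_reg_r with s; [lra|]. rewrite Rmult_assoc, Rinv_l by lra. lra.
  - intro i.
    change (is_lim_seq (fun k => ln (1 + sseq k * (sal (q ^ S i) t + sbe (q ^ S i) t * sseq k)) / sseq k) (sal (q ^ S i) t)).
    assert (hl : is_lim_seq (fun k => sal (q ^ S i) t + sbe (q ^ S i) t * sseq k) (sal (q ^ S i) t + sbe (q ^ S i) t * 0)).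
    { apply is_lim_seq_plus'; [apply is_lim_seq_const|]. apply is_lim_seq_mult'; [apply is_lim_seq_const|apply sseq_lim]. }
    assert (h := difference_quotient_seq (fun u => ln (1 + u)) 1 sseq _ _
       ln_1p_derive (fun k => Rgt_not_eq _ _ (sseq_pos k)) sseq_lim hl).
    rewrite Rmult_1_l, Rmult_0_r, !Rplus_0_r, ln_1 in h. eapply is_lim_seq_ext; [|exact h].
    intro k. cbv beta. rewrite Rminus_0_r. reflexivity.
Qed.

Lemma sprod_shift (q t : R) (k : nat) : 0 < q < 1 ->
  sprod q (t + hseq k) * sprod q (t - hseq k) = sprod q t ^ 2 * exp (sseq k * slog q t k).
Proof.
  intro hq. unfold sprod. replace (exp (Sum (fun i => ln (sfac (q ^ S i) t))) ^ 2) with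
    (exp (Sum (fun i => ln (sfac (q ^ S i) t)) + Sum (fun i => ln (sfac (q ^ S i) t)))) by (rewrite exp_plus; ring).
  rewrite <- !exp_plus. f_equal.
  assert (hs := sseq_pos k).
  assert (pw : forall i, ln (sfac (q ^ S i) (t + hseq k)) + ln (sfac (q ^ S i) (t - hseq k)) - (ln (sfac (q ^ S i) t) + ln (sfac (q ^ S i) t))
     = sseq k * (ln (1 + sseq k * (sal (q ^ S i) t + sbe (q ^ S i) t * sseq k)) / sseq k)).
  { intro i. set (c := q ^ S i).
    assert (p0 : 0 < sfac c t) by (apply (sfac_pos q t i hq)).
    assert (p1 : 0 < sfac c (t + hseq k)) by (apply (sfac_pos q _ i hq)).
    assert (p2 : 0 < sfac c (t - hseq k)) by (apply (sfac_pos q _ i hq)).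
    assert (e := sfac_shift c t (hseq k) ltac:(lra)). fold (sseq k) in e.
    set (Y := 1 + sseq k * (sal c t + sbe c t * sseq k)) in *.
    assert (pY : 0 < Y).
    { apply Rmult_lt_reg_l with (sfac c t ^ 2); [apply pow_lt; lra|]. rewrite Rmult_0_r, <- e. nra. }
    rewrite <- (ln_mult (sfac c (t + hseq k))) by assumption. rewrite e.
    rewrite ln_mult by (try apply pow_lt; lra). simpl pow. rewrite Rmult_1_r, ln_mult by lra. field. lra. }
  unfold slog. rewrite <- Sum_scal.
  - rewrite <- (Sum_ext _ _ pw). rewrite Sum_minus, !Sum_plus; try (repeat apply summable_plus; apply summable_ln_sfac, hq). ring.
  - apply summable_ext with (fun i => / sseq k * (ln (sfac (q ^ S i) (t + hseq k)) + ln (sfac (q ^ S i) (t - hseq k)) - (ln (sfac (q ^ S i) t) + ln (sfac (q ^ S i) t)))).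
    + intro i. rewrite pw. field. lra.
    + apply summable_scal, summable_minus; apply summable_plus; apply summable_ln_sfac, hq.
Qed.

Lemma sprod_0 (q : R) : 0 < q < 1 -> sprod q 0 = eulerT q ^ 2.
Proof.
  intro hq. apply is_lim_seq_uniq with (1 := sprod_lim q 0 hq).
  destruct (eulerT_lim q hq) as [_ h].
  apply is_lim_seq_ext with (fun n => rpoch q n * rpoch q n).
  - induction n as [|n IH]; [cbn; ring|]. cbn [rprod rpoch]. rewrite <- IH. unfold sfac. rewrite Rmult_0_r, cos_0. ring.
  - replace (eulerT q ^ 2) with (eulerT q * eulerT q) by ring. apply is_lim_seq_mult'; exact h.
Qed.

Lemma sprod_hseq (q : R) : 0 < q < 1 -> is_lim_seq (fun k => sprod q (hseq k)) (eulerT q ^ 2).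
Proof.
  intro hq. rewrite <- sprod_0 by exact hq. unfold sprod.
  apply (is_lim_seq_continuous exp); [apply derivable_continuous_pt, derivable_pt_exp|].
  apply (filterlim_Sum eventually (fun k i => ln (sfac (q ^ S i) (hseq k))) (fun i => ln (sfac (q ^ S i) 0)) (fun i => 2 / (1 - q) * q ^ S i)).
  - apply summable_scal, summable_pow_S, hq.
  - apply filter_forall. intros k i. apply ln_sfac_bound; [|lra]. assert (h := pow_S_bounds q i hq). lra.
  - intro i. apply (is_lim_seq_continuous (fun x => ln (sfac (q ^ S i) x)) hseq 0); [|apply hseq_lim].
    apply (continuity_pt_comp (fun x => sfac (q ^ S i) x) ln 0).
    + unfold sfac. reg.
    + apply derivable_continuous_pt. exists (/ sfac (q ^ S i) 0). apply derivable_pt_lim_ln, sfac_pos, hq.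
Qed.

(* The limit h -> 0 of the three-term relation: the classical formula for wp(x) - wp(y). *)
Lemma sal_difference (q x y : R) : 0 < q < 1 -> sin x <> 0 -> sin y <> 0 ->
  Sum (fun i => sal (q ^ S i) x) - / sin x ^ 2 - (Sum (fun i => sal (q ^ S i) y) - / sin y ^ 2) =
  sig q (x + y) * sig q (x - y) * eulerT q ^ 4 / (sig q x ^ 2 * sig q y ^ 2).
Proof.
  intros hq hx hy.
  assert (px : 0 < sprod q x) by apply exp_pos. assert (py : 0 < sprod q y) by apply exp_pos.
  assert (nx : sig q x <> 0) by (apply Rmult_integral_contrapositive_currified; [exact hx|lra]).
  assert (ny : sig q y <> 0) by (apply Rmult_integral_contrapositive_currified; [exact hy|lra]).
  assert (lim1 : forall t, is_lim_seq (fun k => (exp (sseq k * slog q t k) - exp 0) / sseq k - / sin t ^ 2 * exp (sseq k * slog q t k))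
     (Sum (fun i => sal (q ^ S i) t) - / sin t ^ 2)).
  { intro t. assert (hl := slog_lim q t hq). apply is_lim_seq_minus'.
    - assert (h := difference_quotient_seq exp 1 sseq (slog q t) _
        ltac:(rewrite <- exp_0; apply is_derive_exp) (fun k => Rgt_not_eq _ _ (sseq_pos k)) sseq_lim hl).
      rewrite Rmult_1_l in h. exact h.
    - replace (Finite (/ sin t ^ 2)) with (Finite (/ sin t ^ 2 * exp (0 * Sum (fun i => sal (q ^ S i) t)))) by (rewrite Rmult_0_l, exp_0, Rmult_1_r; reflexivity).
      apply is_lim_seq_mult'; [apply is_lim_seq_const|].
      apply (is_lim_seq_continuous exp); [apply derivable_continuous_pt, derivable_pt_exp|].
      apply is_lim_seq_mult'; [apply sseq_lim|exact hl]. }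
  assert (l := is_lim_seq_minus' _ _ _ _ (lim1 x) (lim1 y)).
  apply (is_lim_seq_uniq _ _ _ l).
  apply is_lim_seq_ext with (fun k => sig q (x + y) * sig q (x - y) * (sprod q (hseq k) * sprod q (hseq k)) / (sig q x ^ 2 * sig q y ^ 2)).
  - intro k. assert (hs := sseq_pos k).
    assert (e := sig_three_term q x y (hseq k) hq).
    assert (es : forall t, sig q (t + hseq k) * sig q (t - hseq k) = (sin t ^ 2 - sseq k) * (sprod q t ^ 2 * exp (sseq k * slog q t k))).
    { intro t. rewrite <- sprod_shift by exact hq. unfold sig.
      assert (e1 : sin (t + hseq k) * sin (t - hseq k) = sin t ^ 2 - sseq k).
      { unfold sseq. rewrite sin_plus, sin_minus. assert (h1 := sin2_cos2 t). assert (h2 := sin2_cos2 (hseq k)). unfold Rsqr in *. nra. }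
      rewrite <- e1. ring. }
    rewrite !es in e. unfold sig at 5 in e.
    assert (eh : (sin (hseq k) * sprod q (hseq k)) ^ 2 = sseq k * (sprod q (hseq k) * sprod q (hseq k))) by (unfold sseq; ring).
    rewrite eh in e. rewrite exp_0.
    apply Rmult_eq_reg_l with (sseq k * (sig q x ^ 2 * sig q y ^ 2)).
    2:{ apply Rmult_integral_contrapositive_currified; [lra|].
        apply Rmult_integral_contrapositive_currified; apply pow_nonzero; assumption. }
    transitivity (sig q (x + y) * sig q (x - y) * (sseq k * (sprod q (hseq k) * sprod q (hseq k)))).
    + field. auto.
    + rewrite <- e. unfold sig. field. repeat split; auto; lra.
  - unfold Rdiv. apply is_lim_seq_mult'; [|apply is_lim_seq_const]. apply is_lim_seq_mult'; [apply is_lim_seq_const|].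
    replace (eulerT q ^ 4) with (eulerT q ^ 2 * eulerT q ^ 2) by ring. apply is_lim_seq_mult'; apply sprod_hseq, hq.
Qed.

(** For c = cos(pi/5), computing cos(4 pi/5) = -c by two duplications gives (c+1)(2c-1)(4c^2-2c-1) =
    0, and c > 1/2 selects the quadratic factor. *)
Lemma cos_2PI5 : cos (2 * (PI / 5)) = (sqrt 5 - 1) / 4 /\ cos (2 * (2 * (PI / 5))) = - (sqrt 5 + 1) / 4.
Proof.
  set (c := cos (PI / 5)). assert (hpi := PI_RGT_0).
  assert (e2 : cos (2 * (PI / 5)) = 2 * c * c - 1) by apply cos_2a_cos.
  assert (e4 : cos (2 * (2 * (PI / 5))) = - c).
  { replace (2 * (2 * (PI / 5))) with (PI - PI / 5) by field. apply Rtrigo_facts.cos_pi_minus. }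
  assert (pc : 1 / 2 < c).
  { rewrite <- cos_PI3. apply cos_decreasing_1; lra. }
  assert (e4' : cos (2 * (2 * (PI / 5))) = 2 * (2 * c * c - 1) * (2 * c * c - 1) - 1) by (rewrite cos_2a_cos, e2; reflexivity).
  assert (k : (c + 1) * (2 * c - 1) * (4 * c * c - 2 * c - 1) = 0).
  { transitivity (2 * (2 * c * c - 1) * (2 * c * c - 1) - 1 + c); [ring|lra]. }
  apply Rmult_integral in k. destruct k as [k|k]; [apply Rmult_integral in k; lra|].
  assert (e : sqrt 5 = 4 * c - 1).
  { rewrite <- (sqrt_square (4 * c - 1)) by lra. f_equal. lra. }
  rewrite e2, e4, e. split; lra.
Qed.

(** The closed form of the sum of (m/5) m c^m over m >= 1, with the Legendre symbol modulo 5. It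
    arises because [sal c t] has the Fourier series 8 sum m c^m cos(2mt) and cos(2 pi m/5) - cos(4
    pi m/5) = (m/5) sqrt 5/2. *)
Definition chi5 (c : R) : R :=
  (c * (1 + 4 * c ^ 5) - c ^ 2 * (2 + 3 * c ^ 5) - c ^ 3 * (3 + 2 * c ^ 5) + c ^ 4 * (4 + c ^ 5)) / (1 - c ^ 5) ^ 2.

Lemma sal_chi5 (c : R) : 0 < c < 1 -> sal c (PI / 5) - sal c (2 * (PI / 5)) = 4 * sqrt 5 * chi5 c.
Proof.
  intro hc. destruct cos_2PI5 as [e1 e2]. unfold sal, chi5, sfac. rewrite e1, e2.
  assert (h5 := sqrt5_sq). assert (hb := sqrt5_bounds). set (r := sqrt 5) in *.
  set (D1 := 1 - 2 * c * ((r - 1) / 4) + c ^ 2). set (D2 := 1 - 2 * c * (- (r + 1) / 4) + c ^ 2).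
  assert (p1 : 0 < D1) by (unfold D1; nra). assert (p2 : 0 < D2) by (unfold D2; nra).
  (* The factorization of 1 - c^5 over Q(sqrt 5); after clearing denominators the claim is
     polynomial modulo r^2 = 5. *)
  assert (e : 1 - c ^ 5 = (1 - c) * (D1 * D2)).
  { unfold D1, D2. transitivity ((1 - c) * (1 + c + c ^ 2 + c ^ 3 + c ^ 4 + c ^ 2 * (5 - r * r) / 4)); [rewrite h5; field|field]. }
  rewrite e. apply Rmult_eq_reg_r with (D1 ^ 2 * D2 ^ 2 * (1 - c) ^ 2).
  2:{ assert (0 < D1 ^ 2 * D2 ^ 2 * (1 - c) ^ 2) by (apply Rmult_lt_0_compat; [apply Rmult_lt_0_compat|]; apply pow_lt; lra). lra. }
  transitivity (8 * c * (1 - c) ^ 2 * (((1 + c ^ 2) * ((r - 1) / 4) - 2 * c) * D2 ^ 2 - ((1 + c ^ 2) * (- (r + 1) / 4) - 2 * c) * D1 ^ 2)).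
  { field. lra. }
  transitivity (4 * r * (c * (1 + 4 * c ^ 5) - c ^ 2 * (2 + 3 * c ^ 5) - c ^ 3 * (3 + 2 * c ^ 5) + c ^ 4 * (4 + c ^ 5))).
  2:{ field. lra. }
  unfold D1, D2. assert (h2 : r ^ 2 = 5) by (simpl; lra). field [h2].
Qed.

(** * The logarithmic derivative of R *)

Lemma summable_sal (q t : R) : 0 < q < 1 -> summable (fun i => sal (q ^ S i) t).
Proof.
  intro hq. apply summable_dom with (fun i => 32 / (1 - q) ^ 4 * q ^ S i).
  - intro i. apply sal_bound; [|lra]. assert (h := pow_S_bounds q i hq). lra.
  - apply summable_scal, summable_pow_S, hq.
Qed.

Lemma sprod_PI5 (q : R) : 0 < q < 1 ->
  sprod q (PI / 5) * sprod q (2 * (PI / 5)) * eulerT q = eulerT (q ^ 5).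
Proof.
  intro hq. destruct (eulerT_lim q hq) as [_ hT]. destruct (eulerT_lim (q ^ 5) (pow5_bounds q hq)) as [_ hT5].
  assert (l := is_lim_seq_mult' _ _ _ _ (is_lim_seq_mult' _ _ _ _ (sprod_lim q (PI / 5) hq) (sprod_lim q (2 * (PI / 5)) hq)) hT).
  apply (is_lim_seq_uniq _ _ _ l). eapply is_lim_seq_ext; [|exact hT5].
  destruct cos_2PI5 as [e1 e2].
  induction n as [|n IH]; [cbn; ring|]. cbn [rprod rpoch]. rewrite IH. unfold sfac. rewrite e1, e2.
  set (c := q ^ S n). replace ((q ^ 5) ^ S n) with (c ^ 5) by (unfold c; rewrite <- !pow_mult; f_equal; lia).
  assert (h5 := sqrt5_sq). set (r := sqrt 5) in *.
  assert (e : (1 - 2 * c * ((r - 1) / 4) + c ^ 2) * (1 - 2 * c * (- (r + 1) / 4) + c ^ 2) * (1 - c) = 1 - c ^ 5).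
  { assert (h2 : r ^ 2 = 5) by (simpl; lra). field [h2]. }
  rewrite <- e. ring.
Qed.

Lemma sin_sq_PI5 : sin (PI / 5) ^ 2 = (5 - sqrt 5) / 8 /\ sin (2 * (PI / 5)) ^ 2 = (5 + sqrt 5) / 8 /\
  sin (PI / 5) * sin (2 * (PI / 5)) = sqrt 5 / 4 /\ 0 < sin (PI / 5) /\ 0 < sin (2 * (PI / 5)).
Proof.
  destruct cos_2PI5 as [e1 e2]. rewrite cos_2a_sin in e1, e2. assert (hpi := PI_RGT_0).
  assert (p1 : 0 < sin (PI / 5)) by (apply sin_gt_0; lra).
  assert (p2 : 0 < sin (2 * (PI / 5))) by (apply sin_gt_0; lra).
  set (s := sin (PI / 5)) in *. set (t := sin (2 * (PI / 5))) in *.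
  assert (a1 : s ^ 2 = (5 - sqrt 5) / 8) by (simpl; lra). assert (a2 : t ^ 2 = (5 + sqrt 5) / 8) by (simpl; lra).
  split; [exact a1|]. split; [exact a2|]. split; [|split; assumption].
  rewrite <- (sqrt_square (s * t)) by nra. rewrite <- (sqrt_square (sqrt 5 / 4)) by (pose proof sqrt5_bounds; lra).
  f_equal. replace (s * t * (s * t)) with (s ^ 2 * t ^ 2) by ring. rewrite a1, a2. pose proof sqrt5_sq. nra.
Qed.

(** At x = pi/5, y = 2 pi/5 the arguments x + y and x - y reduce to y and -x, since [sig] is odd and
    invariant under t -> pi - t. The quotient of [sal_difference] collapses to -T^4/(sig x sig y),
    and [sprod_PI5] evaluates the denominator. *)
Lemma chi5_sum (q : R) : 0 < q < 1 ->
  1 - 5 * Sum (fun i => chi5 (q ^ S i)) = eulerT q ^ 5 / eulerT (q ^ 5).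
Proof.
  intro hq. destruct sin_sq_PI5 as [a1 [a2 [a3 [p1 p2]]]].
  assert (hT := eulerT_pos q hq). assert (h5 := sqrt5_sq). assert (hb := sqrt5_bounds).
  assert (h := sal_difference q (PI / 5) (2 * (PI / 5)) hq ltac:(lra) ltac:(lra)).
  assert (es : Sum (fun i => sal (q ^ S i) (PI / 5)) - Sum (fun i => sal (q ^ S i) (2 * (PI / 5))) = 4 * sqrt 5 * Sum (fun i => chi5 (q ^ S i))).
  { rewrite <- Sum_minus by (apply summable_sal, hq).
    assert (ec : forall i, sal (q ^ S i) (PI / 5) - sal (q ^ S i) (2 * (PI / 5)) = 4 * sqrt 5 * chi5 (q ^ S i)).
    { intro i. apply sal_chi5. assert (k := pow_S_bounds q i hq). lra. }
    rewrite (Sum_ext _ _ ec). apply Sum_scal.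
    apply summable_ext with (fun i => / (4 * sqrt 5) * (sal (q ^ S i) (PI / 5) - sal (q ^ S i) (2 * (PI / 5)))).
    - intro i. rewrite ec. field. lra.
    - apply summable_scal, summable_minus; apply summable_sal, hq. }
  assert (e3 : sig q (PI / 5 + 2 * (PI / 5)) = sig q (2 * (PI / 5))).
  { unfold sig. replace (PI / 5 + 2 * (PI / 5)) with (PI - 2 * (PI / 5)) by field. rewrite sin_PI_x. f_equal.
    unfold sprod. f_equal. apply Sum_ext. intro i. unfold sfac.
    replace (2 * (PI - 2 * (PI / 5))) with (- (2 * (2 * (PI / 5))) + 2 * INR 1 * PI) by (simpl; ring).
    rewrite cos_period, cos_neg. reflexivity. }
  assert (e1 : sig q (PI / 5 - 2 * (PI / 5)) = - sig q (PI / 5)).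
  { unfold sig. replace (PI / 5 - 2 * (PI / 5)) with (- (PI / 5)) by ring. rewrite sin_neg.
    assert (k : sprod q (- (PI / 5)) = sprod q (PI / 5)).
    { unfold sprod. f_equal. apply Sum_ext. intro i. unfold sfac.
      replace (2 * (- (PI / 5))) with (- (2 * (PI / 5))) by ring. rewrite cos_neg. reflexivity. }
    rewrite k. ring. }
  rewrite e3, e1, a1, a2 in h.
  assert (px : 0 < sprod q (PI / 5)) by apply exp_pos. assert (py : 0 < sprod q (2 * (PI / 5))) by apply exp_pos.
  assert (ep := sprod_PI5 q hq). rewrite <- ep.
  assert (exy : sig q (PI / 5) * sig q (2 * (PI / 5)) = sqrt 5 / 4 * (sprod q (PI / 5) * sprod q (2 * (PI / 5)))).
  { unfold sig. rewrite <- a3. ring. }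
  assert (nx : 0 < sig q (PI / 5)) by (apply Rmult_lt_0_compat; assumption).
  assert (ny : 0 < sig q (2 * (PI / 5))) by (apply Rmult_lt_0_compat; assumption).
  set (Px := sprod q (PI / 5)) in *. set (Py := sprod q (2 * (PI / 5))) in *.
  set (X := sig q (PI / 5)) in *. set (Y := sig q (2 * (PI / 5))) in *. set (T := eulerT q) in *.
  assert (h' : Y * - X * T ^ 4 / (X ^ 2 * Y ^ 2) = - (4 * T ^ 4 / (sqrt 5 * (Px * Py)))).
  { transitivity (- (T ^ 4 / (X * Y))); [field; lra|]. rewrite exy. field. lra. }
  rewrite h' in h.
  assert (e4 : / ((5 - sqrt 5) / 8) - / ((5 + sqrt 5) / 8) = 4 * sqrt 5 / 5).
  { set (r := sqrt 5) in *. assert (h2 : r ^ 2 = 5) by (simpl; lra). 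
    transitivity (16 * r / (25 - r * r)); [field; split; [|split]; nra|]. rewrite h5. field. }
  replace (T ^ 5 / (Px * Py * T)) with (sqrt 5 / 4 * (4 * T ^ 4 / (sqrt 5 * (Px * Py)))) by (field; lra).
  replace (4 * T ^ 4 / (sqrt 5 * (Px * Py))) with (4 * sqrt 5 / 5 - 4 * sqrt 5 * Sum (fun i => chi5 (q ^ S i))) by lra.
  set (S0 := Sum (fun i => chi5 (q ^ S i))). transitivity (sqrt 5 * sqrt 5 * (1 / 5 - S0)); [rewrite h5; field|field].
Qed.

(** * Termwise differentiation and Lambert series *)

Lemma Rabs_between (x y z d : R) : Rabs (y - x) < d -> Rmin x y <= z <= Rmax x y -> Rabs (z - x) < d.
Proof.
  intros h hz. apply Rabs_def2 in h. revert hz. unfold Rmin, Rmax. destruct (Rle_dec x y); intro hz; apply Rabs_def1; lra.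
Qed.

(** The mean value theorem turns the bound [M] on the derivatives into a bound on the difference
    quotients, to which dominated convergence at the punctured point applies. *)
Lemma is_derive_Sum {I : Type} (f df : R -> I -> R) (x d : R) (M : I -> R) :
  0 < d -> summable M -> summable (f x) ->
  (forall y, Rabs (y - x) < d -> forall i, is_derive (fun y => f y i) y (df y i) /\ Rabs (df y i) <= M i) ->
  is_derive (fun y => Sum (f y)) x (Sum (df x)).
Proof.
  intros hd hM hf hdf.
  assert (mvt : forall y, Rabs (y - x) < d -> forall i, Rabs (f y i - f x i) <= M i * Rabs (y - x)).
  { intros y hy i.
    destruct (MVT_gen (fun y => f y i) x y (fun y => df y i)) as [c [hc e]].
    - intros z hz. apply hdf. apply (Rabs_between x y); lra.
    - intros z hz. apply continuity_pt_filterlim. apply (ex_derive_continuous (fun y => f y i)). exists (df z i).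
      apply hdf. apply (Rabs_between x y); lra.
    - simpl in e. rewrite e, Rabs_mult. apply Rmult_le_compat_r; [apply Rabs_pos|].
      apply hdf. apply (Rabs_between x y); lra. }
  assert (hs : forall y, Rabs (y - x) < d -> summable (f y)).
  { intros y hy. apply summable_ext with (fun i => f x i + (f y i - f x i)); [intro; ring|].
    apply summable_plus; [exact hf|]. apply summable_dom with (fun i => Rabs (y - x) * M i).
    - intro i. rewrite Rmult_comm. apply mvt, hy.
    - apply summable_scal, hM. }
  assert (hl : filterlim (fun y => Sum (fun i => (f y i - f x i) / (y - x))) (Rbar_locally' x) (locally (Sum (df x)))).
  { apply (filterlim_Sum (Rbar_locally' x) (fun y i => (f y i - f x i) / (y - x)) (df x) M hM).
    - exists (mkposreal d hd). intros y hy ne i.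
      change (Rabs (y - x) < d) in hy. unfold Rdiv. rewrite Rabs_mult, Rabs_inv.
      assert (0 < Rabs (y - x)) by (apply Rabs_pos_lt; lra).
      apply Rmult_le_reg_r with (Rabs (y - x)); [assumption|]. rewrite Rmult_assoc, Rinv_l by lra. rewrite Rmult_1_r.
      apply mvt, hy.
    - intro i. assert (k := proj1 (hdf x ltac:(rewrite Rminus_diag, Rabs_R0; exact hd) i)).
      apply is_derive_Reals in k. apply filterlim_locally. intros [eps he].
      destruct (k eps he) as [[del hdel] hk]. exists (mkposreal del hdel). intros y hy ne.
      change (Rabs (y - x) < del) in hy. change (Rabs ((f y i - f x i) / (y - x) - df x i) < eps).
      specialize (hk (y - x) ltac:(lra) hy). rewrite Rplus_minus in hk. exact hk. }
  apply is_derive_Reals. intros eps he.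
  destruct (proj1 (filterlim_locally _ _) hl (mkposreal eps he)) as [[del hdel] hk].
  assert (hm : 0 < Rmin del d) by (apply Rmin_glb_lt; assumption).
  exists (mkposreal _ hm). intros h nh hh. simpl in hh.
  assert (h1 : Rabs (x + h - x) < del) by (replace (x + h - x) with h by ring; eapply Rlt_le_trans; [exact hh|apply Rmin_l]).
  assert (h2 : Rabs (x + h - x) < d) by (replace (x + h - x) with h by ring; eapply Rlt_le_trans; [exact hh|apply Rmin_r]).
  specialize (hk (x + h) h1 ltac:(lra)).
  change (Rabs (Sum (fun i => (f (x + h) i - f x i) / (x + h - x)) - Sum (df x)) < eps) in hk.
  replace (x + h - x) with h in hk by ring.
  rewrite (Sum_ext _ (fun i => / h * (f (x + h) i - f x i))) in hk by (intro; field; exact nh).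
  assert (s1 := hs _ h2). rewrite Sum_scal in hk by (apply summable_minus; assumption). rewrite Sum_minus in hk by assumption.
  replace ((Sum (f (x + h)) - Sum (f x)) / h) with (/ h * (Sum (f (x + h)) - Sum (f x))) by (field; exact nh).
  exact hk.
Qed.

Lemma summable_INR_pow (r : R) : 0 <= r < 1 -> summable (fun i => INR i * r ^ i).
Proof.
  intro hr. apply summable_nat with (r / (1 - r) ^ 2). intro N.
  assert (h : (1 - r) ^ 2 * sum_n (fun i => Rabs (INR i * r ^ i)) N = r - (INR N + 1) * r ^ S N + INR N * r ^ S (S N)).
  { induction N as [|N IH].
    - rewrite sum_O. simpl. rewrite Rmult_0_l, Rabs_R0. ring.
    - rewrite sum_Sn. unfold plus; simpl plus. rewrite Rmult_plus_distr_l, IH.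
      rewrite Rabs_pos_eq by (apply Rmult_le_pos; [apply pos_INR|apply pow_le; lra]).
      rewrite S_INR. simpl pow. ring. }
  assert (h2 : 0 < (1 - r) ^ 2) by (apply pow_lt; lra).
  apply Rmult_le_reg_l with ((1 - r) ^ 2); [exact h2|]. rewrite h.
  replace ((1 - r) ^ 2 * (r / (1 - r) ^ 2)) with r by (field; lra).
  assert (0 <= r ^ S N) by (apply pow_le; lra). pose proof (pos_INR N).
  replace (INR N * r ^ S (S N)) with (INR N * r ^ S N * r) by (simpl; ring).
  assert (0 <= INR N * r ^ S N) by (apply Rmult_le_pos; assumption). nra.
Qed.

Lemma Sum_nat_shift (f : nat -> R) : summable f -> Sum f = f O + Sum (fun i => f (S i)).
Proof.
  intro hf. assert (h1 := is_lim_seq_Sum f hf).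
  assert (h2 := is_lim_seq_Sum (fun i => f (S i)) (summable_inj S f ltac:(intros; lia) hf)).
  apply is_lim_seq_incr_1 in h1. apply (is_lim_seq_uniq _ _ _ h1).
  apply is_lim_seq_ext with (fun n => f O + sum_n (fun i => f (S i)) n).
  - induction n as [|n IH].
    + rewrite sum_Sn, !sum_O. reflexivity.
    + rewrite (sum_Sn f), (sum_Sn (fun i => f (S i))), <- IH. unfold plus; simpl. ring.
  - apply is_lim_seq_plus'; [apply is_lim_seq_const|exact h2].
Qed.

Lemma Sum_INR_pow (r : R) : 0 <= r < 1 -> Sum (fun i => INR i * r ^ i) = r / (1 - r) ^ 2.
Proof.
  intro hr. assert (hs := summable_INR_pow r hr). assert (hg := summable_geom r hr).
  assert (h := Sum_nat_shift _ hs). cbv beta in h.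
  rewrite (Sum_ext (fun i => INR (S i) * r ^ S i) (fun i => r * (INR i * r ^ i) + r * r ^ i)) in h.
  2:{ intro i. rewrite S_INR. simpl. ring. }
  rewrite Sum_lin, Sum_geom in h by assumption. rewrite Rmult_0_l, Rplus_0_l in h.
  set (s := Sum (fun i => INR i * r ^ i)) in *.
  apply Rmult_eq_reg_l with (1 - r); [|lra]. transitivity (r * / (1 - r)); [lra|field; lra].
Qed.

Lemma summable_affine_pow (a b r : R) : 0 <= r < 1 -> summable (fun i => (a * INR i + b) * r ^ i).
Proof.
  intro hr. apply summable_ext with (fun i => a * (INR i * r ^ i) + b * r ^ i); [intro; ring|].
  apply summable_lin; [apply summable_INR_pow|apply summable_geom]; exact hr.
Qed.

Lemma pow_prog (c : R) (r i : nat) : c ^ (5 * i + r) = c ^ r * (c ^ 5) ^ i.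
Proof. rewrite pow_add, pow_mult. ring. Qed.

Lemma INR_prog (r i : nat) : INR (5 * i + r) = 5 * INR i + INR r.
Proof. rewrite plus_INR, mult_INR. simpl. ring. Qed.

Lemma summable_prog (c : R) (r : nat) : 0 < c < 1 -> summable (fun i => INR (5 * i + r) * c ^ (5 * i + r)).
Proof.
  intro hc. assert (h5 := pow5_bounds c hc).
  apply summable_ext with (fun i => c ^ r * ((5 * INR i + INR r) * (c ^ 5) ^ i)).
  - intro i. rewrite pow_prog, INR_prog. ring.
  - apply summable_scal, summable_affine_pow. lra.
Qed.

Lemma Sum_prog (c : R) (r : nat) : 0 < c < 1 ->
  Sum (fun i => INR (5 * i + r) * c ^ (5 * i + r)) = c ^ r * (INR r + (5 - INR r) * c ^ 5) / (1 - c ^ 5) ^ 2.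
Proof.
  intro hc. assert (h5 := pow5_bounds c hc).
  rewrite (Sum_ext _ (fun i => (c ^ r * 5) * (INR i * (c ^ 5) ^ i) + (c ^ r * INR r) * (c ^ 5) ^ i)).
  2:{ intro i. rewrite pow_prog, INR_prog. ring. }
  rewrite Sum_lin, Sum_INR_pow, Sum_geom; try lra; [|apply summable_INR_pow; lra|apply summable_geom; lra].
  field. lra.
Qed.

Lemma Sum_chi5 (c : R) : 0 < c < 1 ->
  Sum (fun i => INR (5 * i + 1) * c ^ (5 * i + 1) + INR (5 * i + 4) * c ^ (5 * i + 4)
    - (INR (5 * i + 3) * c ^ (5 * i + 3) + INR (5 * i + 2) * c ^ (5 * i + 2))) = chi5 c.
Proof.
  intro hc. assert (h5 := pow5_bounds c hc).
  rewrite Sum_minus by (apply summable_plus; apply summable_prog, hc).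
  rewrite !Sum_plus by (apply summable_prog, hc). rewrite !Sum_prog by exact hc.
  unfold chi5. simpl INR. field. lra.
Qed.

Lemma Sum_lambert (q : R) (k : nat) : 0 < q < 1 -> (1 <= k)%nat ->
  summable (fun n => INR k * (q ^ S n) ^ k) /\ Sum (fun n => INR k * (q ^ S n) ^ k) = INR k * q ^ k / (1 - q ^ k).
Proof.
  intros hq hk. assert (h1 : 0 < q ^ k) by (apply pow_lt; lra).
  assert (h2 := pow_le_pow q 1 k hq hk). rewrite pow_1 in h2.
  assert (e : forall n, (INR k * q ^ k) * (q ^ k) ^ n = INR k * (q ^ S n) ^ k).
  { intro n. rewrite <- !pow_mult. replace (S n * k)%nat with (k + k * n)%nat by lia. rewrite pow_add. ring. }
  assert (hs := summable_geom (q ^ k) ltac:(lra)). split.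
  - apply summable_ext with (1 := e). apply summable_scal, hs.
  - rewrite <- (Sum_ext _ _ e), Sum_scal, Sum_geom by (exact hs || lra). reflexivity.
Qed.

Definition lam (q : R) (k : nat) : R := INR k * q ^ k / (1 - q ^ k).

(** Each Lambert term is expanded as a geometric series in n. Summed over i first, the double series
    has the inner sum [chi5] at q^(n+1); summed over n first, it is the logarithmic derivative of
    the product. *)
Lemma lambert_swap (q : R) : 0 < q < 1 ->
  Sum (fun i => lam q (5 * i + 1) + lam q (5 * i + 4) - (lam q (5 * i + 3) + lam q (5 * i + 2))) = Sum (fun n => chi5 (q ^ S n)).
Proof.
  intro hq.
  set (h := fun p : nat * nat => INR (5 * fst p + 1) * (q ^ S (snd p)) ^ (5 * fst p + 1) + INR (5 * fst p + 4) * (q ^ S (snd p)) ^ (5 * fst p + 4)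
    - (INR (5 * fst p + 3) * (q ^ S (snd p)) ^ (5 * fst p + 3) + INR (5 * fst p + 2) * (q ^ S (snd p)) ^ (5 * fst p + 2))).
  assert (hs : summable h).
  (* Each of the four terms is at most (5i+4) q^i q^n, because (n+1)(5i+r) >= i + n. *)
  { apply summable_pair with (fun i => (20 * INR i + 16) * q ^ i) (fun n => q ^ n).
    - intros i n. unfold h. cbn [fst snd].
      assert (hb : forall r, (1 <= r <= 4)%nat -> 0 <= INR (5 * i + r) * (q ^ S n) ^ (5 * i + r) <= (5 * INR i + 4) * (q ^ i * q ^ n)).
      { intros r hr. rewrite INR_prog. assert (hi := pos_INR i).
        assert (1 <= INR r <= 4). { split; [apply (le_INR 1); lia|]. replace 4 with (INR 4) by (simpl; ring). apply le_INR; lia. }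
        rewrite <- pow_mult, <- pow_add. assert (p := pow_le_pow q (i + n) (S n * (5 * i + r)) hq ltac:(nia)).
        assert (0 < q ^ (S n * (5 * i + r))) by (apply pow_lt; lra). split; [nra|].
        apply Rmult_le_compat; lra. }
      assert (b1 := hb 1%nat ltac:(lia)). assert (b2 := hb 2%nat ltac:(lia)). assert (b3 := hb 3%nat ltac:(lia)). assert (b4 := hb 4%nat ltac:(lia)).
      replace ((20 * INR i + 16) * q ^ i * q ^ n) with (4 * ((5 * INR i + 4) * (q ^ i * q ^ n))) by ring.
      apply Rabs_le. lra.
    - intro i. apply Rmult_le_pos; [pose proof (pos_INR i); lra|apply pow_le; lra].
    - intro; apply pow_le; lra.
    - apply summable_affine_pow; lra.
    - apply summable_geom; lra. }
  rewrite (Sum_ext (fun n => chi5 (q ^ S n)) (fun n => Sum (fun i => h (i, n)))).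
  2:{ intro n. rewrite <- Sum_chi5; [reflexivity|]. assert (k := pow_S_bounds q n hq). lra. }
  rewrite <- (Sum_swap h hs). apply Sum_ext. intro i. unfold h, lam. cbn [fst snd].
  destruct (Sum_lambert q (5 * i + 1) hq ltac:(lia)) as [s1 <-]. destruct (Sum_lambert q (5 * i + 2) hq ltac:(lia)) as [s2 <-].
  destruct (Sum_lambert q (5 * i + 3) hq ltac:(lia)) as [s3 <-]. destruct (Sum_lambert q (5 * i + 4) hq ltac:(lia)) as [s4 <-].
  rewrite Sum_minus, !Sum_plus; try apply summable_plus; try assumption. reflexivity.
Qed.

(** The logarithm of the i-th factor of B/A. *)
Definition lfac (q : R) (i : nat) : R :=
  ln (1 - q ^ (5 * i + 1)) + ln (1 - q ^ (5 * i + 4)) - (ln (1 - q ^ (5 * i + 3)) + ln (1 - q ^ (5 * i + 2))).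

Lemma ln_1m_pow_bound (q : R) (i k : nat) : 0 < q < 1 -> (S i <= k)%nat -> - (/ (1 - q) * q ^ S i) <= ln (1 - q ^ k) <= 0.
Proof.
  intros hq hk. assert (h1 := pow_le_pow q (S i) k hq hk). assert (h2 := pow_S_bounds q i hq).
  assert (h3 : 0 < q ^ k) by (apply pow_lt; lra). split.
  - eapply Rle_trans; [|apply ln_1m_ge with (r := q); lra].
    apply Ropp_le_contravar. unfold Rdiv. rewrite Rmult_comm. apply Rmult_le_compat_l; [left; apply Rinv_0_lt_compat; lra|exact h1].
  - rewrite <- ln_1. apply ln_le_mono; lra.
Qed.

Lemma summable_lfac (q : R) : 0 < q < 1 -> summable (lfac q).
Proof.
  intro hq. apply summable_dom with (fun i => 2 * (/ (1 - q) * q ^ S i)).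
  - intro i. unfold lfac.
    assert (b1 := ln_1m_pow_bound q i (5 * i + 1) hq ltac:(lia)). assert (b2 := ln_1m_pow_bound q i (5 * i + 2) hq ltac:(lia)).
    assert (b3 := ln_1m_pow_bound q i (5 * i + 3) hq ltac:(lia)). assert (b4 := ln_1m_pow_bound q i (5 * i + 4) hq ltac:(lia)).
    apply Rabs_le. lra.
  - apply summable_scal, summable_scal, summable_pow_S, hq.
Qed.

Lemma rprod_div (f g : nat -> R) (n : nat) : (forall i, g i <> 0) -> rprod (fun i => f i / g i) n = rprod f n / rprod g n.
Proof.
  intro hg. assert (h : forall n, rprod g n <> 0).
  { clear n. induction n as [|n IH]; cbn; [lra|]. apply Rmult_integral_contrapositive_currified; auto. }
  induction n as [|n IH]; cbn; [field|]. rewrite IH. field. split; [apply hg|apply h].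
Qed.

Lemma one_minus_pow_pos (q : R) (k : nat) : 0 < q < 1 -> (1 <= k)%nat -> 0 < 1 - q ^ k.
Proof. intros hq hk. assert (h := pow_le_pow q 1 k hq hk). rewrite pow_1 in h. lra. Qed.

Lemma exp_lfac (q : R) (i : nat) : 0 < q < 1 ->
  exp (lfac q i) = (1 - q ^ (5 * i + 1)) * (1 - q ^ (5 * i + 4)) / ((1 - q ^ (5 * i + 3)) * (1 - q ^ (5 * i + 2))).
Proof.
  intro hq. unfold lfac, Rminus. rewrite !exp_plus, exp_Ropp, exp_plus.
  rewrite !exp_ln by (apply one_minus_pow_pos; [exact hq|lia]). reflexivity.
Qed.

Lemma thB_div_thA (q : R) : 0 < q < 1 -> thB q / thA q = exp (Sum (lfac q)).
Proof.
  intro hq. destruct (thA_lim q hq) as [_ lA]. destruct (thB_lim q hq) as [_ lB].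
  assert (hA := thA_pos q hq). assert (hT := eulerT_pos _ (pow5_bounds q hq)).
  assert (pos := fun k hk => one_minus_pow_pos q k hq hk).
  assert (l : is_lim_seq (rprod (fun i => exp (lfac q i))) (exp (Sum (lfac q)))).
  { assert (k := rprod_lim (fun i => exp (lfac q i)) (fun i => exp_pos _)).
    assert (e : forall i, ln (exp (lfac q i)) = lfac q i) by (intro; apply ln_exp).
    cbv beta in k. replace (Sum (lfac q)) with (Sum (fun i => ln (exp (lfac q i)))) by (apply Sum_ext, e). apply k. apply summable_ext with (lfac q); [intro; rewrite e; reflexivity|apply summable_lfac, hq]. }
  symmetry. apply (is_lim_seq_uniq _ _ _ l).
  assert (li : is_lim_seq (fun n => / (rprod (fun i => (1 - q ^ (5 * i + 3)) * (1 - q ^ (5 * i + 2))) n * eulerT (q ^ 5))) (/ thA q)).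
  { apply (is_lim_seq_inv _ (thA q)); [exact lA|]. intro e. injection e. intro e2. lra. }
  eapply is_lim_seq_ext; [|exact (is_lim_seq_mult' _ _ _ _ lB li)].
  intro n. cbv beta. rewrite (rprod_ext (fun i => exp (lfac q i)) _ n (fun i => exp_lfac q i hq)).
    rewrite rprod_div.
    2:{ intro i. apply Rmult_integral_contrapositive_currified; apply Rgt_not_eq, pos; lia. }
    assert (0 < rprod (fun i => (1 - q ^ (5 * i + 3)) * (1 - q ^ (5 * i + 2))) n).
    { apply rprod_pos. intro i. apply Rmult_lt_0_compat; apply pos; lia. }
    field. split; apply Rgt_not_eq; assumption.
Qed.

Lemma RR_exp (q : R) : 0 < q < 1 -> RR q = exp (1 / 5 * ln q + Sum (lfac q)).
Proof. intro hq. rewrite RR_theta, thB_div_thA, exp_plus by exact hq. reflexivity. Qed.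

Definition dln (q : R) (k : nat) : R := - (INR k * q ^ pred k / (1 - q ^ k)).

Lemma dln_derive (q : R) (k : nat) : 0 < q < 1 -> (1 <= k)%nat -> is_derive (fun y => ln (1 - y ^ k)) q (dln q k).
Proof.
  intros hq hk. assert (h := one_minus_pow_pos q k hq hk). unfold dln. auto_derive; [exact h|]. field. lra.
Qed.

Lemma dln_bound (q r : R) (i k : nat) : 0 < q <= r -> r < 1 -> (S i <= k <= 5 * i + 4)%nat ->
  Rabs (dln q k) <= / (1 - r) * ((5 * INR i + 4) * r ^ i).
Proof.
  intros hq hr hk. unfold dln. rewrite Rabs_Ropp.
  assert (h := one_minus_pow_pos q k ltac:(lra) ltac:(lia)).
  assert (h2 := pow_le_pow q 1 k ltac:(lra) ltac:(lia)). rewrite pow_1 in h2.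
  assert (h3 : 0 <= INR k <= 5 * INR i + 4).
  { split; [apply pos_INR|]. replace (5 * INR i + 4) with (INR (5 * i + 4)) by (rewrite INR_prog; simpl; ring). apply le_INR; lia. }
  assert (h4 := pow_le_pow r i (pred k) ltac:(lra) ltac:(lia)).
  assert (h5 : 0 < q ^ pred k <= r ^ pred k) by (split; [apply pow_lt; lra|apply pow_incr; lra]).
  rewrite Rabs_pos_eq.
  2:{ apply Rmult_le_pos; [apply Rmult_le_pos; lra|left; apply Rinv_0_lt_compat; lra]. }
  unfold Rdiv. rewrite Rmult_comm. apply Rmult_le_compat; [left; apply Rinv_0_lt_compat; lra|apply Rmult_le_pos; lra|apply Rinv_le_contravar; lra|].
  apply Rmult_le_compat; lra.
Qed.

Lemma lam_dln (q : R) (k : nat) : 0 < q < 1 -> (1 <= k)%nat -> q * dln q k = - lam q k.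
Proof.
  intros hq hk. assert (h := one_minus_pow_pos q k hq hk). unfold dln, lam. destruct k as [|k]; [lia|]. simpl pred.
  simpl pow in *. field. lra.
Qed.

(** The logarithmic derivative of q^(1/5) B/A is (1/(5q)) (1 - 5 sum chi5) by the interchange of the
    Lambert series, and [chi5_sum] evaluates the bracket. *)
Lemma RR_derive (q : R) : 0 < q < 1 ->
  is_derive RR q (RR q / (5 * q) * (eulerT q ^ 5 / eulerT (q ^ 5))).
Proof.
  (* The neighbourhood of radius d stays inside (0, r) with r < 1, where one geometric majorant
     serves all y. *)
  intro hq. set (r := (1 + q) / 2). set (d := Rmin q ((1 - q) / 2)).
  assert (hd : 0 < d) by (unfold d; apply Rmin_glb_lt; lra).
  set (df := fun y i => dln y (5 * i + 1) + dln y (5 * i + 4) - (dln y (5 * i + 3) + dln y (5 * i + 2))).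
  assert (hS : is_derive (fun y => Sum (lfac y)) q (Sum (df q))).
  { apply (is_derive_Sum lfac df q d (fun i => 4 * (/ (1 - r) * ((5 * INR i + 4) * r ^ i)))); [exact hd| |apply summable_lfac, hq|].
    - apply summable_scal, summable_scal, summable_affine_pow. unfold r; lra.
    - intros y hy i. apply Rabs_def2 in hy.
      assert (d <= q) by apply Rmin_l. assert (d <= (1 - q) / 2) by apply Rmin_r.
      assert (hy0 : 0 < y <= r) by (unfold r; lra). assert (hy1 : 0 < y < 1) by (unfold r in hy0; lra). split.
      + unfold df, lfac. apply (is_derive_minus (V := R_NormedModule)); apply (is_derive_plus (V := R_NormedModule)); apply dln_derive; (exact hy1 || lia).
      + unfold df. assert (b1 := dln_bound y r i (5 * i + 1) hy0 ltac:(unfold r; lra) ltac:(lia)).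
        assert (b2 := dln_bound y r i (5 * i + 2) hy0 ltac:(unfold r; lra) ltac:(lia)).
        assert (b3 := dln_bound y r i (5 * i + 3) hy0 ltac:(unfold r; lra) ltac:(lia)).
        assert (b4 := dln_bound y r i (5 * i + 4) hy0 ltac:(unfold r; lra) ltac:(lia)).
        apply Rabs_le_between in b1, b2, b3, b4. apply Rabs_le. lra. }
  assert (e : q * Sum (df q) = - Sum (fun n => chi5 (q ^ S n))).
  { rewrite <- lambert_swap by exact hq.
    assert (b := fun k hk => dln_bound q q k hk).
    assert (hs : summable (df q)).
    { apply summable_dom with (fun i => 4 * (/ (1 - q) * ((5 * INR i + 4) * q ^ i))).
      - intro i. unfold df. assert (b1 := dln_bound q q i (5 * i + 1) ltac:(lra) ltac:(lra) ltac:(lia)).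
        assert (b2 := dln_bound q q i (5 * i + 2) ltac:(lra) ltac:(lra) ltac:(lia)).
        assert (b3 := dln_bound q q i (5 * i + 3) ltac:(lra) ltac:(lra) ltac:(lia)).
        assert (b4 := dln_bound q q i (5 * i + 4) ltac:(lra) ltac:(lra) ltac:(lia)).
        apply Rabs_le_between in b1, b2, b3, b4. apply Rabs_le. lra.
      - apply summable_scal, summable_scal, summable_affine_pow; lra. }
    rewrite (Sum_ext (fun i => lam q (5 * i + 1) + _ - _) (fun i => - q * df q i)).
    - rewrite Sum_scal by exact hs. ring.
    - intro i. unfold df. replace (lam q (5 * i + 1)) with (- (q * dln q (5 * i + 1))) by (rewrite lam_dln by (lia || exact hq); ring).
      replace (lam q (5 * i + 2)) with (- (q * dln q (5 * i + 2))) by (rewrite lam_dln by (lia || exact hq); ring).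
      replace (lam q (5 * i + 3)) with (- (q * dln q (5 * i + 3))) by (rewrite lam_dln by (lia || exact hq); ring).
      replace (lam q (5 * i + 4)) with (- (q * dln q (5 * i + 4))) by (rewrite lam_dln by (lia || exact hq); ring). ring. }
  rewrite <- chi5_sum by exact hq.
  assert (hloc : locally q (fun y => exp (1 / 5 * ln y + Sum (lfac y)) = RR y)).
  { exists (mkposreal d hd). intros y hy. change (Rabs (y - q) < d) in hy. apply Rabs_def2 in hy.
    assert (d <= q) by apply Rmin_l. assert (d <= (1 - q) / 2) by apply Rmin_r. symmetry. apply RR_exp. lra. }
  apply (is_derive_ext_loc _ _ _ _ hloc).
  rewrite RR_exp by exact hq.
  assert (k : is_derive (fun y => 1 / 5 * ln y + Sum (lfac y)) q (1 / 5 * / q + Sum (df q))).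
  { apply (is_derive_plus (V := R_NormedModule)); [|exact hS]. auto_derive; [lra|]. field. lra. }
  assert (k2 := is_derive_comp exp _ q _ _ (is_derive_exp _) k).
  replace (exp (1 / 5 * ln q + Sum (lfac q)) / (5 * q) * (1 - 5 * Sum (fun i => chi5 (q ^ S i)))) with
    (scal (1 / 5 * / q + Sum (df q)) (exp (1 / 5 * ln q + Sum (lfac q)))); [exact k2|].
  unfold scal; simpl; unfold mult; simpl.
  replace (Sum (fun i => chi5 (q * q ^ i))) with (- (q * Sum (df q))) by (rewrite e; simpl; ring). field. lra.
Qed.

(** * Theta constants and their duplication formulas *)

(** Natural exponents, unlike those of [theta]: the theta constants become power series that make
    sense and are differentiable at q = 0, where the limits below are read off. *)
Definition esq (j : Z) : nat := Z.to_nat (j * j).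

Definition epr (j : Z) : nat := Z.to_nat (j * j + j).

Definition thS (e : Z -> nat) (q : R) : R := Sum (fun j => q ^ e j).

Definition dthS (e : Z -> nat) (q : R) : R := Sum (fun j => INR (e j) * q ^ pred (e j)).

(** Growth conditions for termwise differentiation: the upper bound controls the factor [e j] of the
    derivative, the lower bounds give triangular decay of q^(e j) and of q^(e j - 1). *)
Definition thexp (e : Z -> nat) : Prop :=
  forall j, (Z.of_nat (e j) <= 2 * (j * j))%Z /\ (e j = O \/ (trin (Z.abs_nat j) <= pred (e j))%nat) /\ (trin (Z.abs_nat j) <= e j)%nat.

Lemma thexp_esq : thexp esq.
Proof.
  intro j. unfold esq. assert (h := trin_spec (Z.abs_nat j)). rewrite Zabs2Nat.id_abs in h.
  assert (Z.abs j * Z.abs j = j * j)%Z by (destruct (Z.abs_spec j) as [[_ ->]|[_ ->]]; lia).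
  assert (0 <= j * j)%Z by nia.
  split; [lia|]. split; [|lia]. destruct (Z.eq_dec j 0) as [->|hj]; [left; reflexivity|right]. nia.
Qed.

Lemma thexp_epr : thexp epr.
Proof.
  intro j. unfold epr. assert (h := trin_spec (Z.abs_nat j)). rewrite Zabs2Nat.id_abs in h.
  assert (Z.abs j * Z.abs j = j * j)%Z by (destruct (Z.abs_spec j) as [[_ ->]|[_ ->]]; lia).
  assert (0 <= j * j + j)%Z by nia.
  split; [nia|]. split; [|destruct (Z.abs_spec j); lia].
  destruct (Z.eq_dec j 0) as [->|hj]; [left; reflexivity|].
  destruct (Z.eq_dec j (-1)) as [->|hj1]; [left; reflexivity|right].
  destruct (Z.abs_spec j) as [[h1 h2]|[h1 h2]]; nia.
Qed.

Lemma Rabs_pow_le (q r : R) (m n : nat) : Rabs q <= r -> r < 1 -> (m <= n)%nat -> Rabs (q ^ n) <= r ^ m.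
Proof.
  intros hq hr h. pose proof (Rabs_pos q). rewrite <- RPow_abs.
  replace n with (m + (n - m))%nat by lia. rewrite pow_add.
  rewrite <- (Rmult_1_r (r ^ m)). apply Rmult_le_compat; try (apply pow_le; lra).
  - apply pow_incr; lra.
  - rewrite <- (pow1 (n - m)). apply pow_incr; lra.
Qed.

Lemma thS_bounds (e : Z -> nat) (r : R) : thexp e -> 0 <= r < 1 -> exists M, summable M /\
  forall q, Rabs q <= r -> forall j, Rabs (q ^ e j) <= M j /\ Rabs (INR (e j) * q ^ pred (e j)) <= M j.
Proof.
  (* The weight 4 absorbs the factor of the derivative: [e j] is at most 2 m^2, hence at most 2 *
     4^m, for m = |j|. *)
  intros he hr. destruct (pow_trin_bound 4 r ltac:(lra) hr) as [K [hK0 hK]].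
  exists (fun j => 2 * K * (1 / 2) ^ Z.abs_nat j). split; [apply summable_scal, summable_half_Z|].
  intros q hq j. destruct (he j) as [h1 [h2 h3]]. set (m := Z.abs_nat j) in *. specialize (hK m).
  assert (hr0 : 0 <= r ^ trin m) by (apply pow_le; lra).
  assert (h4 : 1 <= 4 ^ m) by (apply pow_R1_Rle; lra).
  split.
  - eapply Rle_trans; [apply (Rabs_pow_le q r (trin m)); [exact hq|lra|exact h3]|].
    assert (0 <= K * (1 / 2) ^ m) by (apply Rmult_le_pos; [exact hK0|apply pow_le; lra]). nra.
  - destruct h2 as [h2|h2].
    + rewrite h2. simpl. rewrite Rmult_0_l, Rabs_R0. apply Rmult_le_pos; [lra|apply pow_le; lra].
    + rewrite Rabs_mult. rewrite (Rabs_pos_eq (INR (e j))) by apply pos_INR.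
      assert (h5 := Rabs_pow_le q r (trin m) (pred (e j)) hq ltac:(lra) h2).
      assert (h6 : INR (e j) <= 2 * 4 ^ m).
      { assert (h7 : (Z.of_nat m * Z.of_nat m = j * j)%Z) by (unfold m; rewrite Zabs2Nat.id_abs; destruct (Z.abs_spec j) as [[_ ->]|[_ ->]]; lia).
        apply Rle_trans with (INR (2 * (m * m))); [apply le_INR; lia|].
        rewrite mult_INR. apply Rmult_le_compat_l; [simpl; lra|].
        clear. induction m as [|m IH]; [simpl; lra|]. rewrite mult_INR, S_INR in *. simpl pow.
        pose proof (pos_INR m). assert (INR m <= 4 ^ m).
        { clear IH. induction m as [|m IH]; [simpl; lra|]. rewrite S_INR in *. simpl pow. assert (1 <= 4 ^ m) by (apply pow_R1_Rle; lra).
          pose proof (pos_INR m). specialize (IH ltac:(lra)). lra. }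
        assert (1 <= 4 ^ m) by (apply pow_R1_Rle; lra). nra. }
      pose proof (pos_INR (e j)). pose proof (Rabs_pos (q ^ pred (e j))).
      apply Rle_trans with (2 * 4 ^ m * r ^ trin m); [apply Rmult_le_compat; lra|lra].
Qed.

Lemma thS_summable (e : Z -> nat) (q : R) : thexp e -> Rabs q < 1 -> summable (fun j => q ^ e j).
Proof.
  intros he hq. destruct (thS_bounds e (Rabs q) he ltac:(split; [apply Rabs_pos|exact hq])) as [M [hM hb]].
  apply summable_dom with M; [|exact hM]. intro j. apply hb. lra.
Qed.

Lemma thS_derive (e : Z -> nat) (q : R) : thexp e -> Rabs q < 1 -> is_derive (thS e) q (dthS e q).
Proof.
  intros he hq. set (r := (1 + Rabs q) / 2). pose proof (Rabs_pos q).
  destruct (thS_bounds e r he ltac:(unfold r; lra)) as [M [hM hb]].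
  apply (is_derive_Sum (fun y j => y ^ e j) (fun y j => INR (e j) * y ^ pred (e j)) q ((1 - Rabs q) / 2) M); [lra|exact hM|apply thS_summable; assumption|].
  intros y hy j. split.
  - auto_derive; [exact I|]. ring.
  - apply hb. replace y with (q + (y - q)) by ring. eapply Rle_trans; [apply Rabs_triang|]. unfold r; lra.
Qed.

Lemma thS_0 (e : Z -> nat) (L : list Z) : NoDup L -> (forall j, e j = O <-> In j L) -> thS e 0 = INR (length L).
Proof.
  intros n h. unfold thS.
  rewrite (Sum_unique _ (lsum (fun j => 0 ^ e j) L)).
  - assert (h2 : forall j, In j L -> e j = O) by (intro; apply h). clear h n.
    induction L as [|a L IH]; [reflexivity|]. cbn [lsum length]. rewrite S_INR, IH by (intros; apply h2; right; assumption).
    rewrite h2 by (left; reflexivity). simpl. ring.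
  - apply is_sum_finite; [exact n|]. intros j hj. apply pow_i. destruct (e j) eqn:E; [|lia]. exfalso; apply hj, h, E.
Qed.

Definition th3 (q : R) : R := thS esq q.

(* theta_2 = q^(1/4) psi. *)
Definition psi (q : R) : R := thS epr q.

Lemma th3_0 : th3 0 = 1.
Proof.
  unfold th3. rewrite (thS_0 esq (0%Z :: nil)); [reflexivity|constructor; [intros []|constructor]|].
  intro j. unfold esq. simpl. split; [intro; left; nia|intros [<-|[]]; reflexivity].
Qed.

Lemma psi_0 : psi 0 = 2.
Proof.
  unfold psi. rewrite (thS_0 epr (0%Z :: (-1)%Z :: nil)); [simpl; ring| |].
  - constructor; [intros [h|[]]; lia|constructor; [intros []|constructor]].
  - intro j. unfold epr. simpl. split; [intro; nia|intros [<-|[<-|[]]]; reflexivity].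
Qed.

Lemma zpow_RtoC_nat (q : R) (k : Z) : (0 <= k)%Z -> zpow q k = RtoC (q ^ Z.to_nat k).
Proof. intro h. rewrite <- (Z2Nat.id k h) at 1. rewrite zpow_nat, RtoC_pow. reflexivity. Qed.

Lemma zpow_1_l (k : Z) : zpow 1 k = 1.
Proof. destruct k; simpl; rewrite ?Cpow_1_l; try reflexivity. field. Qed.

Lemma theta_th3 (q : R) : theta (fun j => j * j)%Z 1 q = RtoC (th3 q).
Proof.
  unfold theta, th3, thS. rewrite <- Csum_RtoC. apply Csum_ext. intro j.
  rewrite zpow_1_l, zpow_RtoC_nat by nia. apply Cmult_1_l.
Qed.

Lemma theta_psi (q : R) : theta (fun j => j * j + j)%Z 1 q = RtoC (psi q).
Proof.
  unfold theta, psi, thS. rewrite <- Csum_RtoC. apply Csum_ext. intro j.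
  rewrite zpow_1_l, zpow_RtoC_nat by nia. apply Cmult_1_l.
Qed.

Lemma pow2_bounds (q : R) : 0 < q < 1 -> 0 < q ^ 2 < 1.
Proof. intro h. simpl. split; nra. Qed.

Lemma rprod_odd (q : R) (n : nat) : rpoch q (2 * n) = rprod (fun i => 1 - q ^ (2 * i + 1)) n * rpoch (q ^ 2) n.
Proof.
  induction n as [|n IH]; [cbn; ring|]. replace (2 * S n)%nat with (S (S (2 * n))) by lia. cbn [rpoch rprod].
  rewrite IH, <- pow_mult. replace (2 * S n)%nat with (S (S (2 * n))) by lia.
  replace (2 * n + 1)%nat with (S (2 * n)) by lia. ring.
Qed.

Lemma is_lim_seq_inv_pos (u : nat -> R) (l : R) : 0 < l -> is_lim_seq u l -> is_lim_seq (fun n => / u n) (/ l).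
Proof. intros hl h. apply (is_lim_seq_inv _ l); [exact h|]. intro e; injection e; lra. Qed.

Lemma rpoch_pos (q : R) (n : nat) : 0 < q < 1 -> 0 < rpoch q n.
Proof. intro hq. eapply Rlt_le_trans; [apply (qlow_pos q)|apply rpoch_low, hq]. Qed.

Lemma rprod_odd_lim (q : R) : 0 < q < 1 ->
  is_lim_seq (rprod (fun i => 1 - q ^ (2 * i + 1))) (eulerT q / eulerT (q ^ 2)).
Proof.
  intro hq. assert (h2 := pow2_bounds q hq).
  destruct (eulerT_lim q hq) as [_ l1]. destruct (eulerT_lim _ h2) as [_ l2].
  apply is_lim_seq_ext with (fun n => rpoch q (2 * n) * / rpoch (q ^ 2) n).
  - intro n. rewrite rprod_odd. field. apply Rgt_not_eq, rpoch_pos, h2.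
  - apply is_lim_seq_mult'; [apply (is_lim_seq_subseq _ _ _ (filterlim_mul_nat 2 ltac:(lia)) l1)|].
    apply is_lim_seq_inv_pos; [apply eulerT_pos, h2|exact l2].
Qed.

Lemma rprod_odd_plus_lim (q : R) : 0 < q < 1 ->
  is_lim_seq (rprod (fun i => 1 + q ^ (2 * i + 1))) (eulerT (q ^ 2) ^ 2 / (eulerT q * eulerT (q ^ 4))).
Proof.
  intro hq. assert (h2 := pow2_bounds q hq). assert (h4 := pow2_bounds _ h2).
  replace ((q ^ 2) ^ 2) with (q ^ 4) in h4 by ring.
  assert (p1 := eulerT_pos q hq). assert (p2 := eulerT_pos _ h2). assert (p4 := eulerT_pos _ h4).
  assert (l1 := rprod_odd_lim q hq). assert (l2 := rprod_odd_lim _ h2). replace ((q ^ 2) ^ 2) with (q ^ 4) in l2 by ring.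
  assert (l3 := is_lim_seq_inv_pos _ _ (Rdiv_lt_0_compat _ _ p1 p2) l1).
  assert (l := is_lim_seq_mult' _ _ _ _ l2 l3).
  replace (eulerT (q ^ 2) ^ 2 / (eulerT q * eulerT (q ^ 4))) with (eulerT (q ^ 2) / eulerT (q ^ 4) * / (eulerT q / eulerT (q ^ 2))).
  2:{ field. repeat split; apply Rgt_not_eq; assumption. }
  eapply is_lim_seq_ext; [|exact l]. intro n. cbv beta.
  assert (hp : forall i, 0 < 1 - q ^ (2 * i + 1)) by (intro i; apply one_minus_pow_pos; [exact hq|lia]).
  change (rprod (fun i => 1 - (q ^ 2) ^ (2 * i + 1)) n / rprod (fun i => 1 - q ^ (2 * i + 1)) n = rprod (fun i => 1 + q ^ (2 * i + 1)) n).
  rewrite <- rprod_div by (intro; apply Rgt_not_eq, hp). apply rprod_ext. intro i.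
  rewrite <- pow_mult. replace (2 * (2 * i + 1))%nat with ((2 * i + 1) + (2 * i + 1))%nat by lia. rewrite pow_add.
  specialize (hp i). field. lra.
Qed.

(** Jacobi's theta_4, taken as an eta quotient; [theta_th4] identifies it with the alternating
    series of squares. *)
Definition th4 (q : R) : R := eulerT q ^ 2 / eulerT (q ^ 2).

(** Because j^2 = 2 tri(j) - j, a series of squares is a triple product in base q^2. The sign s = 1
    or -1 treats theta_3 and theta_4 at once. *)
Lemma theta_square_tri (s : R) (q : R) : 0 < q < 1 -> s * s = 1 ->
  theta (fun j => j * j)%Z s q = theta tri (RtoC (s / q)) (RtoC (q ^ 2)).
Proof.
  intros hq hs. assert (hq0 : RtoC q <> 0) by (apply RtoC_neq0; lra).
  assert (hs0 : RtoC s <> 0) by (apply RtoC_neq0; nra).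
  apply theta_ext. intro j. rewrite zpow_RtoC_pow by lra. rewrite RtoC_div by lra. unfold Cdiv.
  rewrite zpow_mul_l, zpow_inv_l by (try apply Cinv_neq0; assumption).
  replace (Z.of_nat 2 * tri j)%Z with (j * j + j)%Z by (pose proof (tri_spec j); lia).
  rewrite zpow_add by exact hq0. field. apply zpow_neq0, hq0.
Qed.

Lemma theta_square_lim (s : R) (q : R) : 0 < q < 1 -> s * s = 1 ->
  theta (fun j => j * j)%Z s q = RtoC (Re (theta (fun j => j * j)%Z s q)) /\
  is_lim_seq (fun n => rprod (fun i => 1 + s * q ^ (2 * i + 1)) n * rprod (fun i => 1 + s * q ^ (2 * i + 1)) n * eulerT (q ^ 2)) (Re (theta (fun j => j * j)%Z s q)).
Proof.
  intros hq hs. rewrite theta_square_tri by assumption.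
  assert (hs0 : s <> 0) by nra.
  assert (hu : s / q <> 0) by (apply Rmult_integral_contrapositive_currified; [exact hs0|apply Rinv_neq_0_compat; lra]).
  destruct (triple_product_real (s / q) (q ^ 2) hu (pow2_bounds q hq)) as [h1 h2].
  split; [exact h1|]. eapply is_lim_seq_ext; [|exact h2]. intro n. cbv beta. f_equal. rewrite <- rprod_mult.
  apply rprod_ext. intro i. f_equal.
  - replace ((q ^ 2) ^ S i) with (q ^ (2 * i + 1) * q); [field; lra|].
    rewrite <- pow_mult. replace (2 * S i)%nat with (S (2 * i + 1)) by lia. simpl pow. ring.
  - rewrite <- pow_mult. rewrite pow_add. generalize (q ^ (2 * i)). intro p.
    assert (e : / s = s) by (apply Rmult_eq_reg_l with s; [rewrite Rinv_r by exact hs0; lra|exact hs0]).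
    unfold Rdiv. rewrite Rinv_mult, Rinv_inv, e. ring.
Qed.

Lemma th3_T (q : R) : 0 < q < 1 -> th3 q = eulerT (q ^ 2) ^ 5 / (eulerT q ^ 2 * eulerT (q ^ 4) ^ 2).
Proof.
  intro hq. destruct (theta_square_lim 1 q hq ltac:(ring)) as [_ h2]. rewrite theta_th3 in h2. simpl Re in h2.
  apply (is_lim_seq_uniq _ _ _ h2).
  assert (l := rprod_odd_plus_lim q hq).
  assert (h4 := pow2_bounds _ (pow2_bounds q hq)). replace ((q ^ 2) ^ 2) with (q ^ 4) in h4 by ring.
  replace (eulerT (q ^ 2) ^ 5 / (eulerT q ^ 2 * eulerT (q ^ 4) ^ 2)) with
    (eulerT (q ^ 2) ^ 2 / (eulerT q * eulerT (q ^ 4)) * (eulerT (q ^ 2) ^ 2 / (eulerT q * eulerT (q ^ 4))) * eulerT (q ^ 2)).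
  2:{ field. split; apply Rgt_not_eq, eulerT_pos; assumption. }
  eapply is_lim_seq_ext; [|exact (is_lim_seq_mult' _ _ _ _ (is_lim_seq_mult' _ _ _ _ l l) (is_lim_seq_const _))].
  intro n. cbv beta. f_equal. f_equal; apply rprod_ext; intro i; ring.
Qed.

Lemma theta_th4 (q : R) : 0 < q < 1 -> theta (fun j => j * j)%Z (RtoC (-1)) q = RtoC (th4 q).
Proof.
  intro hq. destruct (theta_square_lim (-1) q hq ltac:(ring)) as [h1 h2]. rewrite h1. f_equal.
  apply (is_lim_seq_uniq _ _ _ h2). assert (l := rprod_odd_lim q hq).
  unfold th4. replace (eulerT q ^ 2 / eulerT (q ^ 2)) with (eulerT q / eulerT (q ^ 2) * (eulerT q / eulerT (q ^ 2)) * eulerT (q ^ 2)).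
  2:{ field. apply Rgt_not_eq, eulerT_pos, pow2_bounds, hq. }
  eapply is_lim_seq_ext; [|exact (is_lim_seq_mult' _ _ _ _ (is_lim_seq_mult' _ _ _ _ l l) (is_lim_seq_const _))].
  intro n. cbv beta. f_equal. f_equal; apply rprod_ext; intro i; ring.
Qed.

Lemma rprod_plus_shift (x : R) (n : nat) : rprod (fun i => 1 + x ^ i) n * (1 + x ^ n) = 2 * rprod (fun i => 1 + x ^ S i) n.
Proof. induction n as [|n IH]; [cbn; ring|]. cbn [rprod]. rewrite IH. ring. Qed.

Lemma rpoch_plus (x : R) (n : nat) : rprod (fun i => 1 + x ^ S i) n * rpoch x n = rpoch (x ^ 2) n.
Proof.
  induction n as [|n IH]; [cbn; ring|]. cbn [rprod rpoch]. rewrite <- IH.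
  replace ((x ^ 2) ^ S n) with (x ^ S n * x ^ S n); [ring|]. rewrite <- pow_add, <- pow_mult. f_equal. lia.
Qed.

Lemma psi_T (q : R) : 0 < q < 1 -> psi q = 2 * eulerT (q ^ 4) ^ 2 / eulerT (q ^ 2).
Proof.
  intro hq. assert (h2 := pow2_bounds q hq). assert (h4 := pow2_bounds _ h2).
  assert (e4 : (q ^ 2) ^ 2 = q ^ 4) by ring.
  assert (p2 := eulerT_pos _ h2). assert (p4 := eulerT_pos _ h4).
  assert (e0 : theta (fun j => j * j + j)%Z 1 q = theta tri (RtoC 1) (RtoC (q ^ 2))).
  { apply theta_ext. intro j. rewrite zpow_RtoC_pow by lra. f_equal. f_equal. pose proof (tri_spec j). lia. }
  rewrite theta_psi in e0. destruct (triple_product_real 1 (q ^ 2) ltac:(lra) h2) as [_ hl]. rewrite <- e0 in hl. simpl Re in hl.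
  apply (is_lim_seq_uniq _ _ _ hl). set (x := q ^ 2) in *.
  destruct (eulerT_lim x h2) as [_ l1]. destruct (eulerT_lim _ h4) as [_ l2].
  assert (l3 : is_lim_seq (rprod (fun i => 1 + x ^ S i)) (eulerT (x ^ 2) * / eulerT x)).
  { apply is_lim_seq_ext with (fun n => rpoch (x ^ 2) n * / rpoch x n).
    - intro n. rewrite <- rpoch_plus. field. apply Rgt_not_eq, rpoch_pos, h2.
    - apply is_lim_seq_mult'; [exact l2|apply is_lim_seq_inv_pos; assumption]. }
  assert (l4 : is_lim_seq (fun n => / (1 + x ^ n)) (/ (1 + 0))).
  { apply is_lim_seq_inv_pos; [lra|]. apply is_lim_seq_plus'; [apply is_lim_seq_const|].
    apply is_lim_seq_geom. rewrite Rabs_pos_eq; lra. }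
  rewrite <- e4. replace (2 * eulerT (x ^ 2) ^ 2 / eulerT x) with
    (eulerT (x ^ 2) * / eulerT x * (2 * (eulerT (x ^ 2) * / eulerT x) * / (1 + 0)) * eulerT x) by (field; lra).
  eapply is_lim_seq_ext; [|exact (is_lim_seq_mult' _ _ _ _ (is_lim_seq_mult' _ _ _ _ l3
    (is_lim_seq_mult' _ _ _ _ (is_lim_seq_mult' _ _ _ _ (is_lim_seq_const 2) l3) l4)) (is_lim_seq_const (eulerT x)))].
  intro n. cbv beta. f_equal. rewrite <- rprod_plus_shift.
  assert (0 < x ^ n) by (apply pow_lt; lra).
  rewrite (rprod_ext (fun i => (1 + 1 * x ^ S i) * (1 + x ^ i / 1)) (fun i => (1 + x ^ S i) * (1 + x ^ i))) by (intro; field).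
  rewrite rprod_mult. field. lra.
Qed.

(** [theta_tri_mult] in base q^2 at u = v = s/q. There uv = q^(-2) turns the exponent j^2 + j into
    j^2, and j^2 into j^2 - j, which is pronic after j -> -j. *)
Lemma th3_sq (q s : R) : 0 < q < 1 -> s * s = 1 ->
  (theta (fun j => j * j)%Z s q * theta (fun j => j * j)%Z s q)%C = RtoC (th3 (q ^ 2) ^ 2 + s * (q * psi (q ^ 2) ^ 2)).
Proof.
  intros hq hs. rewrite theta_square_tri by assumption.
  assert (hs0 : s <> 0) by nra. assert (h2 := pow2_bounds q hq).
  assert (hu : s / q <> 0) by (apply Rmult_integral_contrapositive_currified; [exact hs0|apply Rinv_neq_0_compat; lra]).
  assert (hu' := RtoC_neq0 _ hu). assert (hx : RtoC (q ^ 2) <> 0) by (apply RtoC_neq0; lra).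
  assert (hq0 : RtoC q <> 0) by (apply RtoC_neq0; lra).
  assert (hx1 := Cmod_RtoC_lt1 _ h2).
  rewrite theta_tri_mult by assumption.
  assert (e1 : (RtoC (s / q) / RtoC (s / q))%C = RtoC 1) by (unfold Cdiv; apply Cinv_r, hu').
  assert (e2 : (RtoC (s / q) * RtoC (s / q))%C = RtoC (/ q ^ 2)).
  { rewrite <- RtoC_mult. f_equal. transitivity (s * s / q ^ 2); [field; lra|rewrite hs; field; lra]. }
  assert (e3 : (/ RtoC (s / q))%C = RtoC (s * q)).
  { rewrite <- RtoC_inv by exact hu. f_equal. transitivity (q * (s * s) / s); [rewrite hs|]; field; lra. }
  assert (ez : forall j, zpow (RtoC (/ q ^ 2)) j = zpow q (- (2 * j))).
  { intro j. rewrite RtoC_inv by lra. rewrite zpow_inv_l by exact hx. rewrite zpow_RtoC_pow by lra.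
    rewrite zpow_opp by exact hq0. reflexivity. }
  assert (f1 : theta (fun j => j * j + j)%Z (RtoC (/ q ^ 2)) (RtoC (q ^ 2)) = RtoC (th3 (q ^ 2))).
  { rewrite <- theta_th3. apply theta_ext. intro j. rewrite ez, !zpow_RtoC_pow, zpow_1_l by lra.
    rewrite <- zpow_add by exact hq0. rewrite Cmult_1_l. f_equal. lia. }
  assert (f2 : theta (fun j => j * j)%Z (RtoC (/ q ^ 2)) (RtoC (q ^ 2)) = RtoC (psi (q ^ 2))).
  { rewrite <- theta_psi. unfold theta. rewrite (Csum_opp (fun j => zpow 1 j * _)%C).
    - apply Csum_ext. intro j. rewrite ez, !zpow_RtoC_pow, zpow_1_l by lra.
      rewrite <- zpow_add by exact hq0. rewrite Cmult_1_l. f_equal. lia.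
    - apply (theta_summable 1 (RtoC (q ^ 2)) (fun j => j * j + j)%Z); [apply C1_nz|exact hx1|intro; apply le_pronic]. }
  rewrite e1, e2, e3, f1, f2, theta_th3, theta_psi. rewrite <- !RtoC_mult, <- RtoC_plus. f_equal. ring.
Qed.

Lemma th3_duplication (q : R) : 0 < q < 1 -> th3 q ^ 2 = th3 (q ^ 2) ^ 2 + q * psi (q ^ 2) ^ 2.
Proof.
  intro hq. assert (h := th3_sq q 1 hq ltac:(ring)). rewrite theta_th3, <- RtoC_mult in h.
  apply RtoC_inj in h. lra.
Qed.

Lemma th4_duplication (q : R) : 0 < q < 1 -> th4 q ^ 2 = th3 (q ^ 2) ^ 2 - q * psi (q ^ 2) ^ 2.
Proof.
  intro hq. assert (h := th3_sq q (-1) hq ltac:(ring)). rewrite theta_th4, <- RtoC_mult in h by exact hq.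
  apply RtoC_inj in h. lra.
Qed.

Lemma th3_th4 (q : R) : 0 < q < 1 -> th3 q * th4 q = th4 (q ^ 2) ^ 2.
Proof.
  intro hq. assert (h2 := pow2_bounds q hq). assert (h4 := pow2_bounds _ h2).
  rewrite th3_T by exact hq. unfold th4. replace ((q ^ 2) ^ 2) with (q ^ 4) in * by ring.
  assert (p1 := eulerT_pos q hq). assert (p2 := eulerT_pos _ h2). assert (p4 := eulerT_pos _ h4). field. repeat split; apply Rgt_not_eq; assumption.
Qed.

Lemma th3_pos (q : R) : 0 < q < 1 -> 0 < th3 q.
Proof.
  intro hq. assert (h2 := pow2_bounds q hq). assert (h4 := pow2_bounds _ h2). replace ((q ^ 2) ^ 2) with (q ^ 4) in * by ring.
  rewrite th3_T by exact hq. apply Rdiv_lt_0_compat; [|apply Rmult_lt_0_compat]; apply pow_lt, eulerT_pos; assumption.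
Qed.

Lemma th4_pos (q : R) : 0 < q < 1 -> 0 < th4 q.
Proof. intro hq. apply Rdiv_lt_0_compat; [apply pow_lt|]; apply eulerT_pos; [|apply pow2_bounds]; exact hq. Qed.

Lemma psi_pos (q : R) : 0 < q < 1 -> 0 < psi q.
Proof.
  intro hq. assert (h2 := pow2_bounds q hq). assert (h4 := pow2_bounds _ h2). replace ((q ^ 2) ^ 2) with (q ^ 4) in * by ring.
  rewrite psi_T by exact hq. apply Rdiv_lt_0_compat; [apply Rmult_lt_0_compat; [lra|apply pow_lt]|]; apply eulerT_pos; assumption.
Qed.

(** * The modulus and its complement as functions of the nome *)

Definition kq (q : R) : R := sqrt q * psi q ^ 2 / th3 q ^ 2.

Definition kpq (q : R) : R := th4 q ^ 2 / th3 q ^ 2.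

Lemma kq_pos (q : R) : 0 < q < 1 -> 0 < kq q.
Proof.
  intro hq. apply Rdiv_lt_0_compat; [apply Rmult_lt_0_compat; [apply sqrt_lt_R0; lra|]|]; apply pow_lt; [apply psi_pos|apply th3_pos]; exact hq.
Qed.

Lemma kpq_pos (q : R) : 0 < q < 1 -> 0 < kpq q.
Proof. intro hq. apply Rdiv_lt_0_compat; apply pow_lt; [apply th4_pos|apply th3_pos]; exact hq. Qed.

Lemma kq_landen (q : R) : 0 < q < 1 -> kq (q ^ 2) = (1 - kpq q) / (1 + kpq q).
Proof.
  intro hq. assert (p3 := th3_pos q hq). assert (p4 := th4_pos q hq). assert (p3' := th3_pos _ (pow2_bounds q hq)).
  unfold kq, kpq. rewrite sqrt_pow2 by lra.
  transitivity ((th3 q ^ 2 - th4 q ^ 2) / (th3 q ^ 2 + th4 q ^ 2)).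
  - rewrite (th3_duplication q hq), (th4_duplication q hq).
    assert (0 < th3 (q ^ 2) ^ 2) by (apply pow_lt; exact p3'). set (a := th3 (q ^ 2)) in *. set (b := q * psi (q ^ 2) ^ 2).
    field. split; nra.
  - assert (0 < th3 q ^ 2) by (apply pow_lt; lra). assert (0 < th4 q ^ 2) by (apply pow_lt; lra). field. split; nra.
Qed.

Lemma kpq_landen (q : R) : 0 < q < 1 -> kpq (q ^ 2) ^ 2 * (1 + kpq q) ^ 2 = 4 * kpq q.
Proof.
  intro hq. assert (p3 := th3_pos q hq). assert (p4 := th4_pos q hq). assert (p3' := th3_pos _ (pow2_bounds q hq)).
  unfold kpq. rewrite <- th3_th4 by exact hq.
  assert (e : th3 (q ^ 2) ^ 2 = (th3 q ^ 2 + th4 q ^ 2) / 2) by (rewrite (th3_duplication q hq), (th4_duplication q hq); field).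
  rewrite e. assert (0 < th3 q ^ 2) by (apply pow_lt; lra). assert (0 < th4 q ^ 2) by (apply pow_lt; lra). field. split; nra.
Qed.

(** Jacobi's identity theta_2^4 + theta_4^4 = theta_3^4, read off from the two Landen formulas at
    sqrt q: (1-c)^2 + 4c = (1+c)^2. *)
Lemma kq_kpq (q : R) : 0 < q < 1 -> kq q ^ 2 + kpq q ^ 2 = 1.
Proof.
  intro hq. set (p := sqrt q). assert (hp : 0 < p < 1).
  { unfold p. split; [apply sqrt_lt_R0; lra|]. rewrite <- sqrt_1. apply sqrt_lt_1; lra. }
  assert (ep : p ^ 2 = q) by (unfold p; simpl; rewrite Rmult_1_r; apply sqrt_sqrt; lra).
  rewrite <- ep. rewrite kq_landen by exact hp. assert (h := kpq_landen p hp). assert (h2 := kpq_pos p hp).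
  apply Rmult_eq_reg_r with ((1 + kpq p) ^ 2); [|apply pow_nonzero; lra].
  rewrite Rmult_plus_distr_r, h. field. lra.
Qed.

Lemma kq_bounds (q : R) : 0 < q < 1 -> 0 < kq q < 1 /\ kpq q = sqrt (1 - kq q ^ 2).
Proof.
  intro hq. assert (h := kq_kpq q hq). assert (p1 := kq_pos q hq). assert (p2 := kpq_pos q hq). split.
  - split; [exact p1|]. assert (0 < kpq q ^ 2) by (apply pow_lt; exact p2). nra.
  - rewrite <- (sqrt_pow2 (kpq q)) by lra. f_equal. lra.
Qed.

(** The logarithmic derivative q k'(q)/k(q): the 1/2 comes from sqrt q, the rest from
    psi^2/theta_3^2. *)
Definition Lq (q : R) : R := 1 / 2 + 2 * q * (dthS epr q / psi q - dthS esq q / th3 q).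

Lemma kq_derive (q : R) : 0 < q < 1 -> is_derive kq q (kq q * Lq q / q).
Proof.
  intro hq. assert (ha : Rabs q < 1) by (rewrite Rabs_pos_eq; lra).
  assert (d1 := thS_derive esq q thexp_esq ha). assert (d2 := thS_derive epr q thexp_epr ha).
  fold th3 in d1. fold psi in d2. assert (p3 := th3_pos q hq). assert (p2 := psi_pos q hq).
  assert (ps : 0 < sqrt q) by (apply sqrt_lt_R0; lra).
  change (is_derive th3 q (dthS esq q)) in d1. change (is_derive psi q (dthS epr q)) in d2.
  unfold kq. auto_derive.
  - repeat split; try lra; [exists (dthS epr q); exact d2|exists (dthS esq q); exact d1|nra].
  - replace (Derive (fun x : R => th3 x) q) with (dthS esq q) by (symmetry; apply is_derive_unique; exact d1).
    replace (Derive (fun x : R => psi x) q) with (dthS epr q) by (symmetry; apply is_derive_unique; exact d2).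
    unfold Lq. set (a := psi q) in *. set (b := th3 q) in *. set (da := dthS epr q). set (db := dthS esq q).
    set (s := sqrt q) in *. assert (es : q = s * s) by (unfold s; rewrite sqrt_sqrt; lra).
    rewrite es. field. lra.
Qed.

(** [kq_landen] is an identity of functions near q, so both of its sides can be differentiated; with
    the complement written as sqrt(1 - k^2), only the derivative of [kq] is needed. *)
Lemma Lq_landen (q : R) : 0 < q < 1 -> Lq (q ^ 2) = Lq q / kpq q.
Proof.
  intro hq. assert (h2 := pow2_bounds q hq).
  assert (d1 := kq_derive q hq). assert (d2 := kq_derive _ h2).
  destruct (kq_bounds q hq) as [hk ekp]. assert (pk := kpq_pos q hq).
  assert (hkk : 0 < 1 - kq q ^ 2) by nra.
  assert (e1 : is_derive (fun y => kq (y ^ 2)) q (2 * q * (kq (q ^ 2) * Lq (q ^ 2) / q ^ 2))).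
  { apply (is_derive_comp kq (fun y => y ^ 2) q _ _ d2). auto_derive; [exact I|]. ring. }
  assert (e2 : is_derive (fun y => (1 - sqrt (1 - kq y ^ 2)) / (1 + sqrt (1 - kq y ^ 2))) q
     (2 * kq q * (kq q * Lq q / q) / (kpq q * (1 + kpq q) ^ 2))).
  { auto_derive.
    - repeat split; try (exists (kq q * Lq q / q); exact d1); try lra.
      replace (1 + - (kq q * (kq q * 1))) with (1 - kq q ^ 2) by ring. rewrite <- ekp. lra.
    - replace (1 + - (kq q * (kq q * 1))) with (1 - kq q ^ 2) by ring.
      replace (Derive (fun x : R => kq x) q) with (kq q * Lq q / q) by (symmetry; apply is_derive_unique; exact d1). rewrite <- ekp. field. lra. }
  assert (loc : locally q (fun y => (1 - sqrt (1 - kq y ^ 2)) / (1 + sqrt (1 - kq y ^ 2)) = kq (y ^ 2))).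
  { assert (hd : 0 < Rmin q (1 - q)) by (apply Rmin_glb_lt; lra).
    exists (mkposreal _ hd). intros y hy. change (Rabs (y - q) < Rmin q (1 - q)) in hy. apply Rabs_def2 in hy.
    assert (Rmin q (1 - q) <= q) by apply Rmin_l. assert (Rmin q (1 - q) <= 1 - q) by apply Rmin_r.
    assert (hy1 : 0 < y < 1) by lra. rewrite kq_landen by exact hy1. destruct (kq_bounds y hy1) as [_ <-]. reflexivity. }
  apply (is_derive_ext_loc _ _ _ _ loc) in e2.
  apply is_derive_unique in e1, e2. assert (e3 := eq_trans (eq_sym e1) e2). clear e1 e2.
  rename e3 into e2. rewrite (kq_landen q hq) in e2.
  assert (hkk2 : kq q ^ 2 = (1 - kpq q) * (1 + kpq q)) by (assert (k := kq_kpq q hq); lra).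
  assert (hlt : 0 < 1 - kpq q). { assert (0 < kq q ^ 2) by (apply pow_lt; lra). nra. }
  apply Rmult_eq_reg_l with (2 * q * ((1 - kpq q) / (1 + kpq q)) / q ^ 2).
  2:{ apply Rgt_not_eq. apply Rdiv_lt_0_compat; [|apply pow_lt; lra]. apply Rmult_lt_0_compat; [lra|]. apply Rdiv_lt_0_compat; lra. }
  transitivity (2 * q * ((1 - kpq q) / (1 + kpq q) * Lq (q ^ 2) / q ^ 2)); [field; lra|]. rewrite e2.
  transitivity (2 * kq q ^ 2 * Lq q / (q * (kpq q * (1 + kpq q) ^ 2))).
  - field. split; [lra|split; lra].
  - rewrite hkk2. field. split; [lra|split; lra].
Qed.

(** * Iteration of q -> q^2 *)

Fixpoint qsq (q : R) (n : nat) : R := match n with O => q | S n' => qsq q n' ^ 2 end.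

Lemma qsq_bounds (q : R) (n : nat) : 0 < q < 1 -> 0 < qsq q n <= q ^ S n.
Proof.
  intro hq. induction n as [|n [I1 I2]]; [simpl; lra|]. cbn [qsq].
  assert (h := pow_S_bounds q n hq).
  assert (e : qsq q n ^ 2 <= q ^ S n * q ^ S n) by (replace (qsq q n ^ 2) with (qsq q n * qsq q n) by ring; apply Rmult_le_compat; lra).
  split; [apply pow_lt; exact I1|]. change (q ^ S (S n)) with (q * q ^ S n).
  eapply Rle_trans; [exact e|]. apply Rmult_le_compat_r; lra.
Qed.

Lemma qsq_unit (q : R) (n : nat) : 0 < q < 1 -> 0 < qsq q n < 1.
Proof. intro hq. assert (h := qsq_bounds q n hq). assert (h2 := pow_S_bounds q n hq). lra. Qed.

Lemma qsq_lim (q : R) : 0 < q < 1 -> is_lim_seq (qsq q) 0.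
Proof.
  intro hq. apply is_lim_seq_le_le with (fun _ => 0) (fun n => q ^ S n).
  - intro n. assert (h := qsq_bounds q n hq). lra.
  - apply is_lim_seq_const.
  - apply (is_lim_seq_incr_1 (fun n => q ^ n)). apply is_lim_seq_geom. rewrite Rabs_pos_eq; lra.
Qed.

Lemma thS_qsq_lim (e : Z -> nat) (q : R) : thexp e -> 0 < q < 1 -> is_lim_seq (fun n => thS e (qsq q n)) (thS e 0).
Proof.
  intros he hq. apply (is_lim_seq_continuous (thS e) (qsq q) 0); [|apply qsq_lim, hq].
  apply continuity_pt_filterlim. apply (ex_derive_continuous (thS e)). exists (dthS e 0). apply thS_derive; [exact he|].
  rewrite Rabs_R0; lra.
Qed.

Lemma qsq_dthS_lim (e : Z -> nat) (q : R) : thexp e -> 0 < q < 1 -> is_lim_seq (fun n => qsq q n * dthS e (qsq q n)) 0.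
Proof.
  intros he hq. destruct (thS_bounds e q he ltac:(lra)) as [M [hM hb]].
  apply is_lim_seq_abs_0. apply is_lim_seq_le_le with (fun _ => 0) (fun n => qsq q n * Sum M).
  - intro n. split; [apply Rabs_pos|]. assert (h := qsq_bounds q n hq). assert (h2 := pow_S_bounds q n hq).
    rewrite Rabs_mult, (Rabs_pos_eq (qsq q n)) by lra. apply Rmult_le_compat_l; [lra|].
    apply Rabs_Sum_le; [|exact hM]. intro j. apply hb. rewrite Rabs_pos_eq; lra.
  - apply is_lim_seq_const.
  - replace (Finite 0) with (Finite (0 * Sum M)) by (f_equal; ring). apply is_lim_seq_mult'; [apply qsq_lim, hq|apply is_lim_seq_const].
Qed.

(* The quotient 2 Lq / th4^4 is invariant under q -> q^2, hence equal to its limit 1 at 0. *)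
Lemma Lq_th4 (q : R) : 0 < q < 1 -> Lq q = th4 q ^ 4 / 2.
Proof.
  intro hq.
  assert (inv : forall n, 2 * Lq (qsq q n) / th4 (qsq q n) ^ 4 = 2 * Lq q / th4 q ^ 4).
  { induction n as [|n IH]; [reflexivity|]. cbn [qsq]. rewrite <- IH. assert (hn := qsq_unit q n hq).
    set (p := qsq q n) in *. rewrite Lq_landen by exact hn.
    assert (e : th4 (p ^ 2) ^ 4 = th4 p ^ 4 / kpq p).
    { assert (k := th3_th4 p hn). replace (th4 (p ^ 2) ^ 4) with ((th4 (p ^ 2) ^ 2) ^ 2) by ring. rewrite <- k.
      unfold kpq. assert (p3 := th3_pos p hn). assert (p4 := th4_pos p hn). field. lra. }
    rewrite e. assert (p4 := th4_pos p hn). assert (pk := kpq_pos p hn). field. lra. }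
  assert (l3 := thS_qsq_lim esq q thexp_esq hq). assert (l2 := thS_qsq_lim epr q thexp_epr hq).
  fold (th3 0) in l3. fold (psi 0) in l2. rewrite th3_0 in l3. rewrite psi_0 in l2.
  assert (m3 := qsq_dthS_lim esq q thexp_esq hq). assert (m2 := qsq_dthS_lim epr q thexp_epr hq).
  assert (lL : is_lim_seq (fun n => Lq (qsq q n)) (1 / 2)).
  { replace (Finite (1 / 2)) with (Finite (1 / 2 + 2 * (0 * / 2 - 0 * / 1))) by (f_equal; field).
    apply is_lim_seq_ext with (fun n => 1 / 2 + 2 * (qsq q n * dthS epr (qsq q n) * / psi (qsq q n) - qsq q n * dthS esq (qsq q n) * / th3 (qsq q n))).
    - intro n. unfold Lq. field. assert (hn := qsq_unit q n hq). assert (p3 := th3_pos _ hn). assert (p2 := psi_pos _ hn). split; apply Rgt_not_eq; assumption.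
    - apply is_lim_seq_plus'; [apply is_lim_seq_const|]. apply is_lim_seq_mult'; [apply is_lim_seq_const|].
      apply is_lim_seq_minus'; apply is_lim_seq_mult'; try assumption; apply is_lim_seq_inv_pos; try assumption; lra. }
  assert (l4 : is_lim_seq (fun n => th4 (qsq q n) ^ 4) 1).
  (* [th4] is an eta quotient with no series at hand at 0, so its limit is taken from the
     duplication formulas: th4(p)^2 = 2 th3(p^2)^2 - th3(p)^2. *)
  { apply is_lim_seq_ext with (fun n => (2 * (th3 (qsq q (S n)) * th3 (qsq q (S n))) - th3 (qsq q n) * th3 (qsq q n)) * (2 * (th3 (qsq q (S n)) * th3 (qsq q (S n))) - th3 (qsq q n) * th3 (qsq q n))).
    - intro n. cbn [qsq]. assert (hn := qsq_unit q n hq). set (p := qsq q n) in *.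
      assert (e : th4 p ^ 2 = 2 * (th3 (p ^ 2) * th3 (p ^ 2)) - th3 p * th3 p).
      { assert (e1 := th3_duplication p hn). assert (e2 := th4_duplication p hn). simpl in *. lra. }
      rewrite <- e. ring.
    - assert (l3S : is_lim_seq (fun n => th3 (qsq q (S n))) 1) by (apply (is_lim_seq_incr_1 (fun n => th3 (qsq q n))); exact l3).
      replace (Finite 1) with (Finite ((2 * (1 * 1) - 1 * 1) * (2 * (1 * 1) - 1 * 1))) by (f_equal; ring).
      assert (l : is_lim_seq (fun n => 2 * (th3 (qsq q (S n)) * th3 (qsq q (S n))) - th3 (qsq q n) * th3 (qsq q n)) (2 * (1 * 1) - 1 * 1)).
      { apply is_lim_seq_minus'; [apply is_lim_seq_mult'; [apply is_lim_seq_const|]|]; apply is_lim_seq_mult'; assumption. }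
      apply is_lim_seq_mult'; exact l. }
  assert (l : is_lim_seq (fun n => 2 * Lq (qsq q n) / th4 (qsq q n) ^ 4) (2 * (1 / 2) * / 1)).
  { apply is_lim_seq_mult'; [apply is_lim_seq_mult'; [apply is_lim_seq_const|exact lL]|apply is_lim_seq_inv_pos; [lra|exact l4]]. }
  assert (l' : is_lim_seq (fun n => 2 * Lq (qsq q n) / th4 (qsq q n) ^ 4) (2 * Lq q / th4 q ^ 4)).
  { eapply is_lim_seq_ext; [intro n; symmetry; apply inv|apply is_lim_seq_const]. }
  assert (e := is_lim_seq_uniq _ _ _ l l'). assert (p4 := th4_pos q hq).
  assert (0 < th4 q ^ 4) by (apply pow_lt; exact p4).
  transitivity (2 * Lq q / th4 q ^ 4 * (th4 q ^ 4 / 2)); [field; lra|]. rewrite <- e. field.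
Qed.

Lemma kq_eulerT (q : R) : 0 < q < 1 -> kq q / kpq q ^ 2 * th4 q ^ 12 = 4 * sqrt q * eulerT q ^ 12.
Proof.
  intro hq. assert (h2 := pow2_bounds q hq). assert (h4 := pow2_bounds _ h2). replace ((q ^ 2) ^ 2) with (q ^ 4) in h4 by ring.
  assert (p1 := eulerT_pos q hq). assert (p2 := eulerT_pos _ h2). assert (p4 := eulerT_pos _ h4).
  unfold kq, kpq. rewrite th3_T, psi_T by exact hq. unfold th4. field. repeat split; apply Rgt_not_eq; assumption.
Qed.

(** * The elliptic singular modulus *)

Lemma sqrt_lt_one (x : R) : 0 <= x < 1 -> sqrt x < 1.
Proof. intro h. assert (k := sqrt_lt_1 x 1 ltac:(lra) ltac:(lra) ltac:(lra)). rewrite sqrt_1 in k. exact k. Qed.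

Definition ellf (k th : R) : R := / sqrt (1 - k ^ 2 * sin th ^ 2).

Lemma ellf_arg (k th : R) : 0 <= k < 1 -> 1 - k ^ 2 <= 1 - k ^ 2 * sin th ^ 2 <= 1 /\ 0 < 1 - k ^ 2.
Proof.
  intro hk. pose proof (SIN_bound th). assert (0 <= k ^ 2 < 1) by (simpl; nra). assert (0 <= sin th ^ 2 <= 1) by (simpl; nra). nra.
Qed.

Lemma ellf_continuous (k th : R) : 0 <= k < 1 -> continuous (ellf k) th.
Proof.
  intro hk. destruct (ellf_arg k th hk) as [h1 h2]. apply (ex_derive_continuous (ellf k)). unfold ellf. auto_derive.
  replace (1 + - (k * (k * 1) * (sin th * (sin th * 1)))) with (1 - k ^ 2 * sin th ^ 2) by ring.
  split; [lra|]. split; [|exact I]. apply Rgt_not_eq, sqrt_lt_R0. lra.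
Qed.

Lemma ellf_ex_RInt (k a b : R) : 0 <= k < 1 -> ex_RInt (ellf k) a b.
Proof. intro hk. apply (ex_RInt_continuous (V := R_CompleteNormedModule)). intros; apply ellf_continuous, hk. Qed.

Lemma ellK_ellf (k : R) : ellK k = RInt (ellf k) 0 (PI / 2).
Proof. reflexivity. Qed.

Lemma ellK_bounds (k : R) : 0 <= k < 1 -> PI / 2 <= ellK k <= PI / 2 / sqrt (1 - k ^ 2).
Proof.
  intro hk. rewrite ellK_ellf. pose proof PI_RGT_0. split.
  - replace (PI / 2) with (RInt (fun _ => 1) 0 (PI / 2)) at 1 by (rewrite RInt_const; unfold scal; simpl; unfold mult; simpl; ring).
    apply RInt_le; [lra|apply ex_RInt_const|apply ellf_ex_RInt, hk|]. intros x hx.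
    destruct (ellf_arg k x hk). unfold ellf. rewrite <- Rinv_1 at 1. apply Rinv_le_contravar; [apply sqrt_lt_R0; lra|].
    apply Rle_trans with (sqrt 1); [apply sqrt_le_1; lra|rewrite sqrt_1; lra].
  - replace (PI / 2 / sqrt (1 - k ^ 2)) with (RInt (fun _ => / sqrt (1 - k ^ 2)) 0 (PI / 2)) by (rewrite RInt_const; unfold scal; simpl; unfold mult; simpl; unfold Rdiv; ring).
    apply RInt_le; [lra|apply ellf_ex_RInt, hk|apply ex_RInt_const|]. intros x hx.
    destruct (ellf_arg k x hk). unfold ellf. apply Rinv_le_contravar; [apply sqrt_lt_R0; lra|].
    apply sqrt_le_1; lra.
Qed.

Lemma ellK_pos (k : R) : 0 <= k < 1 -> 0 < ellK k.
Proof. intro hk. destruct (ellK_bounds k hk). pose proof PI_RGT_0. lra. Qed.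

Lemma ellK_increasing (k l : R) : 0 <= k < l -> l < 1 -> ellK k < ellK l.
Proof.
  intros hk hl. rewrite !ellK_ellf. pose proof PI_RGT_0. apply RInt_lt; [lra| | |].
  - intros; apply ellf_continuous; lra.
  - intros; apply ellf_continuous; lra.
  - intros x hx. destruct (ellf_arg k x ltac:(lra)). destruct (ellf_arg l x ltac:(lra)).
    assert (hs : 0 < sin x) by (apply sin_gt_0; lra). assert (0 < sin x ^ 2) by (apply pow_lt; exact hs).
    assert (k ^ 2 < l ^ 2) by (simpl; nra). unfold ellf. apply Rinv_lt_contravar.
    + apply Rmult_lt_0_compat; apply sqrt_lt_R0; lra.
    + apply sqrt_lt_1; nra.
Qed.

Lemma ellf_RInt_derive (k x : R) : 0 <= k < 1 -> is_derive (fun y => RInt (ellf k) 0 y) x (ellf k x).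
Proof.
  intro hk. apply (is_derive_RInt (ellf k) (fun y => RInt (ellf k) 0 y) 0 x).
  - apply filter_forall. intro y. exact (RInt_correct (V := R_CompleteNormedModule) (ellf k) 0 y (ellf_ex_RInt k 0 y hk)).
  - apply ellf_continuous, hk.
Qed.

(* Landen's substitution psi = phi + atan (k' tan phi), in the variable t = tan phi. *)
Lemma landen_integrand (c t : R) : 0 < c <= 1 ->
  ellf ((1 - c) / (1 + c)) (atan t + atan (c * t)) * (/ (1 + t ^ 2) + c / (1 + (c * t) ^ 2)) =
  (1 + c) * (ellf (sqrt (1 - c ^ 2)) (atan t) * / (1 + t ^ 2)).
Proof.
  intro hc. unfold ellf.
  assert (hc2 : 0 <= 1 - c ^ 2) by (simpl; nra).
  assert (es : sqrt (1 - c ^ 2) ^ 2 = 1 - c ^ 2) by (apply pow2_sqrt; exact hc2).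
  rewrite es, sin_plus, !cos_atan, !sin_atan. unfold Rsqr.
  set (u := 1 + t * t). set (v := 1 + c * t * (c * t)).
  assert (hu : 0 < u) by (unfold u; nra). assert (hv : 0 < v) by (unfold v; nra).
  assert (su : 0 < sqrt u) by (apply sqrt_lt_R0; exact hu). assert (sv : 0 < sqrt v) by (apply sqrt_lt_R0; exact hv).
  assert (qu : sqrt u ^ 2 = u) by (apply pow2_sqrt; lra).
  assert (qv : sqrt v ^ 2 = v) by (apply pow2_sqrt; lra).
  assert (e1 : 1 - ((1 - c) / (1 + c)) ^ 2 * (t / sqrt u * (1 / sqrt v) + 1 / sqrt u * (c * t / sqrt v)) ^ 2 = ((1 + c * t ^ 2) / (sqrt u * sqrt v)) ^ 2).
  { transitivity (1 - (1 - c) ^ 2 * t ^ 2 / (sqrt u ^ 2 * sqrt v ^ 2)); [field; lra|].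
    transitivity ((1 + c * t ^ 2) ^ 2 / (sqrt u ^ 2 * sqrt v ^ 2)); [|field; lra].
    rewrite qu, qv. apply Rmult_eq_reg_r with (u * v); [|nra]. field_simplify; [|lra|lra]. unfold u, v. ring. }
  assert (e2 : 1 - (1 - c ^ 2) * (t / sqrt u) ^ 2 = (sqrt v / sqrt u) ^ 2).
  { transitivity (1 - (1 - c ^ 2) * t ^ 2 / sqrt u ^ 2); [field; lra|].
    transitivity (sqrt v ^ 2 / sqrt u ^ 2); [|field; lra]. rewrite qu, qv.
    apply Rmult_eq_reg_r with u; [|lra]. field_simplify; [|lra|lra]. unfold u, v. ring. }
  rewrite e1, e2. assert (hp : 0 < 1 + c * t ^ 2) by (simpl; nra).
  rewrite !sqrt_pow2.
  - replace (1 + t ^ 2) with u by (unfold u; ring). replace (1 + (c * t) ^ 2) with v by (unfold v; ring).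
    assert (e3 : / u + c / v = (1 + c) * (1 + c * t ^ 2) / (sqrt u ^ 2 * sqrt v ^ 2)).
    { rewrite qu, qv. apply Rmult_eq_reg_r with (u * v); [|nra]. field_simplify; [|lra|lra]. unfold u, v. ring. }
    rewrite e3. replace (/ u) with (/ sqrt u ^ 2) by (rewrite qu; reflexivity). field. lra.
  - left. apply Rdiv_lt_0_compat; assumption.
  - left. apply Rdiv_lt_0_compat; [exact hp|]. apply Rmult_lt_0_compat; assumption.
Qed.

Lemma ellf_PI (k : R) : 0 <= k < 1 -> RInt (ellf k) 0 PI = 2 * ellK k.
Proof.
  intro hk. rewrite ellK_ellf.
  rewrite <- (RInt_Chasles (ellf k) 0 (PI / 2) PI) by (apply ellf_ex_RInt, hk).
  assert (e : RInt (ellf k) (PI / 2) PI = RInt (ellf k) 0 (PI / 2)).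
  { assert (h := RInt_comp_lin (ellf k) (-1) PI 0 (PI / 2)).
    replace (-1 * 0 + PI) with PI in h by ring. replace (-1 * (PI / 2) + PI) with (PI / 2) in h by field.
    specialize (h (ellf_ex_RInt k _ _ hk)).
    rewrite <- (opp_RInt_swap (V := R_CompleteNormedModule) (ellf k) (PI / 2) PI) in h by (apply ellf_ex_RInt, hk).
    assert (e2 : RInt (fun y => scal (-1) (ellf k (-1 * y + PI))) 0 (PI / 2) = opp (RInt (ellf k) 0 (PI / 2))).
    { rewrite <- (RInt_opp (V := R_CompleteNormedModule)) by (apply ellf_ex_RInt, hk). apply RInt_ext. intros x _.
      unfold ellf. replace (-1 * x + PI) with (PI - x) by ring. rewrite sin_PI_x.
      unfold scal, opp; simpl; unfold mult; simpl. ring. }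
    assert (h' := eq_trans (eq_sym e2) h). unfold opp in h'; simpl in h'. lra. }
  rewrite e. unfold plus; simpl. ring.
Qed.

(** As t = tan phi goes from 0 to infinity, phi reaches pi/2 while phi + atan(c t) reaches pi. The
    left integral thus covers [0, pi] and equals 2K. [G] is the difference of the two sides up to t;
    by [landen_integrand] its derivative is zero. *)
Lemma landen_K (c : R) : 0 < c < 1 -> 2 * ellK ((1 - c) / (1 + c)) = (1 + c) * ellK (sqrt (1 - c ^ 2)).
Proof.
  intro hc. set (k1 := (1 - c) / (1 + c)). set (k := sqrt (1 - c ^ 2)).
  assert (hk1 : 0 <= k1 < 1).
  { unfold k1. split; [apply Rlt_le, Rdiv_lt_0_compat; lra|]. apply Rmult_lt_reg_r with (1 + c); [lra|]. field_simplify; lra. }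
  assert (hk : 0 <= k < 1).
  { unfold k. split; [apply sqrt_pos|]. apply sqrt_lt_one. simpl; nra. }
  set (G := fun t => RInt (ellf k1) 0 (atan t + atan (c * t)) - (1 + c) * RInt (ellf k) 0 (atan t)).
  assert (hG : forall t, is_derive G t 0).
  { intro t. replace 0 with (((/ (1 + t ^ 2) + c / (1 + (c * t) ^ 2)) * ellf k1 (atan t + atan (c * t))) - (1 + c) * (/ (1 + t ^ 2) * ellf k (atan t))).
    2:{ assert (h := landen_integrand c t ltac:(lra)). fold k1 in h. fold k in h. lra. }
    apply (is_derive_minus (V := R_NormedModule)).
    - apply (is_derive_comp (fun y => RInt (ellf k1) 0 y) (fun t => atan t + atan (c * t))); [apply ellf_RInt_derive, hk1|].
      apply (is_derive_plus (V := R_NormedModule)).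
      + replace (1 + t ^ 2) with (1 + Rsqr t) by (unfold Rsqr; ring). apply is_derive_atan.
      + unfold Rdiv. apply (is_derive_comp atan (fun t => c * t)).
        * replace (1 + (c * t) ^ 2) with (1 + Rsqr (c * t)) by (unfold Rsqr; ring). apply is_derive_atan.
        * auto_derive; [exact I|ring].
    - apply is_derive_scal. apply (is_derive_comp (fun y => RInt (ellf k) 0 y) atan); [apply ellf_RInt_derive, hk|].
      replace (1 + t ^ 2) with (1 + Rsqr t) by (unfold Rsqr; ring). apply is_derive_atan. }
  assert (hG0 : forall t, 0 < t -> G t = 0).
  { intros t ht. transitivity (G 0).
    - symmetry. apply (eq_is_derive (V := R_NormedModule) G 0 t); [|exact ht]. intros s _. apply hG.
    - unfold G. rewrite Rmult_0_r, atan_0, Rplus_0_r, !RInt_point. unfold zero; simpl. ring. }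
  assert (la : forall m, is_lim_seq (fun n => PI / 2 - atan (hseq n * m)) (PI / 2)).
  { intro m. replace (Finite (PI / 2)) with (Finite (PI / 2 - atan (0 * m))) by (rewrite Rmult_0_l, atan_0; f_equal; ring).
    apply is_lim_seq_minus'; [apply is_lim_seq_const|].
    apply (is_lim_seq_continuous atan); [apply derivable_continuous_pt, derivable_pt_atan|].
    apply is_lim_seq_mult'; [apply hseq_lim|apply is_lim_seq_const]. }
  assert (ct : forall kk x, 0 <= kk < 1 -> continuity_pt (fun y => RInt (ellf kk) 0 y) x).
  { intros kk x hkk. apply continuity_pt_filterlim. apply (ex_derive_continuous (fun y => RInt (ellf kk) 0 y)).
    exists (ellf kk x). apply ellf_RInt_derive, hkk. }
  assert (l1 : is_lim_seq (fun n => RInt (ellf k1) 0 (PI / 2 - atan (hseq n * 1) + (PI / 2 - atan (hseq n * / c)))) (RInt (ellf k1) 0 (PI / 2 + PI / 2))).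
  { apply (is_lim_seq_continuous (fun y => RInt (ellf k1) 0 y)); [apply ct, hk1|]. apply is_lim_seq_plus'; apply la. }
  assert (l2 : is_lim_seq (fun n => (1 + c) * RInt (ellf k) 0 (PI / 2 - atan (hseq n * 1))) ((1 + c) * RInt (ellf k) 0 (PI / 2))).
  { apply is_lim_seq_mult'; [apply is_lim_seq_const|].
    apply (is_lim_seq_continuous (fun y => RInt (ellf k) 0 y)); [apply ct, hk|]. apply la. }
  replace (PI / 2 + PI / 2) with PI in l1 by field. rewrite ellf_PI in l1 by exact hk1. rewrite <- ellK_ellf in l2.
  apply (is_lim_seq_uniq _ _ _ l1). eapply is_lim_seq_ext; [|exact l2].
  (* The upper limit t is sent to infinity as 1/h; atan(1/h) = pi/2 - atan h replaces it by a limit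
     at h = 0. *)
  intro n. cbv beta. assert (hn := hseq_bounds n). assert (g := hG0 (/ hseq n) ltac:(apply Rinv_0_lt_compat; lra)).
  unfold G in g. replace (c * / hseq n) with (/ (hseq n * / c)) in g by (field; lra).
  rewrite !atan_inv in g; [|apply Rmult_lt_0_compat; [lra|apply Rinv_0_lt_compat; lra]|lra].
  rewrite Rmult_1_r. lra.
Qed.

(* The integrand 1/D is compared with sin x / D, which has the elementary primitive A. *)
Lemma ellK_compl_bounds (k : R) : 0 < k < 1 ->
  (ln (1 + sqrt (1 - k ^ 2)) - ln k) / sqrt (1 - k ^ 2) <= ellK (sqrt (1 - k ^ 2)) <=
  (ln (1 + sqrt (1 - k ^ 2)) - ln k + PI / 2) / sqrt (1 - k ^ 2).
Proof.
  intro hk. set (m := sqrt (1 - k ^ 2)). assert (hk2 : 0 < k ^ 2 < 1) by (simpl; nra).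
  assert (hm : 0 < m < 1).
  { unfold m. split; [apply sqrt_lt_R0; lra|]. apply sqrt_lt_one. lra. }
  assert (em : m ^ 2 = 1 - k ^ 2) by (unfold m; apply pow2_sqrt; lra).
  pose proof PI_RGT_0.
  set (D := fun x => sqrt (1 - m ^ 2 * sin x ^ 2)).
  assert (hD : forall x, 0 < D x) by (intro x; destruct (ellf_arg m x ltac:(lra)); apply sqrt_lt_R0; lra).
  assert (hD2 : forall x, D x ^ 2 = 1 - m ^ 2 * sin x ^ 2).
  { intro x. destruct (ellf_arg m x ltac:(lra)). unfold D. rewrite <- Rsqr_pow2. apply Rsqr_sqrt. lra. }
  assert (hsc : forall x, D x ^ 2 = k ^ 2 + m ^ 2 * cos x ^ 2).
  { intro x. rewrite hD2. assert (h := sin2_cos2 x). unfold Rsqr in h. replace (sin x ^ 2) with (1 - cos x ^ 2) by (simpl; lra). lra. }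
  set (A := fun x => - ln (m * cos x + D x) / m).
  assert (hpos : forall x, 0 < m * cos x + D x).
  { intro x. assert (m ^ 2 * cos x ^ 2 < D x ^ 2) by (rewrite hsc; lra). specialize (hD x).
    destruct (Rlt_le_dec 0 (m * cos x + D x)); [assumption|]. exfalso.
    assert (D x * D x <= (m * cos x) * (m * cos x)) by nra. simpl in *. lra. }
  assert (hA : forall x, is_derive A x (sin x / D x)).
  { intro x. unfold A, D. assert (k1 := hpos x). assert (k2 := hD x). assert (k3 := hD2 x). unfold D in k1, k2, k3. destruct (ellf_arg m x ltac:(lra)).
    auto_derive.
    - replace (1 + - (m * (m * 1) * (sin x * (sin x * 1)))) with (1 - m ^ 2 * sin x ^ 2) by ring. split; [lra|]. split; [exact k1|]. lra.
    - replace (1 + - (m * (m * 1) * (sin x * (sin x * 1)))) with (1 - m ^ 2 * sin x ^ 2) by ring.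
      set (d := sqrt (1 - m ^ 2 * sin x ^ 2)) in *. field. lra. }
  assert (cD : forall x, continuous (fun x => sin x / D x) x).
  { intro x. assert (k2 := hD x). destruct (ellf_arg m x ltac:(lra)). apply (ex_derive_continuous (fun x => sin x / D x)). unfold D in *. auto_derive.
    replace (1 + - (m * (m * 1) * (sin x * (sin x * 1)))) with (1 - m ^ 2 * sin x ^ 2) by ring. split; [lra|]. split; [lra|exact I]. }
  assert (hI := is_RInt_derive (V := R_CompleteNormedModule) A (fun x => sin x / D x) 0 (PI / 2) (fun x _ => hA x) (fun x _ => cD x)).
  assert (eA : minus (A (PI / 2)) (A 0) = (ln (1 + m) - ln k) / m).
  { unfold A, D, minus, plus, opp; simpl. rewrite cos_PI2, sin_PI2, cos_0, sin_0.
    replace (1 - m * (m * 1) * (0 * (0 * 1))) with 1 by ring. rewrite sqrt_1.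
    replace (1 - m * (m * 1) * (1 * (1 * 1))) with (k ^ 2) by (simpl in *; lra). rewrite sqrt_pow2 by lra.
    rewrite Rmult_0_r, Rplus_0_l, Rmult_1_r, (Rplus_comm m 1). field. lra. }
  assert (vI := eq_trans (is_RInt_unique _ _ _ _ hI) eA).
  assert (exI : ex_RInt (fun x => sin x / D x) 0 (PI / 2)) by (eexists; exact hI).
  rewrite ellK_ellf. split.
  - rewrite <- vI. apply RInt_le; [lra|exact exI|apply ellf_ex_RInt; lra|].
    intros x hx. unfold ellf. fold (D x). pose proof (SIN_bound x). unfold Rdiv. rewrite <- (Rmult_1_l (/ D x)) at 2.
    apply Rmult_le_compat_r; [left; apply Rinv_0_lt_compat, hD|lra].
  - replace ((ln (1 + m) - ln k + PI / 2) / m) with (plus ((ln (1 + m) - ln k) / m) (RInt (fun _ => / m) 0 (PI / 2))).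
    2:{ rewrite RInt_const. unfold plus, scal; simpl; unfold mult; simpl. field. lra. }
    rewrite <- vI. rewrite <- (RInt_plus (V := R_CompleteNormedModule)); [|exact exI|apply ex_RInt_const].
    apply RInt_le; [lra|apply ellf_ex_RInt; lra|apply (ex_RInt_plus (V := R_NormedModule)); [exact exI|apply ex_RInt_const]|].
    intros x hx. unfold plus; simpl. unfold ellf. fold (D x).
    assert (hs : 0 < sin x) by (apply sin_gt_0; lra). assert (hc : 0 < cos x) by (apply cos_gt_0; lra).
    assert (hsc1 := sin2_cos2 x). unfold Rsqr in hsc1. assert (hdx := hD x). specialize (hsc x).
    (* These give m (1 - sin x) <= m cos x <= D x, so 1/D exceeds sin x/D by at most 1/m;
       integration yields the error (pi/2)/m. *)
    assert (h1 : m * cos x <= D x).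
    { apply Rnot_lt_le. intro hl. assert (D x * D x < (m * cos x) * (m * cos x)) by nra. simpl in hsc. nra. }
    assert (h2 : 1 - sin x <= cos x).
    { apply Rnot_lt_le. intro hl. assert (cos x * cos x < (1 - sin x) * (1 - sin x)) by nra. nra. }
    assert (h3 : m * (1 - sin x) <= D x) by nra.
    apply Rmult_le_reg_r with (m * D x); [nra|]. field_simplify; lra.
Qed.

Lemma kpq_lt1 (q : R) : 0 < q < 1 -> 0 < kpq q < 1 /\ sqrt (1 - kpq q ^ 2) = kq q.
Proof.
  intro hq. assert (h := kq_kpq q hq). assert (p1 := kq_pos q hq). assert (p2 := kpq_pos q hq).
  assert (0 < kq q ^ 2) by (apply pow_lt; exact p1). split; [split; [exact p2|nra]|].
  rewrite <- (sqrt_pow2 (kq q)) by lra. f_equal. lra.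
Qed.

(** * The ratio K'/K as a function of the nome *)

Definition Kratio (q : R) : R := ellK (kpq q) / ellK (kq q).

(** Landen's transformation used twice: at c = k'(q) it relates K(q^2) to K(q), at c = k(q^2) it
    relates K'(q) to K'(q^2). The common factor 1 + k'(q) cancels and 2 remains. *)
Lemma Kratio_sq (q : R) : 0 < q < 1 -> Kratio (q ^ 2) = 2 * Kratio q.
Proof.
  intro hq. assert (h2 := pow2_bounds q hq). destruct (kpq_lt1 q hq) as [hc es]. destruct (kpq_lt1 _ h2) as [hc2 es2].
  destruct (kq_bounds q hq) as [hk ek]. destruct (kq_bounds _ h2) as [hk2 ek2].
  assert (l1 := landen_K (kpq q) hc). rewrite es, <- kq_landen in l1 by exact hq.
  assert (l2 := landen_K (kq (q ^ 2)) hk2). rewrite <- ek2 in l2.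
  assert (e : (1 - kq (q ^ 2)) / (1 + kq (q ^ 2)) = kpq q) by (rewrite kq_landen by exact hq; field; lra).
  rewrite e in l2. assert (e2 : 1 + kq (q ^ 2) = 2 / (1 + kpq q)) by (rewrite kq_landen by exact hq; field; lra).
  rewrite e2 in l2.
  assert (a1 := ellK_pos (kq q) ltac:(lra)). assert (a2 := ellK_pos (kq (q ^ 2)) ltac:(lra)).
  unfold Kratio.
  assert (f1 : ellK (kpq (q ^ 2)) = (1 + kpq q) * ellK (kpq q)).
  { apply Rmult_eq_reg_l with (2 / (1 + kpq q)); [rewrite <- l2; field; lra|]. apply Rgt_not_eq, Rdiv_lt_0_compat; lra. }
  assert (f2 : ellK (kq (q ^ 2)) = (1 + kpq q) / 2 * ellK (kq q)) by lra.
  rewrite f1, f2. field. lra.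
Qed.

(** The quotient k/sqrt q along the iteration; its finite positive limit shows that ln k behaves
    like (1/2) ln q. *)
Definition kcoef (q : R) (n : nat) : R := psi (qsq q n) * psi (qsq q n) * / (th3 (qsq q n) * th3 (qsq q n)).

Lemma kcoef_lim (q : R) : 0 < q < 1 -> is_lim_seq (kcoef q) (2 * 2 * / (1 * 1)).
Proof.
  intro hq. assert (l3 := thS_qsq_lim esq q thexp_esq hq). assert (l2 := thS_qsq_lim epr q thexp_epr hq).
  change (is_lim_seq (fun n => th3 (qsq q n)) (th3 0)) in l3. change (is_lim_seq (fun n => psi (qsq q n)) (psi 0)) in l2.
  rewrite th3_0 in l3. rewrite psi_0 in l2. unfold kcoef.
  apply is_lim_seq_mult'; [apply is_lim_seq_mult'; exact l2|]. apply is_lim_seq_inv_pos; [lra|]. apply is_lim_seq_mult'; exact l3.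
Qed.

Lemma kq_qsq (q : R) (n : nat) : 0 < q < 1 -> 0 < kcoef q n /\ kq (qsq q n) = sqrt (qsq q n) * kcoef q n.
Proof.
  intro hq. assert (hn := qsq_unit q n hq). assert (p3 := th3_pos _ hn). assert (p2 := psi_pos _ hn). unfold kcoef. split.
  - apply Rmult_lt_0_compat; [nra|]. apply Rinv_0_lt_compat; nra.
  - unfold kq. field. lra.
Qed.

Lemma kq_qsq_lim (q : R) : 0 < q < 1 -> is_lim_seq (fun n => kq (qsq q n)) 0.
Proof.
  intro hq. assert (ls : is_lim_seq (fun n => sqrt (qsq q n)) 0).
  { rewrite <- sqrt_0. apply (is_lim_seq_continuous sqrt); [apply continuity_pt_filterlim, continuous_sqrt|apply qsq_lim, hq]. }
  eapply is_lim_seq_ext; [intro n; symmetry; apply (kq_qsq q n hq)|].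
  replace (Finite 0) with (Finite (0 * (2 * 2 * / (1 * 1)))) by (f_equal; ring).
  apply is_lim_seq_mult'; [exact ls|apply kcoef_lim, hq].
Qed.

(** Along q^(2^n) the complementary integral K' grows like -ln k, that is -(1/2) ln q, and K tends
    to pi/2, so the constant is 1/pi. A bounded error in K' is harmless because it is divided by -ln
    q, which tends to infinity. *)
Lemma Kratio_ln (q : R) : 0 < q < 1 -> Kratio q = - ln q / PI.
Proof.
  intro hq. assert (hpi := PI_RGT_0).
  assert (lnneg : forall p, 0 < p < 1 -> 0 < - ln p) by (intros p hp; assert (ln p < ln 1) by (apply ln_increasing; lra); rewrite ln_1 in *; lra).
  assert (inv : forall n, Kratio (qsq q n) * / - ln (qsq q n) = Kratio q * / - ln q).
  { induction n as [|n IH]; [reflexivity|]. cbn [qsq]. rewrite <- IH. assert (hn := qsq_unit q n hq).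
    rewrite Kratio_sq by exact hn. rewrite ln_pow by lra. assert (h := lnneg _ hn). simpl INR. field. lra. }
  set (Ln := fun n => - ln (qsq q n)).
  assert (hLn : forall n, 0 < Ln n) by (intro n; apply lnneg, qsq_unit, hq).
  assert (lLinv : is_lim_seq (fun n => / Ln n) 0).
  { assert (eL : forall n, Ln n = 2 ^ n * - ln q).
    { unfold Ln. induction n as [|n IH]; [simpl; ring|]. cbn [qsq]. rewrite ln_pow by (apply qsq_unit, hq). simpl INR. simpl pow.
      transitivity (2 * - ln (qsq q n)); [ring|]. rewrite IH. ring. }
    apply is_lim_seq_ext with (fun n => (1 / 2) ^ n * / - ln q).
    - intro n. rewrite eL. rewrite Rinv_mult, <- pow_inv. f_equal. f_equal. field.
    - replace (Finite 0) with (Finite (0 * / - ln q)) by (f_equal; ring). apply is_lim_seq_mult'; [|apply is_lim_seq_const].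
      apply is_lim_seq_geom. rewrite Rabs_pos_eq; lra. }
  set (C := kcoef q). assert (lC := kcoef_lim q hq : is_lim_seq C (2 * 2 * / (1 * 1))).
  assert (hC : forall n, 0 < C n) by (intro n; apply (kq_qsq q n hq)).
  assert (ek : forall n, kq (qsq q n) = sqrt (qsq q n) * C n) by (intro n; apply (kq_qsq q n hq)).
  assert (lk := kq_qsq_lim q hq).
  assert (lkp : is_lim_seq (fun n => kpq (qsq q n)) 1).
  { apply is_lim_seq_ext with (fun n => sqrt (1 - kq (qsq q n) * kq (qsq q n))).
    - intro n. destruct (kq_bounds _ (qsq_unit q n hq)) as [_ ->]. f_equal. ring.
    - replace (Finite 1) with (Finite (sqrt (1 - 0 * 0))) by (rewrite Rmult_0_r, Rminus_0_r, sqrt_1; reflexivity).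
      apply (is_lim_seq_continuous sqrt); [apply continuity_pt_filterlim, continuous_sqrt|].
      apply is_lim_seq_minus'; [apply is_lim_seq_const|]. apply is_lim_seq_mult'; exact lk. }
  assert (cln : forall (u : nat -> R) l, 0 < l -> is_lim_seq u l -> is_lim_seq (fun n => ln (u n)) (ln l)).
  { intros u l hl hu. apply (is_lim_seq_continuous ln); [|exact hu]. apply derivable_continuous_pt. exists (/ l). apply derivable_pt_lim_ln, hl. }
  set (E := fun n => ln (1 + kpq (qsq q n)) - ln (C n)).
  assert (lE : is_lim_seq E (ln (1 + 1) - ln (2 * 2 * / (1 * 1)))).
  { apply is_lim_seq_minus'; apply cln; try lra; [|exact lC]. apply is_lim_seq_plus'; [apply is_lim_seq_const|exact lkp]. }
  assert (bnd : forall n, (E n * / Ln n + 1 / 2) * / kpq (qsq q n) <= ellK (kpq (qsq q n)) * / Ln n <= (E n * / Ln n + 1 / 2 + PI / 2 * / Ln n) * / kpq (qsq q n)).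
  { intro n. assert (hn := qsq_unit q n hq). destruct (kq_bounds _ hn) as [hk e]. assert (b := ellK_compl_bounds _ hk). rewrite <- e in b.
    assert (el : ln (kq (qsq q n)) = - (1 / 2) * Ln n + ln (C n)).
    { rewrite ek, ln_mult by (try apply sqrt_lt_R0; try apply hC; lra). f_equal. rewrite <- Rpower_sqrt by lra. unfold Rpower. rewrite ln_exp. unfold Ln. field. }
    rewrite el in b. assert (hl := hLn n). assert (hkp := kpq_pos _ hn).
    assert (hi : 0 < / Ln n) by (apply Rinv_0_lt_compat; exact hl).
    destruct b as [b1 b2]. apply (Rmult_le_compat_r (/ Ln n)) in b1; [|lra]. apply (Rmult_le_compat_r (/ Ln n)) in b2; [|lra].
    split.
    - eapply Rle_trans; [apply Req_le|exact b1]. unfold E. field. lra.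
    - eapply Rle_trans; [exact b2|apply Req_le]. unfold E. field. lra. }
  assert (l1' : is_lim_seq (fun n => ellK (kpq (qsq q n)) * / Ln n) (1 / 2)).
  { assert (lEL := is_lim_seq_mult' _ _ _ _ lE lLinv). rewrite Rmult_0_r in lEL.
    assert (lki := is_lim_seq_inv_pos _ _ Rlt_0_1 lkp).
    apply is_lim_seq_le_le with (1 := bnd).
    - replace (Finite (1 / 2)) with (Finite ((0 + 1 / 2) * / 1)) by (f_equal; field).
      apply is_lim_seq_mult'; [|exact lki]. apply is_lim_seq_plus'; [exact lEL|apply is_lim_seq_const].
    - replace (Finite (1 / 2)) with (Finite ((0 + 1 / 2 + PI / 2 * 0) * / 1)) by (f_equal; field).
      apply is_lim_seq_mult'; [|exact lki]. apply is_lim_seq_plus'; [apply is_lim_seq_plus'; [exact lEL|apply is_lim_seq_const]|].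
      apply is_lim_seq_mult'; [apply is_lim_seq_const|exact lLinv]. }
  assert (lK : is_lim_seq (fun n => ellK (kq (qsq q n))) (PI / 2)).
  { apply is_lim_seq_le_le with (fun _ => PI / 2) (fun n => PI / 2 * / kpq (qsq q n)).
    - intro n. destruct (kq_bounds _ (qsq_unit q n hq)) as [hk e]. rewrite e. apply (ellK_bounds (kq (qsq q n))). lra.
    - apply is_lim_seq_const.
    - replace (Finite (PI / 2)) with (Finite (PI / 2 * / 1)) by (f_equal; field).
      apply is_lim_seq_mult'; [apply is_lim_seq_const|apply is_lim_seq_inv_pos; [lra|exact lkp]]. }
  assert (lR : is_lim_seq (fun n => Kratio (qsq q n) * / - ln (qsq q n)) (1 / 2 * / (PI / 2))).
  { eapply is_lim_seq_ext; [|exact (is_lim_seq_mult' _ _ _ _ l1' (is_lim_seq_inv_pos _ (PI / 2) ltac:(lra) lK))].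
    intro n. cbv beta. unfold Kratio, Ln, Rdiv. ring. }
  assert (lR' : is_lim_seq (fun n => Kratio (qsq q n) * / - ln (qsq q n)) (Kratio q * / - ln q)).
  { eapply is_lim_seq_ext; [intro n; symmetry; apply inv|apply is_lim_seq_const]. }
  assert (e := is_lim_seq_uniq _ _ _ lR lR'). assert (hl := lnneg q hq).
  transitivity (Kratio q * / - ln q * - ln q); [field; lra|]. rewrite <- e. field. lra.
Qed.

Lemma exp_PI_sqrt_bounds (r : R) : 0 < r -> 0 < exp (- PI * sqrt r) < 1.
Proof.
  intro hr. split; [apply exp_pos|]. assert (hs : 0 < sqrt r) by (apply sqrt_lt_R0; exact hr). pose proof PI_RGT_0.
  apply Rlt_le_trans with (exp 0); [apply exp_increasing; nra|rewrite exp_0; lra].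
Qed.

Lemma k_sing_exp (r : R) : 0 < r -> k_sing r = kq (exp (- PI * sqrt r)).
Proof.
  intro hr. assert (hs : 0 < sqrt r) by (apply sqrt_lt_R0; exact hr). assert (hpi := PI_RGT_0).
  set (q := exp (- PI * sqrt r)).
  assert (hq : 0 < q < 1) by (apply exp_PI_sqrt_bounds, hr).
  destruct (kq_bounds q hq) as [hk ek].
  assert (ex : ellK (sqrt (1 - kq q ^ 2)) / ellK (kq q) = sqrt r).
  { rewrite <- ek. change (Kratio q = sqrt r). rewrite Kratio_ln by exact hq. unfold q. rewrite ln_exp. field. lra. }
  assert (spec : 0 < k_sing r < 1 /\ ellK (sqrt (1 - k_sing r ^ 2)) / ellK (k_sing r) = sqrt r).
  { unfold k_sing. apply epsilon_spec. exists (kq q). split; [exact hk|exact ex]. }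
  destruct spec as [h1 h2].
  assert (mono : forall a b, 0 < a < b -> b < 1 -> ellK (sqrt (1 - b ^ 2)) / ellK b < ellK (sqrt (1 - a ^ 2)) / ellK a).
  { intros a b ha hb. assert (a ^ 2 < b ^ 2) by (simpl; nra). assert (0 < a ^ 2) by (apply pow_lt; lra). assert (b ^ 2 < 1) by (simpl; nra).
    assert (i1 := ellK_increasing a b ltac:(lra) hb).
    assert (hb2 : sqrt (1 - a ^ 2) < 1) by (apply sqrt_lt_one; lra).
    assert (i2 := ellK_increasing (sqrt (1 - b ^ 2)) (sqrt (1 - a ^ 2)) (conj (sqrt_pos _) (sqrt_lt_1 (1 - b ^ 2) (1 - a ^ 2) ltac:(lra) ltac:(lra) ltac:(lra))) hb2).
    assert (pa := ellK_pos a ltac:(lra)). assert (pb := ellK_pos (sqrt (1 - b ^ 2)) ltac:(split; [apply sqrt_pos|apply sqrt_lt_one; lra])).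
    apply Rlt_trans with (ellK (sqrt (1 - b ^ 2)) / ellK a).
    - apply Rmult_lt_compat_l; [exact pb|]. apply Rinv_lt_contravar; [nra|exact i1].
    - apply Rmult_lt_compat_r; [apply Rinv_0_lt_compat; exact pa|exact i2]. }
  destruct (Rtotal_order (k_sing r) (kq q)) as [h|[h|h]]; [exfalso|exact h|exfalso].
  - assert (m := mono _ _ (conj (proj1 h1) h) (proj2 hk)). lra.
  - assert (m := mono _ _ (conj (proj1 hk) h) (proj2 h1)). lra.
Qed.

(** * The hypergeometric side and the integral of F1 *)

Definition pser (a : nat -> R) (z : R) : R := Sum (fun n => a n * z ^ n).

Definition dpser (a : nat -> R) (z : R) : R := Sum (fun n => a n * (INR n * z ^ pred n)).

Lemma summable_INR_pow_pred (r : R) : 0 < r < 1 -> summable (fun n => INR n * r ^ pred n).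
Proof.
  intro hr. apply summable_ext with (fun n => / r * (INR n * r ^ n)).
  - intros [|n]; [simpl; ring|]. simpl pred. simpl pow. field. lra.
  - apply summable_scal, summable_INR_pow. lra.
Qed.

Lemma coef_term_bound (a : nat -> R) (z : R) (n : nat) : (forall n, Rabs (a n) <= 1) -> Rabs (a n * z) <= Rabs z.
Proof.
  intro ha. rewrite Rabs_mult. specialize (ha n). pose proof (Rabs_pos z). pose proof (Rabs_pos (a n)). nra.
Qed.

Lemma pser_summable (a : nat -> R) (z : R) : (forall n, Rabs (a n) <= 1) -> Rabs z < 1 -> summable (fun n => a n * z ^ n).
Proof.
  intros ha hz. apply summable_dom with (fun n => Rabs z ^ n).
  - intro n. rewrite RPow_abs. apply coef_term_bound, ha.
  - apply summable_geom. split; [apply Rabs_pos|exact hz].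
Qed.

Lemma pser_derive (a : nat -> R) (z : R) : (forall n, Rabs (a n) <= 1) -> Rabs z < 1 -> is_derive (pser a) z (dpser a z).
Proof.
  intros ha hz. pose proof (Rabs_pos z). set (r := (1 + Rabs z) / 2).
  apply (is_derive_Sum (fun y n => a n * y ^ n) (fun y n => a n * (INR n * y ^ pred n)) z ((1 - Rabs z) / 2) (fun n => INR n * r ^ pred n)).
  - lra.
  - apply summable_INR_pow_pred. unfold r; lra.
  - apply pser_summable; assumption.
  - intros y hy n. split; [auto_derive; [exact I|ring]|].
    eapply Rle_trans; [apply coef_term_bound, ha|]. rewrite Rabs_mult, (Rabs_pos_eq (INR n)) by apply pos_INR.
    apply Rmult_le_compat_l; [apply pos_INR|]. apply Rabs_pow_le; [|unfold r; lra|lia].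
    replace y with (z + (y - z)) by ring. eapply Rle_trans; [apply Rabs_triang|]. unfold r; lra.
Qed.

(** The binomial coefficients of (1 - z)^(-1/3). *)
Definition binc (n : nat) : R := poch (1 / 3) n / INR (fact n).

Lemma poch_pos (a : R) (n : nat) : 0 < a -> 0 < poch a n.
Proof.
  intro ha. induction n as [|n IH]; cbn [poch]; [lra|]. apply Rmult_lt_0_compat; [exact IH|]. pose proof (pos_INR n). lra.
Qed.

Lemma binc_S (n : nat) : (INR n + 1) * binc (S n) = (1 / 3 + INR n) * binc n.
Proof.
  unfold binc. cbn [poch]. rewrite fact_simpl, mult_INR, S_INR. pose proof (INR_fact_neq_0 n). pose proof (pos_INR n). field. lra.
Qed.

Lemma binc_bounds (n : nat) : 0 < binc n <= 1.
Proof.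
  split; [apply Rdiv_lt_0_compat; [apply poch_pos; lra|apply INR_fact_lt_0]|].
  induction n as [|n IH]; [unfold binc; simpl; lra|].
  assert (h := binc_S n). assert (0 < binc n) by (apply Rdiv_lt_0_compat; [apply poch_pos; lra|apply INR_fact_lt_0]). pose proof (pos_INR n). nra.
Qed.

Lemma binc_abs (n : nat) : Rabs (binc n) <= 1.
Proof. assert (h := binc_bounds n). rewrite Rabs_pos_eq; lra. Qed.

Lemma z_dpser (a : nat -> R) (z : R) : (forall n, Rabs (a n) <= 1) -> 0 <= z < 1 ->
  summable (fun n => a n * (INR n * z ^ n)) /\ Sum (fun n => a n * (INR n * z ^ n)) = z * dpser a z.
Proof.
  intros ha hz.
  assert (e : forall n, z * (a n * (INR n * z ^ pred n)) = a n * (INR n * z ^ n)).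
  { intros [|n]; [simpl; ring|]. simpl pred. simpl pow. ring. }
  assert (hs : summable (fun n => a n * (INR n * z ^ pred n))).
  { apply summable_dom with (fun n => INR n * ((1 + z) / 2) ^ pred n); [|apply summable_INR_pow_pred; lra].
    intro n. eapply Rle_trans; [apply coef_term_bound, ha|]. rewrite Rabs_mult, (Rabs_pos_eq (INR n)) by apply pos_INR.
    apply Rmult_le_compat_l; [apply pos_INR|]. apply Rabs_pow_le; [rewrite Rabs_pos_eq; lra|lra|lia]. }
  split; [apply summable_ext with (1 := e), summable_scal, hs|].
  rewrite <- (Sum_ext _ _ e), Sum_scal by exact hs. reflexivity.
Qed.

Lemma binc_ode (z : R) : 0 <= z < 1 -> (1 - z) * dpser binc z = 1 / 3 * pser binc z.
Proof.
  intro hz. destruct (z_dpser binc z binc_abs hz) as [h1 h2].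
  assert (hp : summable (fun n => binc n * z ^ n)) by (apply pser_summable; [apply binc_abs|rewrite Rabs_pos_eq; lra]).
  assert (hs : summable (fun n => binc n * (INR n * z ^ pred n))).
  { apply summable_dom with (fun n => INR n * ((1 + z) / 2) ^ pred n); [|apply summable_INR_pow_pred; lra].
    intro n. eapply Rle_trans; [apply coef_term_bound, binc_abs|]. rewrite Rabs_mult, (Rabs_pos_eq (INR n)) by apply pos_INR.
    apply Rmult_le_compat_l; [apply pos_INR|]. apply Rabs_pow_le; [rewrite Rabs_pos_eq; lra|lra|lia]. }
  assert (e : dpser binc z = 1 / 3 * pser binc z + z * dpser binc z).
  { rewrite <- h2. unfold dpser at 1. rewrite Sum_nat_shift by exact hs.
    rewrite (Sum_ext (fun i => binc (S i) * (INR (S i) * z ^ pred (S i))) (fun n => 1 / 3 * (binc n * z ^ n) + 1 * (binc n * (INR n * z ^ n)))).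
    - rewrite Sum_lin by assumption. unfold pser. simpl. ring.
    - intro n. simpl pred. rewrite S_INR. assert (h := binc_S n).
      transitivity ((INR n + 1) * binc (S n) * z ^ n); [ring|]. rewrite h. ring. }
  lra.
Qed.

Lemma Sum_nat_0 (a : nat -> R) : Sum (fun n => a n * 0 ^ n) = a O.
Proof.
  apply Sum_unique. replace (a O) with (lsum (fun n => a n * 0 ^ n) (O :: nil)) by (simpl; ring).
  apply is_sum_finite; [constructor; [intros []|constructor]|]. intros [|n] h; [destruct h; left; reflexivity|simpl; ring].
Qed.

(** The coefficient recurrence gives (1 - z) f' = f/3, so the product has derivative zero and keeps
    its value 1 at z = 0. *)
Lemma binomial_third (z : R) : 0 <= z < 1 -> pser binc z * Rpower (1 - z) (1 / 3) = 1.
Proof.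
  intro hz. set (h := fun y => pser binc y * Rpower (1 - y) (1 / 3)).
  assert (h0 : h 0 = 1).
  { unfold h, pser. rewrite Sum_nat_0. unfold binc, Rpower. rewrite Rminus_0_r, ln_1, Rmult_0_r, exp_0. simpl. field. }
  destruct (Req_dec z 0) as [->|nz]; [exact h0|].
  change (h z = 1). transitivity (h 0); [symmetry|exact h0].
  apply (eq_is_derive (V := R_NormedModule) h 0 z); [|lra]. intros y hy.
  assert (hd := pser_derive binc y binc_abs ltac:(rewrite Rabs_pos_eq; lra)).
  assert (ho := binc_ode y ltac:(lra)).
  assert (hr : is_derive (fun y => Rpower (1 - y) (1 / 3)) y (- (1 / 3 / (1 - y)) * Rpower (1 - y) (1 / 3))).
  { unfold Rpower. auto_derive; [lra|]. unfold Rminus. field. lra. }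
  assert (k := is_derive_mult (pser binc) (fun y => Rpower (1 - y) (1 / 3)) y _ _ hd hr Rmult_comm).
  change (is_derive h y 0).
  match type of k with is_derive _ _ ?v => assert (e : v = 0); [|rewrite <- e; exact k] end.
  unfold plus, mult; simpl.
  transitivity (Rpower (1 - y) (1 / 3) / (1 - y) * ((1 - y) * dpser binc y - 1 / 3 * pser binc y)); [field; lra|]. rewrite ho. ring.
Qed.

Definition hypc (n : nat) : R := poch (1 / 6) n * poch (1 / 3) n / (poch (7 / 6) n * INR (fact n)).

(** The Pochhammer quotient (1/6)_n/(7/6)_n telescopes to 1/(6n+1). Hence the operator 1 + 6 z d/dz
    sends this hypergeometric series to the binomial one. *)
Lemma hypc_binc (n : nat) : (1 + 6 * INR n) * hypc n = binc n.
Proof.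
  assert (h : (1 + 6 * INR n) * poch (1 / 6) n = poch (7 / 6) n).
  { induction n as [|n IH]; [simpl; ring|]. cbn [poch]. rewrite <- IH, S_INR. field. }
  assert (0 < poch (7 / 6) n) by (apply poch_pos; lra). pose proof (INR_fact_neq_0 n).
  unfold hypc, binc. transitivity (((1 + 6 * INR n) * poch (1 / 6) n) * poch (1 / 3) n / (poch (7 / 6) n * INR (fact n))); [field; lra|].
  rewrite h. field. lra.
Qed.

Lemma hypc_bounds (n : nat) : 0 < hypc n <= 1.
Proof.
  assert (h := hypc_binc n). assert (h2 := binc_bounds n). pose proof (pos_INR n).
  assert (0 < hypc n).
  { apply Rdiv_lt_0_compat; [apply Rmult_lt_0_compat; apply poch_pos; lra|]. apply Rmult_lt_0_compat; [apply poch_pos; lra|apply INR_fact_lt_0]. }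
  split; [assumption|nra].
Qed.

Lemma hypc_abs (n : nat) : Rabs (hypc n) <= 1.
Proof. assert (h := hypc_bounds n). rewrite Rabs_pos_eq; lra. Qed.

Lemma hyp2F1_pser (z : R) : 0 <= z < 1 -> hyp2F1 (1 / 6) (1 / 3) (7 / 6) z = pser hypc z.
Proof.
  intro hz. unfold hyp2F1, Series.
  assert (h := is_lim_seq_Sum _ (pser_summable hypc z hypc_abs ltac:(rewrite Rabs_pos_eq; lra))).
  apply is_lim_seq_unique in h. unfold hypc in h at 1. rewrite h. reflexivity.
Qed.

Lemma hypc_ode (z : R) : 0 <= z < 1 -> pser hypc z + 6 * (z * dpser hypc z) = pser binc z.
Proof.
  intro hz. destruct (z_dpser hypc z hypc_abs hz) as [h1 h2]. rewrite <- h2.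
  assert (hp : summable (fun n => hypc n * z ^ n)) by (apply pser_summable; [apply hypc_abs|rewrite Rabs_pos_eq; lra]).
  unfold pser. rewrite (Sum_ext (fun n => binc n * z ^ n) (fun n => 1 * (hypc n * z ^ n) + 6 * (hypc n * (INR n * z ^ n)))).
  - rewrite Sum_lin by assumption. ring.
  - intro n. rewrite <- hypc_binc. ring.
Qed.

Definition bk (k : R) : R := 3 * Rpower (2 * k) (1 / 3) * pser hypc (k ^ 2).

Lemma b_sing_bk (r : R) : 0 < r -> b_sing r = bk (kq (exp (- PI * sqrt r))).
Proof.
  intro hr. unfold b_sing. rewrite k_sing_exp by exact hr.
  assert (hq := exp_PI_sqrt_bounds r hr).
  destruct (kq_bounds _ hq) as [hk _]. rewrite hyp2F1_pser; [reflexivity|]. simpl; nra.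
Qed.

(** Differentiating the cube root and the series F in k^2 produces the combination F + 6 k^2 F',
    which [hypc_ode] turns into (1 - k^2)^(-1/3). *)
Lemma bk_derive (k : R) : 0 < k < 1 ->
  is_derive bk k (Rpower (2 * k) (1 / 3) / (k * Rpower (1 - k ^ 2) (1 / 3))).
Proof.
  intro hk. assert (hk2 : 0 <= k ^ 2 < 1) by (simpl; nra).
  assert (hd := pser_derive hypc (k ^ 2) hypc_abs ltac:(rewrite Rabs_pos_eq; lra)).
  assert (ho := hypc_ode (k ^ 2) hk2). assert (hb := binomial_third (k ^ 2) hk2).
  assert (d1 : is_derive (fun y => 3 * Rpower (2 * y) (1 / 3)) k (Rpower (2 * k) (1 / 3) / k)).
  { unfold Rpower. auto_derive; [lra|]. field. lra. }
  assert (d2 : is_derive (fun y => pser hypc (y ^ 2)) k (2 * k * dpser hypc (k ^ 2))).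
  { apply (is_derive_comp (pser hypc) (fun y => y ^ 2) k _ _ hd). auto_derive; [exact I|ring]. }
  assert (d := is_derive_mult _ _ _ _ _ d1 d2 Rmult_comm).
  unfold bk. replace (Rpower (2 * k) (1 / 3) / (k * Rpower (1 - k ^ 2) (1 / 3))) with
    (plus (mult (Rpower (2 * k) (1 / 3) / k) (pser hypc (k ^ 2))) (mult (3 * Rpower (2 * k) (1 / 3)) (2 * k * dpser hypc (k ^ 2)))); [exact d|].
  unfold plus, mult; simpl plus; simpl mult.
  assert (hp : 0 < Rpower (1 - k ^ 2) (1 / 3)) by apply exp_pos.
  assert (hb2 : pser binc (k ^ 2) = / Rpower (1 - k ^ 2) (1 / 3)).
  { apply Rmult_eq_reg_r with (Rpower (1 - k ^ 2) (1 / 3)); [|lra]. rewrite hb. field. lra. }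
  change (Rpower (2 * k) (1 / 3) / k * pser hypc (k ^ 2) + 3 * Rpower (2 * k) (1 / 3) * (2 * k * dpser hypc (k ^ 2)) = Rpower (2 * k) (1 / 3) / (k * Rpower (1 - k ^ 2) (1 / 3))).
  transitivity (Rpower (2 * k) (1 / 3) / k * pser binc (k ^ 2)); [rewrite <- ho; field; lra|]. rewrite hb2. field. lra.
Qed.

(** * The integral of F1 along the values of R *)

Lemma pow_inj_pos (x y : R) (n : nat) : 0 < x -> 0 < y -> x ^ S n = y ^ S n -> x = y.
Proof.
  intros hx hy h.
  assert (mono : forall a b, 0 < a < b -> a ^ S n < b ^ S n).
  { intros a b hab. clear h. induction n as [|n IH]; [simpl; lra|].
    change (a ^ S (S n)) with (a * a ^ S n). change (b ^ S (S n)) with (b * b ^ S n).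
    assert (0 < a ^ S n) by (apply pow_lt; lra). apply Rmult_le_0_lt_compat; lra. }
  destruct (Rtotal_order x y) as [l|[l|l]]; [|exact l|].
  - assert (k := mono x y ltac:(lra)). lra.
  - assert (k := mono y x ltac:(lra)). lra.
Qed.

Lemma Rpower_pow_n (x a : R) (n : nat) : 0 < x -> a * INR n = 1 -> Rpower x a ^ n = x.
Proof.
  intros hx ha. rewrite <- Rpower_pow by apply exp_pos. rewrite Rpower_mult, ha. apply Rpower_1, hx.
Qed.

Definition quint (t : R) : R := / t ^ 5 - 11 - t ^ 5.

Lemma quint_RR (q : R) : 0 < q < 1 -> 0 < quint (RR q).
Proof.
  intro hq. unfold quint. rewrite RR_quintic by exact hq.
  apply Rdiv_lt_0_compat; [apply pow_lt, eulerT_pos, hq|]. apply Rmult_lt_0_compat; [lra|apply pow_lt, eulerT_pos, pow5_bounds, hq].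
Qed.

Definition dRR (q : R) : R := RR q / (5 * q) * (eulerT q ^ 5 / eulerT (q ^ 5)).

Lemma dRR_pos (q : R) : 0 < q < 1 -> 0 < dRR q.
Proof.
  intro hq. apply Rmult_lt_0_compat.
  - apply Rdiv_lt_0_compat; [apply RR_pos, hq|lra].
  - apply Rdiv_lt_0_compat; [apply pow_lt, eulerT_pos, hq|apply eulerT_pos, pow5_bounds, hq].
Qed.

(* Both sides are (1/q) q^(1/6) eulerT(q)^4; positivity allows a comparison of sixth powers. *)
Lemma bk_kq_derive (q : R) : 0 < q < 1 ->
  is_derive (fun y => bk (kq y)) q (5 * (F1_integrand (RR q) * dRR q)).
Proof.
  intro hq. destruct (kq_bounds q hq) as [hk ek]. assert (hkp := kpq_pos q hq). assert (h4 := th4_pos q hq).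
  assert (d := is_derive_comp bk kq q _ _ (bk_derive _ hk) (kq_derive q hq)).
  assert (hT := eulerT_pos q hq). assert (hT5 := eulerT_pos _ (pow5_bounds q hq)). assert (hR := RR_pos q hq).
  assert (hX := quint_RR q hq). assert (eX := RR_quintic q hq). fold (quint (RR q)) in eX.
  match type of d with is_derive _ _ ?v => assert (e : v = 5 * (F1_integrand (RR q) * dRR q)); [|rewrite <- e; exact d] end.
  change (kq q * Lq q / q * (Rpower (2 * kq q) (1 / 3) / (kq q * Rpower (1 - kq q ^ 2) (1 / 3))) = 5 * (F1_integrand (RR q) * dRR q)).
  rewrite Lq_th4 by exact hq.
  unfold F1_integrand, dRR. change (/ RR q ^ 5 - 11 - RR q ^ 5) with (quint (RR q)).
  set (k := kq q) in *. set (T := eulerT q) in *. set (T5 := eulerT (q ^ 5)) in *. set (t := th4 q) in *. set (Rq := RR q) in *.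
  assert (hk2 : 0 < 1 - k ^ 2) by (simpl; nra).
  assert (p1 : 0 < Rpower (2 * k) (1 / 3)) by apply exp_pos. assert (p2 : 0 < Rpower (1 - k ^ 2) (1 / 3)) by apply exp_pos.
  assert (p3 : 0 < Rpower (quint Rq) (1 / 6)) by apply exp_pos.
  assert (c1 : Rpower (2 * k) (1 / 3) ^ 3 = 2 * k) by (apply Rpower_pow_n; [lra|simpl; field]).
  assert (c2 : Rpower (1 - k ^ 2) (1 / 3) ^ 3 = 1 - k ^ 2) by (apply Rpower_pow_n; [lra|simpl; field]).
  assert (c3 : Rpower (quint Rq) (1 / 6) ^ 6 = quint Rq) by (apply Rpower_pow_n; [exact hX|simpl; field]).
  set (A := Rpower (2 * k) (1 / 3)) in *. set (B := Rpower (1 - k ^ 2) (1 / 3)) in *. set (S6 := Rpower (quint Rq) (1 / 6)) in *.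
  assert (ekp : kpq q ^ 2 = 1 - k ^ 2) by (assert (h := kq_kpq q hq); fold k in h; lra).
  assert (hKT := kq_eulerT q hq). fold k t T in hKT. rewrite ekp in hKT.
  assert (es : sqrt q ^ 2 = q) by (apply pow2_sqrt; lra).
  (* The index 5 means sixth powers, which clear the cube roots [A], [B] and the sixth root [S6]
     together. *)
  apply (pow_inj_pos _ _ 5).
  - apply Rmult_lt_0_compat; [|apply Rdiv_lt_0_compat; [exact p1|apply Rmult_lt_0_compat; lra]].
    apply Rdiv_lt_0_compat; [|lra]. apply Rmult_lt_0_compat; [lra|]. apply Rdiv_lt_0_compat; [apply pow_lt; lra|lra].
  - apply Rmult_lt_0_compat; [lra|]. apply Rmult_lt_0_compat; [apply Rinv_0_lt_compat, Rmult_lt_0_compat; lra|].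
    apply Rmult_lt_0_compat; [apply Rdiv_lt_0_compat; lra|]. apply Rdiv_lt_0_compat; [apply pow_lt; lra|lra].
  - transitivity ((A ^ 3) ^ 2 * (t ^ 12) ^ 2 / (64 * q ^ 6 * (B ^ 3) ^ 2)); [field; lra|]. rewrite c1, c2.
    transitivity ((k / (1 - k ^ 2) * t ^ 12) ^ 2 / (16 * q ^ 6)); [field; lra|]. rewrite hKT.
    transitivity (sqrt q ^ 2 * T ^ 24 / q ^ 6); [field; lra|]. rewrite es.
    symmetry. transitivity (T ^ 30 / (q ^ 6 * T5 ^ 6 * S6 ^ 6)); [field; lra|]. rewrite c3, eX. field. lra.
Qed.

Lemma increasing_of_derive (f df : R -> R) (a b : R) : a < b ->
  (forall x, a <= x <= b -> is_derive f x (df x) /\ 0 < df x) -> f a < f b.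
Proof.
  intros hab h. destruct (MVT_gen f a b df) as [c [hc e]].
  - intros x hx. rewrite Rmin_left, Rmax_right in hx by lra. apply h. lra.
  - intros x hx. rewrite Rmin_left, Rmax_right in hx by lra. apply continuity_pt_filterlim.
    apply (ex_derive_continuous f). exists (df x). apply h. lra.
  - rewrite Rmin_left, Rmax_right in hc by lra. destruct (h c hc) as [_ hp]. nra.
Qed.

Lemma RR_increasing (p q : R) : 0 < p < q -> q < 1 -> RR p < RR q.
Proof.
  intros hp hq. apply (increasing_of_derive RR dRR); [lra|]. intros x hx.
  split; [apply RR_derive; lra|apply dRR_pos; lra].
Qed.

Lemma RR_inj (p q : R) : 0 < p < 1 -> 0 < q < 1 -> RR p = RR q -> p = q.
Proof.
  intros hp hq e. destruct (Rtotal_order p q) as [h|[h|h]]; [|exact h|].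
  - assert (k := RR_increasing p q ltac:(lra) ltac:(lra)). lra.
  - assert (k := RR_increasing q p ltac:(lra) ltac:(lra)). lra.
Qed.

(** Each factor of B/A is at most 1, since q + q^4 - q^2 - q^3 = q (1-q)(1-q^2) >= 0. The bound
    makes R tend to 0 with q, which the improper integral needs. *)
Lemma RR_le_q5 (q : R) : 0 < q < 1 -> RR q <= q5 q.
Proof.
  intro hq. rewrite RR_theta, thB_div_thA by exact hq. fold (q5 q). assert (h5 := q5_bounds q hq).
  assert (h : exp (Sum (lfac q)) <= exp 0).
  { apply exp_le. assert (hz : Sum (fun _ : nat => 0) = 0) by (apply Sum_unique, (is_sum_finite _ nil); [constructor|reflexivity]).
    rewrite <- hz. apply Sum_le; [|apply summable_lfac, hq|apply (summable_finite _ nil); reflexivity].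
    intro i. rewrite <- (ln_exp (lfac q i)), exp_lfac, <- ln_1 by exact hq.
    assert (p1 := one_minus_pow_pos q (5 * i + 1) hq ltac:(lia)). assert (p2 := one_minus_pow_pos q (5 * i + 2) hq ltac:(lia)).
    assert (p3 := one_minus_pow_pos q (5 * i + 3) hq ltac:(lia)). assert (p4 := one_minus_pow_pos q (5 * i + 4) hq ltac:(lia)).
    apply ln_le_mono; [apply Rdiv_lt_0_compat; apply Rmult_lt_0_compat; assumption|].
    apply Rmult_le_reg_r with ((1 - q ^ (5 * i + 3)) * (1 - q ^ (5 * i + 2))); [apply Rmult_lt_0_compat; assumption|].
    unfold Rdiv. rewrite Rmult_assoc, Rinv_l by (apply Rgt_not_eq, Rmult_lt_0_compat; assumption).
    rewrite !(pow_add q (5 * i)). assert (hy : 0 < q ^ (5 * i)) by (apply pow_lt; lra).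
    assert (hc : 0 <= q * (1 - q) * (1 - q ^ 2)) by (apply Rmult_le_pos; [nra|simpl; nra]).
    set (y := q ^ (5 * i)) in *.
    assert (y * (q * (1 - q) * (1 - q ^ 2)) >= 0) by (apply Rle_ge, Rmult_le_pos; lra).
    replace (y * (q * (1 - q) * (1 - q ^ 2))) with (y * (q ^ 1 + q ^ 4 - q ^ 2 - q ^ 3)) in H by ring.
    replace ((1 - y * q ^ 1) * (1 - y * q ^ 4)) with (1 - y * (q ^ 1 + q ^ 4) + y ^ 2 * q ^ 5) by ring.
    replace (1 * ((1 - y * q ^ 3) * (1 - y * q ^ 2))) with (1 - y * (q ^ 2 + q ^ 3) + y ^ 2 * q ^ 5) by ring. lra. }
  rewrite exp_0 in h. rewrite <- (Rmult_1_r (q5 q)) at 2. apply Rmult_le_compat_l; lra.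
Qed.

Lemma quint_decr (s t : R) : 0 < s <= t -> quint t <= quint s.
Proof.
  intro h. unfold quint. assert (s ^ 5 <= t ^ 5) by (apply pow_incr; lra). assert (0 < s ^ 5) by (apply pow_lt; lra).
  assert (/ t ^ 5 <= / s ^ 5) by (apply Rinv_le_contravar; assumption). lra.
Qed.

Lemma F1_integrand_pos (t : R) : 0 < t -> 0 < F1_integrand t.
Proof. intro h. apply Rinv_0_lt_compat, Rmult_lt_0_compat; [exact h|apply exp_pos]. Qed.

Lemma F1_integrand_continuous (t : R) : 0 < t -> 0 < quint t -> continuous F1_integrand t.
Proof.
  intros h1 h2. apply (ex_derive_continuous F1_integrand). unfold F1_integrand, Rpower. unfold quint in h2. auto_derive.
  simpl in *. repeat split; try lra.
  - apply Rgt_not_eq. repeat apply Rmult_lt_0_compat; lra.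
  - apply Rgt_not_eq, Rmult_lt_0_compat; [exact h1|apply exp_pos].
Qed.

Definition bq (q : R) : R := bk (kq q).

(** By [bk_kq_derive], the integral from R(x) to R(q) plus b(x)/5 has derivative zero in x; its
    values at p and q are compared. *)
Lemma bq_integral (p q : R) : 0 < p <= q -> q < 1 ->
  is_RInt F1_integrand (RR p) (RR q) ((bq q - bq p) / 5).
Proof.
  (* A point beyond q leaves room to the right of R(q), so that the integrals exist in a
     neighbourhood of each endpoint R(x), x = q included. *)
  intros hp hq. set (q1 := (q + 1) / 2). assert (h1 : q < q1 < 1) by (unfold q1; lra).
  assert (cont : forall t, 0 < t <= RR q1 -> continuous F1_integrand t).
  { intros t ht. apply F1_integrand_continuous; [lra|]. eapply Rlt_le_trans; [apply (quint_RR q1); lra|]. apply quint_decr. exact ht. }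
  assert (mono : forall x y, 0 < x <= y -> y < 1 -> RR x <= RR y).
  { intros x y h2 h3. destruct (Req_dec x y) as [->|ne]; [lra|]. left. apply RR_increasing; lra. }
  assert (ex : forall a b, 0 < a <= RR q1 -> 0 < b <= RR q1 -> ex_RInt F1_integrand a b).
  { intros a b ha hb. apply (ex_RInt_continuous (V := R_CompleteNormedModule)). intros z hz. apply cont.
    revert hz. unfold Rmin, Rmax. destruct (Rle_dec a b); lra. }
  assert (pq := RR_pos q ltac:(lra)). assert (lq := RR_increasing q q1 ltac:(lra) ltac:(lra)).
  set (G := fun x => RInt F1_integrand (RR x) (RR q) + bq x / 5).
  assert (hG : forall x, p <= x <= q -> is_derive G x 0).
  { intros x hx. assert (px := RR_pos x ltac:(lra)). assert (lx := mono x q ltac:(lra) ltac:(lra)).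
    assert (d1 : is_derive (fun y => RInt F1_integrand y (RR q)) (RR x) (opp (F1_integrand (RR x)))).
    { apply (is_derive_RInt' (V := R_NormedModule) F1_integrand (fun y => RInt F1_integrand y (RR q)) (RR x) (RR q)); [|apply cont; lra].
      assert (hd : 0 < Rmin (RR x) (RR q1 - RR q)) by (apply Rmin_glb_lt; lra).
      exists (mkposreal _ hd). intros y hy. change (Rabs (y - RR x) < Rmin (RR x) (RR q1 - RR q)) in hy. apply Rabs_def2 in hy.
      assert (m1 := Rmin_l (RR x) (RR q1 - RR q)). assert (m2 := Rmin_r (RR x) (RR q1 - RR q)).
      apply (RInt_correct (V := R_CompleteNormedModule)). apply ex; lra. }
    assert (d2 := is_derive_comp _ RR x _ _ d1 (RR_derive x ltac:(lra))). fold (dRR x) in d2.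
    assert (d3 : is_derive (fun y => bq y / 5) x (F1_integrand (RR x) * dRR x)).
    { replace (F1_integrand (RR x) * dRR x) with (/ 5 * (5 * (F1_integrand (RR x) * dRR x))) by field.
      apply is_derive_ext with (fun y => / 5 * bq y); [intro; unfold Rdiv; apply Rmult_comm|].
      apply is_derive_scal. apply bk_kq_derive. lra. }
    assert (d := is_derive_plus _ _ _ _ _ d2 d3). unfold G.
    replace 0 with (plus (scal (dRR x) (opp (F1_integrand (RR x)))) (F1_integrand (RR x) * dRR x)); [exact d|].
    unfold plus, scal, opp; simpl; unfold mult; simpl. ring. }
  assert (pp := RR_pos p ltac:(lra)). assert (lp := mono p q hp hq).
  assert (eG : G p = G q).
  { destruct (Req_dec p q) as [->|ne]; [reflexivity|]. apply (eq_is_derive (V := R_NormedModule) G p q); [|lra]. exact hG. }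
  unfold G in eG. rewrite RInt_point in eG. unfold zero in eG; simpl in eG.
  replace ((bq q - bq p) / 5) with (RInt F1_integrand (RR p) (RR q)) by lra.
  apply (RInt_correct (V := R_CompleteNormedModule)). apply ex; lra.
Qed.

Lemma kq_increasing (p q : R) : 0 < p < q -> q < 1 -> kq p < kq q.
Proof.
  intros hp hq. apply (increasing_of_derive kq (fun x => kq x * Lq x / x)); [lra|]. intros x hx.
  split; [apply kq_derive; lra|]. rewrite Lq_th4 by lra. assert (h1 := kq_pos x ltac:(lra)). assert (h2 := th4_pos x ltac:(lra)).
  apply Rdiv_lt_0_compat; [|lra]. apply Rmult_lt_0_compat; [exact h1|]. apply Rdiv_lt_0_compat; [apply pow_lt; exact h2|lra].
Qed.

Lemma bq_small (eps : R) : 0 < eps -> exists d, 0 < d < 1 /\ forall q, 0 < q < d -> 0 <= bq q < eps.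
Proof.
  (* For k below m the square k^2 is at most 1/2, so the series is at most 2; and 2k < (eps/6)^3
     puts the cube root below eps/6. Then 3 * (eps/6) * 2 = eps. *)
  intro he. set (m := Rmin (1 / 2) ((eps / 6) ^ 3 / 2)).
  assert (he3 : 0 < (eps / 6) ^ 3) by (apply pow_lt; lra).
  assert (hm : 0 < m) by (unfold m; apply Rmin_glb_lt; lra).
  destruct (proj2 (is_lim_seq_spec _ _) (kq_qsq_lim (1 / 2) ltac:(lra)) (mkposreal _ hm)) as [N hN].
  assert (hd := qsq_unit (1 / 2) N ltac:(lra)).
  exists (qsq (1 / 2) N). split; [exact hd|]. intros q hq.
  specialize (hN N (Nat.le_refl _)). simpl in hN. rewrite Rminus_0_r, Rabs_pos_eq in hN by (apply Rlt_le, kq_pos, hd).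
  assert (hk := kq_pos q ltac:(lra)). assert (hlt := kq_increasing q _ ltac:(exact hq) ltac:(lra)).
  assert (m1 : m <= 1 / 2) by apply Rmin_l. assert (m2 : m <= (eps / 6) ^ 3 / 2) by apply Rmin_r.
  unfold bq, bk. set (k := kq q) in *. assert (hk2 : 0 <= k ^ 2 <= 1 / 2) by (simpl; nra).
  assert (hs : summable (fun n => hypc n * (k ^ 2) ^ n)) by (apply pser_summable; [apply hypc_abs|rewrite Rabs_pos_eq; lra]).
  assert (f0 : 0 <= pser hypc (k ^ 2)).
  { eapply Rle_trans; [|apply (Sum_ge_lsum _ nil); [|exact hs|constructor]]; [simpl; lra|].
    intro n. apply Rmult_le_pos; [left; apply hypc_bounds|apply pow_le; lra]. }
  assert (f1 : pser hypc (k ^ 2) <= 2).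
  { replace 2 with (Sum (fun n => (1 / 2) ^ n)) by (rewrite Sum_geom by lra; field).
    apply Sum_le; [|exact hs|apply summable_geom; lra]. intro n. assert (hc := hypc_bounds n).
    assert (0 <= (k ^ 2) ^ n) by (apply pow_le; lra). assert ((k ^ 2) ^ n <= (1 / 2) ^ n) by (apply pow_incr; lra). nra. }
  assert (p0 : 0 < Rpower (2 * k) (1 / 3)) by apply exp_pos.
  assert (p1 : Rpower (2 * k) (1 / 3) < eps / 6).
  { assert (c : Rpower (2 * k) (1 / 3) ^ 3 = 2 * k) by (apply Rpower_pow_n; [lra|simpl; field]).
    apply Rnot_le_lt. intro hl. assert ((eps / 6) ^ 3 <= Rpower (2 * k) (1 / 3) ^ 3) by (apply pow_incr; lra). lra. }
  split; [apply Rmult_le_pos; [lra|exact f0]|].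
  apply Rle_lt_trans with (3 * Rpower (2 * k) (1 / 3) * 2); [apply Rmult_le_compat_l; lra|lra].
Qed.

Lemma RR_onto (q a : R) : 0 < q < 1 -> 0 < a < RR q -> exists p, 0 < p < q /\ RR p = a.
Proof.
  intros hq ha. assert (h1 : RR q <= q5 q) by (apply RR_le_q5, hq). assert (h5 := q5_bounds q hq).
  (* At this point the fifth root is a/2, so R(p0) <= a/2 < a, which is the lower end for the
     intermediate value theorem. *)
  set (p0 := (a / 2) ^ 5). assert (ha2 : 0 < a / 2 < 1) by lra.
  assert (hp0 : 0 < p0 < 1) by (apply pow5_bounds, ha2).
  assert (l0 : RR p0 < a).
  { apply Rle_lt_trans with (q5 p0); [apply RR_le_q5, hp0|].
    assert (e : q5 p0 = a / 2); [|lra]. apply (pow_inj_pos _ _ 4); [apply q5_bounds, hp0|lra|]. rewrite q5_pow5 by lra. reflexivity. }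
  assert (hlt : p0 < q).
  { apply Rnot_le_lt. intro hl. destruct hl as [hl|hl]; [|subst; lra].
    assert (k := RR_increasing q p0 ltac:(lra) ltac:(lra)). lra. }
  destruct (Ranalysis5.IVT_interv (fun x => RR x - a) p0 q) as [p [hp e]]; [|exact hlt|lra|lra|].
  - intros x hx. apply continuity_pt_filterlim. apply (ex_derive_continuous (fun x => RR x - a)).
    apply (ex_derive_minus (V := R_NormedModule)); [exists (dRR x); apply RR_derive; lra|apply ex_derive_const].
  - exists p. split; [|lra]. split; [lra|]. destruct hp as [_ [hp| ->]]; [exact hp|]. lra.
Qed.

(** A lower endpoint near 0 is R(p) for a small p by [RR_onto]; the part of the integral still
    missing is b(p)/5, which is small by [bq_small]. *)
Lemma RR_RInt_gen (q : R) : 0 < q < 1 ->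
  is_RInt_gen F1_integrand (at_right 0) (at_point (RR q)) (bq q / 5).
Proof.
  intros hq P [[eps he] hP].
  destruct (bq_small eps he) as [d [hd hb]].
  set (e := Rmin d q). assert (hE : 0 < e) by (unfold e; apply Rmin_glb_lt; lra).
  assert (e1 : e <= d) by apply Rmin_l. assert (e2 : e <= q) by apply Rmin_r.
  assert (hRe := RR_pos e ltac:(lra)).
  apply Filter_prod with (fun a => 0 < a < RR e) (fun b => b = RR q).
  - exists (mkposreal _ hRe). intros y hy hy0. change (Rabs (y - 0) < RR e) in hy. rewrite Rminus_0_r in hy.
    apply Rabs_def2 in hy. lra.
  - reflexivity.
  - intros a b ha ->. destruct (RR_onto e a ltac:(lra) ha) as [p [hp <-]].
    exists ((bq q - bq p) / 5). split; [apply bq_integral; lra|]. apply hP.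
    change (Rabs ((bq q - bq p) / 5 - bq q / 5) < eps). assert (h := hb p ltac:(lra)).
    replace ((bq q - bq p) / 5 - bq q / 5) with (- (bq p / 5)) by field. rewrite Rabs_Ropp, Rabs_pos_eq; lra.
Qed.

Lemma F1_unique (u v l : R) : 0 < u < v -> (forall t, 0 < t <= v -> 0 < quint t) ->
  is_RInt_gen F1_integrand (at_right 0) (at_point u) l ->
  is_RInt_gen F1_integrand (at_right 0) (at_point v) l -> False.
Proof.
  intros huv hv h1 h2.
  assert (cont : forall t, u <= t <= v -> continuous F1_integrand t).
  { intros t ht. apply F1_integrand_continuous; [lra|apply hv; lra]. }
  assert (ex : ex_RInt F1_integrand u v).
  { apply (ex_RInt_continuous (V := R_CompleteNormedModule)). intros z hz. rewrite Rmin_left, Rmax_right in hz by lra. apply cont, hz. }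
  assert (h3 := RInt_correct (V := R_CompleteNormedModule) _ _ _ ex).
  apply (proj2 (is_RInt_gen_at_point (V := R_NormedModule) F1_integrand u v _)) in h3.
  assert (h4 := is_RInt_gen_Chasles (V := R_NormedModule) F1_integrand u _ _ h1 h3).
  assert (e1 := is_RInt_gen_unique (V := R_CompleteNormedModule) F1_integrand _ h2).
  assert (e2 := is_RInt_gen_unique (V := R_CompleteNormedModule) F1_integrand _ h4).
  assert (e : l = l + RInt F1_integrand u v) by (transitivity (RInt_gen F1_integrand (at_right 0) (at_point v)); [symmetry; exact e1|exact e2]).
  assert (p : 0 < RInt F1_integrand u v).
  { apply RInt_gt_0; [lra| |exact cont]. intros t ht. apply F1_integrand_pos. lra. }
  lra.
Qed.

(** R meets the specification of [F1], whose positivity clause on (0, u] holds because t^(-5) - 11 -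
    t^5 decreases. For uniqueness the two candidates are compared, and the larger one provides the
    positivity that [F1_unique] asks for. *)
Lemma F1_b_sing (r : R) : 0 < r -> F1 (b_sing r) = RR (exp (- PI * sqrt r)).
Proof.
  intro hr. assert (hq := exp_PI_sqrt_bounds r hr). rewrite b_sing_bk by exact hr. set (q := exp (- PI * sqrt r)) in *.
  fold (bq q). assert (hR := RR_pos q hq).
  assert (hv : forall t, 0 < t <= RR q -> 0 < quint t).
  { intros t ht. eapply Rlt_le_trans; [apply (quint_RR q hq)|]. apply quint_decr. exact ht. }
  assert (spec : 0 < F1 (bq q) /\ (forall t, 0 < t <= F1 (bq q) -> 0 < / t ^ 5 - 11 - t ^ 5) /\
     is_RInt_gen F1_integrand (at_right 0) (at_point (F1 (bq q))) (bq q / 5)).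
  { unfold F1. apply epsilon_spec. exists (RR q). split; [exact hR|]. split; [exact hv|apply RR_RInt_gen, hq]. }
  destruct spec as [h1 [h2 h3]].
  destruct (Rtotal_order (F1 (bq q)) (RR q)) as [h|[h|h]]; [exfalso|exact h|exfalso].
  - apply (F1_unique _ _ _ (conj h1 h) hv h3). apply RR_RInt_gen, hq.
  - apply (F1_unique _ _ _ (conj hR h) h2 (RR_RInt_gen q hq) h3).
Qed.

(** * The maps H_n and their inverses *)

Lemma RR_exp_inj (r s : R) : 0 < r -> 0 < s -> RR (exp (- PI * sqrt r)) = RR (exp (- PI * sqrt s)) -> r = s.
Proof.
  intros hr hs e. apply RR_inj in e; [|apply exp_PI_sqrt_bounds; assumption|apply exp_PI_sqrt_bounds; assumption].
  apply exp_inv in e. pose proof PI_RGT_0. apply Rmult_eq_reg_l in e; [|lra]. apply sqrt_inj; lra.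
Qed.

(** The argument r selected inside [Omega] satisfies R(e^{-pi sqrt r}) = R(e^{-pi sqrt y}), and
    injectivity forces r = y. *)
Lemma H_eq (n y : R) : 0 < y -> H n y = RR (exp (- PI * (1 / n) * sqrt y)).
Proof.
  intro hy. unfold H, Omega. rewrite F1_b_sing by exact hy.
  set (r := epsilon (inhabits 0) (fun r => 0 < r /\ RR (exp (- PI * sqrt r)) = RR (exp (- PI * sqrt y)))).
  assert (spec : 0 < r /\ RR (exp (- PI * sqrt r)) = RR (exp (- PI * sqrt y))).
  { unfold r. apply epsilon_spec. exists y. split; [exact hy|reflexivity]. }
  destruct spec as [h1 h2]. apply RR_exp_inj in h2; [|exact h1|exact hy]. rewrite h2. reflexivity.
Qed.

Lemma H_scaled (n m : R) : 0 < n -> 0 < m -> H n (n ^ 2 * m) = RR (exp (- PI * sqrt m)).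
Proof.
  intros hn hm. assert (hn2 : 0 < n ^ 2) by (apply pow_lt; exact hn).
  rewrite H_eq by (apply Rmult_lt_0_compat; assumption). do 2 f_equal.
  rewrite sqrt_mult, sqrt_pow2 by lra. field. lra.
Qed.

Lemma Hinv_scaled (n m : R) : 0 < n -> 0 < m -> Hinv n (RR (exp (- PI * sqrt m))) = n ^ 2 * m.
Proof.
  intros hn hm. assert (hn2 : 0 < n ^ 2) by (apply pow_lt; exact hn).
  set (X := Hinv n (RR (exp (- PI * sqrt m)))).
  assert (spec : 0 < X /\ H n X = RR (exp (- PI * sqrt m))).
  { unfold X, Hinv. apply epsilon_spec. exists (n ^ 2 * m). split; [apply Rmult_lt_0_compat; assumption|apply H_scaled; assumption]. }
  destruct spec as [h1 h2].
  assert (hX : 0 < X / n ^ 2) by (apply Rdiv_lt_0_compat; assumption).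
  replace X with (n ^ 2 * (X / n ^ 2)) in h2 by (field; lra). rewrite H_scaled in h2 by assumption.
  apply RR_exp_inj in h2; [|exact hX|exact hm]. rewrite <- h2. field. lra.
Qed.

Theorem theorem7 (G mG : R -> R) (n x : R) :
  smooth G ->
  0 < n ->
  mG_def G mG x ->
  mG_def G mG (n ^ 2 * x) ->
  yfun mG (n ^ 2 * x) =
    H n (n ^ 2 * Q G mG n (/ n ^ 2 * Hinv n (yfun mG x))).
Proof.
  intros _ hn [hm hint] [hM _]. assert (hn2 : 0 < n ^ 2) by (apply pow_lt; exact hn).
  unfold yfun at 2. rewrite Hinv_scaled by assumption.
  replace (/ n ^ 2 * (n ^ 2 * mG x)) with (mG x) by (field; lra).
  (* The implicit definition of m_G enters here: the improper integral from sqrt(m_G(x)) has the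
     value x/pi, so the explicit inverse returns x and Q_{n^2} at m_G(x) is m_G(n^2 x). *)
  assert (e : mG_inv G (mG x) = x).
  { unfold mG_inv. rewrite (is_RInt_gen_unique _ _ hint). pose proof PI_RGT_0. field. lra. }
  unfold Q. rewrite e, H_scaled by assumption. reflexivity.
Qed.
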